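(* Let $d\ge 1$. For any $k\in\{0,1,\dots,d\}$, the $k$-th discrete intrinsic volume $A_k(\cdot)$ is a translation-invariant valuation on $\mathcal P(\mathbb Z^d)$. Furthermore, for all $P\in\mathcal P(\mathbb Z^d)$ we have: (1) $A_0(P)=1$ if $P\neq\emptyset$; (2) $A_d(P)=A(P)$; (3) for $k\in\{0,1,\dots,d\}$, if $\dim P<k$, then $A_k(P)=0$; (4) $\lim_{n\to\infty}\dfrac{A_k(nP)}{n^k}=V_k(P)$ for $k=0,1,\dots,d$, where $n$ ranges over positive integers.
   Context: $\mathcal P(\mathbb Z^d)$ is the set of all convex lattice polytopes in $\mathbb R^d$ (convex hulls of finitely many points of $\mathbb Z^d$), including the empty set. $\dim P$ is the dimension of the affine hull $\operatorname{aff}P$ (with $\dim\emptyset=0$). $|P|$ is the $(\dim P)$-dimensional Lebesgue measure of $P$ (so $|P|=1$ for a point, $|\emptyset|=0$). $nP=\{n u:u\in P\}$. A function $\varphi:\mathcal P(\mathbb Z^d)\to\mathbb R$ is a valuation if $\varphi(\emptyset)=0$ and $\varphi(P\cup Q)=\varphi(P)+\varphi(Q)-\varphi(P\cap Q)$ for all $P,Q\in\mathcal P(\mathbb Z^d)$ with $P\cup Q\in\mathcal P(\mathbb Z^d)$. It is translation-invariant if $\varphi(t+P)=\varphi(P)$ for all $P\in\mathcal P(\mathbb Z^d)$, $t\in\mathbb Z^d$. $\mathcal F_k(P)$ is the set of (nonempty) $k$-dimensional faces of $P$ ($P$ itself is a face of $P$). For a lattice polytope $F$ of dimension $k$, $\det(F)$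 is the determinant (covolume in $\operatorname{aff}F$) of the $k$-dimensional lattice $\mathbb Z^d\cap\operatorname{aff}F$ (up to translation), with $\det(F)=1$ if $F$ is a point. For a polyhedral cone $C$, the solid angle $\alpha(C)$ is the probability that a random vector uniformly distributed on the unit sphere of the linear hull of $C$ lies in $C$; $\alpha(\{0\})=1$. For $v\in P$, the tangent cone is $T_v(P)=\operatorname{pos}(P-v)=\{\lambda(x-v):x\in P,\lambda\ge0\}$. For a face $F$ of $P$, $T_F(P)=T_v(P)$ for any $v$ in the relative interior of $F$, and the normal cone $N_F(P)$ is the polar cone $T_F(P)^\circ=\{w\in\mathbb R^d:\langle w,x\rangle\le0\ \forall x\in T_F(P)\}$. The $k$-th discrete intrinsic volume is $$A_k(P)=\sum_{v\in P\cap\mathbb Z^d}\ \sum_{F\in\mathcal F_k(P)}\mathbf 1[v\in F]\,\det(F)\,\alpha(N_F(P))\,\alpha(T_v(F)).$$ The solid-angle valuation is $A(P)=\sum_{v\in P\cap\mathbb Z^d}\alpha(T_v(P))$ if $\dim P=d$, and $A(P)=0$ otherwise. The $k$-th intrinsic volume of $P$ is $V_k(P)=\sum_{F\in\mathcal F_k(P)}\alpha(N_F(P))\,|F|$. *)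

(* Defs.v *)
From HB Require Import structures.
From mathcomp Require Import all_boot all_order all_algebra.
From mathcomp Require Import all_classical all_reals all_analysis.

Set Implicit Arguments.
Unset Strict Implicit.
Unset Printing Implicit Defensive.
Import Order.TTheory GRing.Theory Num.Theory.
Local Open Scope classical_set_scope.
Local Open Scope ring_scope.

Section lebesgue.
Context {R : realType}.

Fixpoint lebesgue_tuple (n : nat) :
    set (n.-tuple (measurableTypeR R)) -> \bar R :=
  match n with
  | 0 => dirac [tuple]
  | m.+1 => pushforward (product_measure1 lebesgue_measure (@lebesgue_tuple m))
              (fun p => [tuple of p.1 :: p.2])
  end.

Definition lebesgue_rV (n : nat) (A : set 'rV[R]_n) : \bar R :=
  lebesgue_tuple [set t : n.-tuple (measurableTypeR R) |
                   A (\row_i (tnth t i : R))].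

End lebesgue.

Section euclidean.
Context {R : realType} {d : nat}.
Notation E := 'rV[R]_d.
Implicit Types (L : {vspace E}) (S A : set E).

Definition dotr (x y : E) : R := (x *m y^T) 0 0.

(* The library norm on matrices is the sup norm. *)
Definition enorm (x : E) : R := Num.sqrt (dotr x x).

Definition lin S : {vspace E} :=
  xget 0%VS [set U : {vspace E} | S `<=` [set` U] /\
    forall W : {vspace E}, S `<=` [set` W] -> (U <= W)%VS].

Definition aff S : set E :=
  [set x | exists (n : nat) (c : 'I_n -> R) (v : 'I_n -> E),
    [/\ forall i, S (v i), \sum_(i < n) c i = 1
      & x = \sum_(i < n) c i *: v i]].

Definition dirspace S : {vspace E} := lin [set x - y | x in aff S & y in aff S].

(* dirspace set0 = 0, so the empty set has dimension 0. *)
Definition adim S : nat := \dim (dirspace S).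

Definition orthonormal_basis L : 'M[R]_(\dim L, d) :=
  xget 0 [set B : 'M[R]_(\dim L, d) | B *m B^T = 1%:M /\
    forall x : E, x \in L <-> (x <= B)%MS].

(* (\dim L)-dimensional Lebesgue measure of A `&` L, through orthonormal
   coordinates of L. *)
Definition vol_in L A : R :=
  fine (lebesgue_rV [set y : 'rV[R]_(\dim L) | A (y *m orthonormal_basis L)]).

(* Translates S by one of its points, into dirspace S. *)
Definition rvol S : R :=
  vol_in (dirspace S) [set x - xget 0 S | x in S].

(* The uniform distribution on the unit sphere of L, evaluated at A: the image
   of the uniform distribution on the unit ball under x |-> x / |x|. *)
Definition unif_sphere L A : R :=
  vol_in L [set x | 0 < enorm x <= 1 /\ A ((enorm x)^-1 *: x)]
    / vol_in L [set x | enorm x <= 1].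

Definition solid_angle A : R :=
  if `[< A = [set 0] >] then 1 else unif_sphere (lin A) A.

Definition relint S : set E :=
  [set v | S v /\ exists2 e : R, 0 < e &
    forall x, aff S x -> enorm (x - v) < e -> S x].

Definition tangent_cone (v : E) (P : set E) : set E :=
  [set l *: (x - v) | l in [set l : R | 0 <= l] & x in P].

(* The cone does not depend on the point chosen in relint F. *)
Definition tangent_cone_face (F P : set E) : set E :=
  tangent_cone (xget 0 (relint F)) P.

Definition polar (C : set E) : set E :=
  [set w | forall x, C x -> dotr w x <= 0].

Definition normal_cone (F P : set E) : set E := polar (tangent_cone_face F P).

(* c = 0, b = 0 gives F = P. *)
Definition is_face (F P : set E) : Prop :=
  F !=set0 /\ exists (c : E) (b : R),
    (forall x, P x -> dotr c x <= b) /\ F = [set x | P x /\ dotr c x = b].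

Definition faces (k : nat) (P : set E) : set (set E) :=
  [set F | is_face F P /\ adim F = k].

Definition intrinsic_volume (k : nat) (P : set E) : R :=
  \sum_(F \in faces k P) solid_angle (normal_cone F P) * rvol F.

Definition translate (t : E) (P : set E) : set E := [set t + x | x in P].

Definition dilate (n : nat) (P : set E) : set E := [set n%:R *: u | u in P].

End euclidean.

Section lattice.
Context {R : realType} {d : nat}.
Notation E := 'rV[R]_d.
Implicit Types (P Q F : set E) (phi : set E -> R).

Definition zpt (v : 'rV[int]_d) : E := map_mx intr v.

Definition lattice_polytope P : Prop :=
  exists (n : nat) (v : 'I_n -> 'rV[int]_d),
    P = [set x | exists c : 'I_n -> R,
          [/\ forall i, 0 <= c i, \sum_(i < n) c i = 1
            & x = \sum_(i < n) c i *: zpt (v i)]].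

Definition latpts P : set 'rV[int]_d := [set v | P (zpt v)].

(* The lattice of integer points of aff F, translated to the origin. *)
Definition aff_lattice F : set 'rV[int]_d :=
  [set z - w | z in latpts (aff F) & w in latpts (aff F)].

Definition lattice_basis F : 'M[int]_(adim F, d) :=
  xget 0 [set B : 'M[int]_(adim F, d) |
    row_free (map_mx intr B : 'M[R]_(adim F, d)) /\
    forall z, aff_lattice F z <-> exists c : 'rV[int]_(adim F), z = c *m B].

(* Square root of the Gram determinant; equal to 1 when adim F = 0. *)
Definition latdet F : R :=
  let B := map_mx intr (lattice_basis F) : 'M[R]_(adim F, d) in
  Num.sqrt (\det (B *m B^T)).

Definition valuation phi : Prop :=
  phi set0 = 0 /\
  forall P Q, lattice_polytope P -> lattice_polytope Q ->
    lattice_polytope (P `|` Q) ->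
    phi (P `|` Q) = phi P + phi Q - phi (P `&` Q).

Definition translation_invariant phi : Prop :=
  forall P (t : 'rV[int]_d), lattice_polytope P ->
    phi (translate (zpt t) P) = phi P.

(* The index sets of the sums below are finite for a lattice polytope P. *)
Definition discrete_intrinsic_volume (k : nat) P : R :=
  \sum_(v \in latpts P) \sum_(F \in faces k P)
    (\1_F (zpt v) * latdet F * solid_angle (normal_cone F P)
       * solid_angle (tangent_cone (zpt v) F)).

Definition solid_angle_valuation P : R :=
  if adim P == d then \sum_(v \in latpts P) solid_angle (tangent_cone (zpt v) P)
  else 0.

End lattice.

(* Main.v *)
Require Import Defs.
From HB Require Import structures.
From mathcomp Require Import all_boot all_order all_algebra all_fingroup.
From mathcomp Require Import all_classical all_reals all_analysis.
From mathcomp Require Import measurable_realfun ring lra zify.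
Import Order.TTheory GRing.Theory Num.Theory.
Import numFieldNormedType.Exports.
Local Open Scope classical_set_scope.
Local Open Scope ring_scope.

Set Implicit Arguments.
Unset Strict Implicit.
Unset Printing Implicit Defensive.

(** Fix a lattice point [v] of [P]. A [k]-face through [v] is determined by its
    direction space [L]: its tangent cone at [v] is the trace on [L] of the tangent
    cone [T] of [P], and its normal cone is the trace of the polar of [T] on the
    orthogonal complement of [L]. Measuring both traces relative to the unit balls
    of these two subspaces gives [0] whenever no face has direction [L], so that
    [A_k(P)] is the sum over [v] and over all [k]-dimensional [L] of
    [det(L)] times the two measures; only [T] matters.

    For the valuation property, let [C], [D] be the tangent cones of [P], [Q] at a
    common point. If [x] lies in [C] but not in [D], and [y] is orthogonal to [x]
    and in the polar of [C], then convexity of the union forces [y] into the polar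
    of [D]; and the polar of the intersection is the union of the polars. Together
    with additivity of measures this is the valuation identity for every [L].

    Part (1) says that the normal cones at the lattice points of [P] tile the space
    up to null sets. For part (4), the weighted lattice points of [n F] are compared
    with translates of a fundamental cell of the lattice, which are squeezed between
    [(n - c) F] and [(n + c) F]. The same counting argument shows that linear maps
    multiply volumes by the determinant: the cell of a matrix has a multiplicative
    volume, which is [1] for permutations and the product of the diagonal for
    triangular matrices. *)

(** * Lebesgue measure on row vectors *)

(** Two features of the definitions shape the proof. Every choice ([lin], [orthonormal_basis],
    [lattice_basis], the point of [relint F]) falls back to a default when its specification is
    unsatisfiable, and a sum with infinite support is 0; so existence and finiteness have to be
    settled before anything can be computed. For lattice bases, existence rests on the direction
    space being spanned by integer vectors and on the Smith normal form. The sum runs over subspaces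
    because the faces of P, Q, their union and their intersection do not correspond to each other,
    whereas the terms attached to a fixed subspace do. Balls replace spheres because a trace on L
    can then be measured whether or not the cone spans L. The valuation identity evaluates A_k at
    the intersection, about which nothing is assumed. Convexity of the union forces its extreme
    points to be generators of P or of Q, so it is again a lattice polytope. In the limit, the
    angles at points near the relative boundary of n F are only known to lie between 0 and 1. This
    suffices, since there are too few such points to matter after division by n^k. *)

Section sigma_finite_measure_of.
Context d (T : measurableType d) {R : realType}.
Variable m : {measure set T -> \bar R}.
Hypothesis sf : sigma_finite setT m.

Let mu : set T -> \bar R := m.

HB.instance Definition _ := Measure.on mu.
HB.instance Definition _ := Measure_isSigmaFinite.Build _ _ _ mu sf.

(** Turns a propositional proof of sigma-finiteness into a structure. The local alias [mu] carries
    the instance. *)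
Lemma sigma_finite_measureP :
  exists nu : {sigma_finite_measure set T -> \bar R}, nu = m :> (set T -> \bar R).
Proof. by exists mu. Qed.

End sigma_finite_measure_of.

Section lebesgue_tuple_measure.
Context {R : realType}.
Local Notation mR := (measurableTypeR R).

Let tcons n (p : mR * n.-tuple mR) : n.+1.-tuple mR := [tuple of p.1 :: p.2].

Let measurable_tcons n : measurable_fun setT (@tcons n).
Proof. exact: measurable_cons. Qed.

HB.instance Definition _ n := isMeasurableFun.Build _ _ _ _ (@tcons n) (@measurable_tcons n).


(** [lebesgue_tuple] is a bare set function. The product construction yields a measure only if its
    second factor is a sigma-finite measure, so this property is carried through the induction. *)
Lemma lebesgue_tuple_sigma_finite n :
  exists mu : {sigma_finite_measure set (n.-tuple mR) -> \bar R},
    @lebesgue_tuple R n = mu.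
Proof.
elim: n => [|n [mu muE]].
  by exists (dirac ([tuple] : 0.-tuple mR)).
pose nu := (product_measure1 (@lebesgue_measure R) mu).
pose m := pushforward nu (@tcons n).
have sf : sigma_finite setT m.
  have /sigma_finiteP[F [TF ndF Ff]] := sigma_finiteT (@lebesgue_measure R).
  have /sigma_finiteP[G [TG ndG Gf]] := sigma_finiteT mu.
  (* A measurable left inverse of [tcons]: it pulls rectangles of finite measure back to an
     exhausting sequence. *)
  pose f (t : n.+1.-tuple mR) : mR * n.-tuple mR := (thead t, [tuple of behead t]).
  have mf : measurable_fun setT f.
    apply/measurable_fun_pairP; split; first exact: measurable_tnth.
    exact: measurable_behead.
  have tK p : f (tcons p) = p.
    by case: p => x t; rewrite /f /tcons theadE; congr pair; apply: val_inj.
  exists (fun k => f @^-1` (F k `*` G k)).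
    rewrite -preimage_bigcup (_ : \bigcup_k _ = setT) ?preimage_setT//.
    rewrite predeqE => -[x y]; split=> // _.
    have [k _ Fk] : (\bigcup_k F k) x by rewrite -TF.
    have [l _ Gl] : (\bigcup_k G k) y by rewrite -TG.
    exists (maxn k l) => //; split.
    - by move: x Fk; exact/subsetPset/ndF/leq_maxl.
    - by move: y Gl; exact/subsetPset/ndG/leq_maxr.
  move=> k; have [mFk Fk] := Ff k; have [mGk Gk] := Gf k; split.
    by rewrite -[X in measurable X]setTI; apply: mf => //; exact: measurableX.
  rewrite /m /pushforward (_ : _ @^-1` _ = F k `*` G k).
    by rewrite /nu product_measure1E// lte_mul_pinfty// ge0_fin_numE.
  apply/funext => p. by rewrite /preimage /mkset; have := tK p; rewrite /tcons => ->.
have [m' m'E] := @sigma_finite_measureP _ _ _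
  (measure_function_pushforward__canonical__measure_function_Measure
    (product_measure1 (@lebesgue_measure R) mu) (@measurable_tcons n)) sf.
by exists m'; rewrite m'E /= /m /nu -muE.
Qed.
End lebesgue_tuple_measure.

(** * Measurable sets of row vectors *)

Section rVmeas.
Context {R : realType}.
Local Notation mR := (measurableTypeR R).

Definition rV_of_tuple n (t : n.-tuple mR) : 'rV[R]_n := \row_i (tnth t i : R).

(** [lebesgue_rV] measures the tuple preimage of a set, so this is the measurability that its
    additivity requires. *)
Definition rVmeas n (A : set 'rV[R]_n) : Prop :=
  measurable ((@rV_of_tuple n) @^-1` A).

(** [fine] sends an infinite value to 0, whence the boundedness hypotheses in what follows. *)
Definition vol n (A : set 'rV[R]_n) : R := fine (lebesgue_rV A).

Lemma rVmeas0 n : rVmeas (@set0 'rV[R]_n).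
Proof. by rewrite /rVmeas preimage_set0; exact: measurable0. Qed.

Lemma rVmeasT n : rVmeas [set: 'rV[R]_n].
Proof. by rewrite /rVmeas preimage_setT. Qed.

Lemma rVmeasC n (A : set 'rV[R]_n) : rVmeas A -> rVmeas (~` A).
Proof. by move=> mA; rewrite /rVmeas preimage_setC; exact: measurableC. Qed.

Lemma rVmeasI n (A B : set 'rV[R]_n) : rVmeas A -> rVmeas B -> rVmeas (A `&` B).
Proof. by move=> mA mB; rewrite /rVmeas preimage_setI; exact: measurableI. Qed.

Lemma rVmeasU n (A B : set 'rV[R]_n) : rVmeas A -> rVmeas B -> rVmeas (A `|` B).
Proof. by move=> mA mB; rewrite /rVmeas preimage_setU; exact: measurableU. Qed.

Lemma rVmeasD n (A B : set 'rV[R]_n) : rVmeas A -> rVmeas B -> rVmeas (A `\` B).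
Proof. by move=> mA mB; rewrite setDE; apply: rVmeasI => //; exact: rVmeasC. Qed.

Lemma rVmeas_bigcup n (F : nat -> set 'rV[R]_n) :
  (forall k, rVmeas (F k)) -> rVmeas (\bigcup_k F k).
Proof.
move=> mF; rewrite /rVmeas preimage_bigcup.
by apply: bigcup_measurable => k _; exact: mF.
Qed.

Lemma rVmeas_bigcap (I : choiceType) n (F : I -> set 'rV[R]_n) (D : set I) :
  finite_set D -> (forall i, D i -> rVmeas (F i)) -> rVmeas (\bigcap_(i in D) F i).
Proof.
move=> fD mF; rewrite /rVmeas preimage_bigcap.
by apply: fin_bigcap_measurable.
Qed.

Lemma measurable_row n m (f : n.-tuple mR -> 'rV[R]_m) (A : set 'rV[R]_m) :
  (forall j, measurable_fun setT (fun t => f t 0 j : mR)) ->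
  rVmeas A -> measurable (f @^-1` A).
Proof.
move=> mf mA.
pose g t : m.-tuple mR := [tuple f t 0 j | j < m].
have mg : measurable_fun setT g.
  apply/measurable_fun_tnthP => j; rewrite (_ : _ \o _ = fun t => f t 0 j)//.
  by apply/funext => t /=; rewrite tnth_mktuple.
rewrite (_ : f @^-1` A = g @^-1` ((@rV_of_tuple m) @^-1` A)).
  by rewrite -[X in measurable X]setTI; exact: mg.
apply/funext => t; rewrite /preimage/=; congr (A _).
by apply/rowP => j; rewrite mxE tnth_mktuple.
Qed.

Lemma measurable_coord n (i : 'I_n) :
  measurable_fun setT (fun t : n.-tuple mR => rV_of_tuple t 0 i : mR).
Proof.
rewrite (_ : (fun _ => _) = @tnth n mR ^~ i); last by apply/funext => t; rewrite mxE.
exact: measurable_tnth.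
Qed.

Lemma measurable_fun_sumr d (T : measurableType d) (I : Type) (s : seq I)
    (f : I -> T -> mR) : (forall i, measurable_fun setT (f i)) ->
  measurable_fun setT (fun t => \sum_(i <- s) f i t : mR).
Proof.
move=> mf; elim: s => [|i s IH].
  by rewrite (_ : (fun _ => _) = cst 0)//; apply/funext => t; rewrite big_nil.
rewrite (_ : (fun _ => _) = (fun t => f i t + \sum_(i <- s) f i t)).
  exact: (@measurable_funD _ T R setT (f i) _ (mf i) IH).
by apply/funext => t; rewrite big_cons.
Qed.

Lemma rVmeas_affine n m (M : 'M[R]_(n, m)) (b : 'rV[R]_m) (A : set 'rV[R]_m) :
  rVmeas A -> rVmeas [set x : 'rV[R]_n | A (x *m M + b)].
Proof.
move=> mA.
apply: (@measurable_row _ _ (fun t => rV_of_tuple t *m M + b)) => // j.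
rewrite (_ : (fun t => _) =
    (fun t : n.-tuple mR => \sum_i rV_of_tuple t 0 i * M i j + b 0 j)); last first.
  by apply/funext => t; rewrite !mxE.
apply: measurable_funD => //; apply: measurable_fun_sumr => i.
by apply: measurable_funM => //; exact: measurable_coord.
Qed.

Lemma rVmeas_coord n (i : 'I_n) (A : set mR) : measurable A ->
  rVmeas [set x : 'rV[R]_n | A (x 0 i)].
Proof.
move=> mA; rewrite /rVmeas -[X in measurable X]setTI.
exact: (@measurable_coord n i _ A).
Qed.

(** The open complement is the union of the countably many rational cubes [B p] contained in it; [F]
    discards the other cubes. *)
Lemma rVmeas_closed n (A : set 'rV[R]_n) : closed A -> rVmeas A.
Proof.
move=> cA; rewrite -(setCK A); apply: rVmeasC.
pose B (p : n.-tuple rat * rat) : set 'rV[R]_n :=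
  [set y | forall i, `|y 0 i - ratr (tnth p.1 i)| < ratr p.2].
pose F p := if `[< B p `<=` ~` A >] then B p else set0.
rewrite (_ : ~` A = \bigcup_p F p).
  rewrite /rVmeas preimage_bigcup; apply: countable_bigcupT_measurable => [|p]; first exact: countableP.
  rewrite /F; case: ifPn => _; last exact: rVmeas0.
  rewrite (_ : B p = \bigcap_(i in [set: 'I_n])
      [set y | `]ratr (tnth p.1 i) - ratr p.2, ratr (tnth p.1 i) + ratr p.2[%classic (y 0 i : mR)]).
    apply: rVmeas_bigcap => [|i _]; first exact: finite_finset.
    by apply: (@rVmeas_coord n i `]_, _[%classic); exact: measurable_itv.
  apply/seteqP; split => y /= H i; have := H i; rewrite /= in_itv/= ltr_distl //.
  by move=> /(_ I).
apply/seteqP; split => [x Ax|x [p _]]; last first.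
  by rewrite /F; case: ifPn => // /asboolP; apply.
have [e /= e0 eA] : nbhs_ball x (~` A).
  by apply/nbhs_ballP; apply: (closed_openC cA).
(* A radius below [e / 2] keeps any two points of the cube within [e] of each other, coordinate by
   coordinate. *)
have /rat_in_itvoo[r] : 0 < e / 2 by rewrite divr_gt0.
rewrite in_itv/= => /andP[r0 re].
have H i : {q : rat | `|x 0 i - ratr q| < ratr r}.
  apply: cid; have /rat_in_itvoo[q] : x 0 i - ratr r < x 0 i + ratr r by lra.
  by rewrite in_itv/= -ltr_distl distrC => ?; exists q.
pose p : n.-tuple rat * rat := ([tuple sval (H i) | i < n], r).
have Bx : B p x by move=> i; rewrite tnth_mktuple; exact: svalP (H i).
exists p => //; rewrite /F; case: ifPn => // /asboolP[] y By.
apply: eA; split=> // i j; rewrite (ord1 i) /ball/=.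
have := By j; have := Bx j; rewrite /= tnth_mktuple => h1 h2.
rewrite (le_lt_trans (ler_distD (ratr (sval (H j))) _ _))//.
by rewrite (distrC _ (y 0 j)); lra.
Qed.

End rVmeas.

(** * Slicing, and behaviour under scaling and translation *)

Section lebesgue_rV.
Context {R : realType}.
Local Notation mR := (measurableTypeR R).

Definition slice n (A : set 'rV[R]_n.+1) (x : R) : set 'rV[R]_n :=
  [set y | A (row_mx x%:M y : 'rV[R]_(1 + n))].

Lemma rVmeas_slice n (A : set 'rV[R]_n.+1) x : rVmeas A -> rVmeas (slice A x).
Proof.
move=> mA.
rewrite (_ : slice A x = [set y | A (y *m (row_mx 0 1%:M : 'M[R]_(n, 1 + n)) + row_mx x%:M 0)]).
  exact: (rVmeas_affine (row_mx 0 1%:M : 'M[R]_(n, 1 + n))).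
apply/funext => y; congr (A _).
by rewrite mul_mx_row mulmx0 mulmx1 add_row_mx add0r addr0.
Qed.

Lemma rV_of_tupleS n (x : mR) (t : n.-tuple mR) :
  rV_of_tuple [tuple of x :: t] = (row_mx (x : R)%:M (rV_of_tuple t) : 'rV[R]_(1 + n)).
Proof.
apply/rowP => i; rewrite !mxE; case: splitP => j ij.
  by rewrite ord1 !mxE eqxx mulr1n (_ : i = ord0) ?tnth0//; apply/val_inj/(etrans ij); rewrite ord1.
by rewrite !mxE (_ : i = lift ord0 j) ?tnthS//; apply/val_inj/(etrans ij).
Qed.

Local Open Scope ereal_scope.

Lemma lebesgue_rV_ge0 n (A : set 'rV[R]_n) : 0 <= lebesgue_rV A.
Proof.
have [mu muE] := @lebesgue_tuple_sigma_finite R n.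
by rewrite /lebesgue_rV muE.
Qed.

Lemma lebesgue_rV0 n : lebesgue_rV (@set0 'rV[R]_n) = 0.
Proof.
have [mu muE] := @lebesgue_tuple_sigma_finite R n.
by rewrite /lebesgue_rV muE; exact: measure0.
Qed.

Lemma lebesgue_rVU n (A B : set 'rV[R]_n) : rVmeas A -> rVmeas B ->
  [disjoint A & B] -> lebesgue_rV (A `|` B) = lebesgue_rV A + lebesgue_rV B.
Proof.
move=> mA mB /disj_set2P AB; have [mu muE] := @lebesgue_tuple_sigma_finite R n.
rewrite /lebesgue_rV muE; apply: (@measureU _ _ _ mu _ _ mA mB).
by apply/seteqP; split => // t /= h; rewrite -[False]/(set0 (rV_of_tuple t)) -AB.
Qed.

Lemma le_lebesgue_rV n (A B : set 'rV[R]_n) : rVmeas A -> rVmeas B ->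
  A `<=` B -> lebesgue_rV A <= lebesgue_rV B.
Proof.
move=> mA mB AB; have [mu muE] := @lebesgue_tuple_sigma_finite R n.
rewrite /lebesgue_rV muE; apply: le_measure; rewrite ?inE//.
by move=> t; exact: AB.
Qed.

Lemma measurable_prod_slice n (A : set 'rV[R]_n.+1) : rVmeas A ->
  measurable [set p : mR * n.-tuple mR | A (rV_of_tuple [tuple of p.1 :: p.2])].
Proof.
move=> mA; pose f (p : mR * n.-tuple mR) := [the n.+1.-tuple _ of p.1 :: p.2].
have mf : measurable_fun setT f by exact: measurable_cons.
by have := mf measurableT _ mA; rewrite setTI.
Qed.

(** Cavalieri's principle, which is the definition of the product measure read on row vectors. *)
Lemma lebesgue_rVS n (A : set 'rV[R]_n.+1) : rVmeas A ->
  lebesgue_rV A = \int[lebesgue_measure]_x lebesgue_rV (slice A x).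
Proof.
move=> mA; rewrite /lebesgue_rV [in LHS]/lebesgue_tuple -/lebesgue_tuple.
rewrite /pushforward /product_measure1; apply: eq_integral => x _ /=.
congr lebesgue_tuple; rewrite /xsection/=; apply/funext => t.
by rewrite /preimage /mkset /slice /= -rV_of_tupleS; apply/propext; rewrite inE.
Qed.

Lemma measurable_lebesgue_rV_slice n (A : set 'rV[R]_n.+1) : rVmeas A ->
  measurable_fun setT (fun x : mR => lebesgue_rV (slice A x)).
Proof.
move=> mA; have [mu muE] := @lebesgue_tuple_sigma_finite R n.
have := measurable_fun_xsection mu (measurable_prod_slice mA).
apply: eq_measurable_fun => x _ /=; rewrite /lebesgue_rV muE; congr (mu _).
apply/funext => t; rewrite /xsection /slice /preimage /mkset -rV_of_tupleS.
by apply/propext; rewrite inE.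
Qed.


(** The pushforward of Lebesgue measure under the affine map, scaled by [a], agrees with Lebesgue
    measure on half-open intervals, hence everywhere by uniqueness. *)
Lemma ge0_integral_affine (a b : R) (f : mR -> \bar R) : (0 < a)%R ->
  measurable_fun setT f -> (forall x, 0 <= f x) ->
  a%:E * \int[lebesgue_measure]_x f (a * x + b)%R = \int[lebesgue_measure]_x f x.
Proof.
move=> a0 mf f0.
pose phi (x : mR) : mR := (a * x + b)%R.
have mphi : measurable_fun setT phi.
  by apply: measurable_funD => //; apply: measurable_funM.
rewrite [RHS](@eq_measure_integral _ _ _ _ (mscale (NngNum (ltW a0))
  (measure_function_pushforward__canonical__measure_function_Measure lebesgue_measure mphi))).
  rewrite ge0_integral_mscale//= ge0_integral_pushforward//.
move=> A mA _; apply: lebesgue_measure_unique => // _ [[p q] _ <-].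
change (lebesgue_measure (`]p, q]%classic : set mR) = a%:E * lebesgue_measure (phi @^-1` `]p, q]%classic)).
rewrite (_ : phi @^-1` _ = `](p - b) / a, (q - b) / a]%classic)%R.
  rewrite !lebesgue_measure_itv/= !lte_fin ltr_pM2r ?invr_gt0// ltrD2r.
  by case: ifPn => _; rewrite ?mule0// -!EFinB -EFinM; congr EFin; field; rewrite gt_eqF.
apply/seteqP; split => x; rewrite /phi /= !in_itv /= ltr_pdivrMr// ler_pdivlMr//.
  by rewrite mulrC ltrBlDr lerBrDr.
by rewrite mulrC ltrBlDr lerBrDr.
Qed.

(** Induction on the dimension: a slice of the preimage is the preimage of a slice. The outer
    integral contributes one factor [a], the induction hypothesis the others. *)
Lemma lebesgue_rV_affine n (a : R) (b : 'rV[R]_n) (A : set 'rV[R]_n) :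
  (0 < a)%R -> rVmeas A ->
  (a ^+ n)%:E * lebesgue_rV [set x | A (a *: x + b)%R] = lebesgue_rV A.
Proof.
move=> a0; elim: n b A => [|n IH] b A mA.
  rewrite expr0 mul1e; congr lebesgue_rV; apply/funext => x /=.
  by congr (A _); apply/rowP => -[].
have mA' : rVmeas [set x | A (a *: x + b)%R].
  rewrite (_ : mkset _ = [set x | A (x *m a%:M + b)%R]); first exact: rVmeas_affine.
  by apply/funext => x /=; rewrite mul_mx_scalar.
rewrite !lebesgue_rVS// -[RHS](ge0_integral_affine (b 0 0)%R a0); last 2 first.
- exact: measurable_lebesgue_rV_slice.
- by move=> x; exact: lebesgue_rV_ge0.
rewrite exprS EFinM -muleA; congr (_ * _).
rewrite -ge0_integralZl//; last 3 first.
- exact: measurable_lebesgue_rV_slice.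
- by move=> x _; exact: lebesgue_rV_ge0.
- by rewrite lee_fin exprn_ge0// ltW.
apply: eq_integral => x _.
pose b' := rsubmx (b : 'rV[R]_(1 + n)).
have bE : b = row_mx (b 0 0)%R%:M b' :> 'rV[R]_(1 + n).
  rewrite -[LHS](@hsubmxK _ 1 1 n); congr row_mx.
  by apply/rowP => i; rewrite ord1 !mxE eqxx mulr1n; congr (b _ _); exact/val_inj.
rewrite -(IH b' (slice A (a * x + b 0 0)%R)); last exact: rVmeas_slice.
congr (_ * lebesgue_rV _); apply/funext => y; rewrite /slice /=; congr (A _).
rewrite [in LHS]bE (@scale_row_mx _ 1 1 n) (@add_row_mx _ 1 1 n).
by rewrite scale_scalar_mx -[in LHS]raddfD.
Qed.

End lebesgue_rV.

(** * Parallelepipeds spanned by the rows of a matrix *)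

Section parallelepiped.
Context {R : realType}.
Local Notation mR := (measurableTypeR R).

Lemma coord_le_norm n (x : 'rV[R]_n) i : `|x 0 i| <= `|x|.
Proof.
by rewrite [leRHS]/Num.norm /= mx_normrE; apply/bigmax_geP; right => /=; exists (0, i).
Qed.

Lemma norm_le_coord n (x : 'rV[R]_n) r : 0 <= r ->
  (forall i, `|x 0 i| <= r) -> `|x| <= r.
Proof.
move=> r0 H; rewrite [leLHS]/Num.norm /= mx_normrE; apply/bigmax_leP; split=> // -[i j] _ /=.
by rewrite (ord1 i).
Qed.

Lemma norm_mulmx_le m n (M : 'M[R]_(m, n)) :
  exists2 C : R, 0 < C & forall x : 'rV[R]_m, `|x *m M| <= C * `|x|.
Proof.
exists (1 + \sum_i \sum_j `|M i j|).
  by rewrite ltr_pwDl// sumr_ge0// => i _; rewrite sumr_ge0.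
move=> x; apply: norm_le_coord.
  by rewrite mulr_ge0// addr_ge0// sumr_ge0// => i _; rewrite sumr_ge0.
move=> j; rewrite mxE (le_trans (ler_norm_sum _ _ _))// mulrDl mul1r ler_wpDl//.
rewrite mulr_suml ler_sum// => i _; rewrite normrM mulrC ler_pM// ?coord_le_norm//.
by rewrite (bigD1 j)//= lerDl sumr_ge0.
Qed.

(** Half-open, so that its integer translates partition the space. *)
Definition cube n : set 'rV[R]_n := [set t | forall i, 0 <= t 0 i < 1].

(** For invertible [M], a fundamental cell of the lattice generated by the rows. *)
Definition par n (M : 'M[R]_n) : set 'rV[R]_n := [set t *m M | t in @cube n].

Lemma rVmeas_cube n : rVmeas (@cube n).
Proof.
rewrite (_ : @cube n = \bigcap_(i in [set: 'I_n])
      [set y | `[0, 1[%classic (y 0 i : mR)]).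
  apply: rVmeas_bigcap => [|i _]; first exact: finite_finset.
  by apply: (@rVmeas_coord _ n i `[_, _[%classic); exact: measurable_itv.
by apply/seteqP; split => y /= H i; have := H i; rewrite /= in_itv/= => // /(_ I).
Qed.

Lemma par_unitmx n (M : 'M[R]_n) : M \in unitmx ->
  par M = [set x | @cube n (x *m invmx M)].
Proof.
move=> uM; apply/seteqP; split => [_ [t ct <-]|x cx] /=; first by rewrite mulmxK.
by exists (x *m invmx M); rewrite // mulmxKV.
Qed.

Lemma rVmeas_mulmx m n (M : 'M[R]_(m, n)) (A : set 'rV[R]_n) :
  rVmeas A -> rVmeas [set x | A (x *m M)].
Proof.
move=> mA; rewrite (_ : mkset _ = [set x | A (x *m M + 0)]); first exact: rVmeas_affine.
by apply/funext => x /=; rewrite addr0.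
Qed.

Lemma rVmeas_par n (M : 'M[R]_n) : M \in unitmx -> rVmeas (par M).
Proof. by move=> uM; rewrite par_unitmx//; apply: rVmeas_mulmx; exact: rVmeas_cube. Qed.

Local Open Scope ereal_scope.

Lemma lebesgue_rV_translate n (b : 'rV[R]_n) (A : set 'rV[R]_n) : rVmeas A ->
  lebesgue_rV [set x | A (x + b)%R] = lebesgue_rV A.
Proof.
move=> mA; rewrite -[RHS](lebesgue_rV_affine b (@ltr01 R)) // expr1n mul1e.
by congr lebesgue_rV; apply/funext => x /=; rewrite scale1r.
Qed.

(** The slice at [x] is empty unless [x / a] lies in [0, 1), where [a] is the first diagonal entry;
    otherwise it is a translate of the cell of the lower right block. Integrating over [x] gives the
    factor [|a|]. *)
Lemma lebesgue_rV_par_upper n (T : 'M[R]_n) :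
  (forall i j : 'I_n, (j < i)%N -> T i j = 0%R) -> T \in unitmx ->
  lebesgue_rV (par T) = (\prod_i `|T i i|)%:E.
Proof.
elim: n T => [|n IH] T uT unT.
  rewrite big_ord0 /lebesgue_rV /lebesgue_tuple /dirac indicE mem_set//=.
  by exists 0%R; [move=> [] | apply/rowP => -[]].
pose T' : 'M[R]_(1 + n) := T.
have TE : T' = block_mx (T 0 0)%R%:M (ursubmx T') 0%R (drsubmx T').
  rewrite -[LHS]submxK; congr block_mx.
    by apply/matrixP => i j; rewrite !ord1 !mxE eqxx mulr1n; congr (T _ _); exact/val_inj.
  by apply/matrixP => i j; rewrite !ord1 !mxE; apply: uT.
set b := ursubmx T' in TE; set D := drsubmx T' in TE; set a := T 0%R 0%R in TE *.
have : \det T' != 0%R by rewrite -unitfE -unitmxE.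
rewrite TE det_ublock det_scalar1 mulf_eq0 negb_or => /andP[a0 detD].
have uD : D \in unitmx by rewrite unitmxE unitfE.
rewrite lebesgue_rVS; last exact: rVmeas_par.
have sE x : slice (par T) x = if (0 <= x / a < 1)%R
    then [set y | par D (y + - ((x / a) *: b))%R] else set0.
  apply/seteqP; split => [y [t ct ty]|y].
    have tE : t = row_mx (t 0 0)%R%:M (rsubmx (t : 'rV[R]_(1 + n))) :> 'rV[R]_(1 + n).
      rewrite -[LHS](@hsubmxK _ 1 1 n); congr row_mx.
      by apply/rowP => i; rewrite ord1 !mxE eqxx mulr1n; congr (t _ _); exact/val_inj.
    have {}ty : (t : 'rV[R]_(1 + n)) *m T' = row_mx x%:M y by [].
    move: ty; rewrite tE TE mul_row_block => /eq_row_mx[].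
    rewrite mulmx0 addr0 -scalar_mxM => /matrixP/(_ 0 0)%R.
    rewrite !mxE eqxx !mulr1n => <-.
    rewrite mulfK//; rewrite ct => <-.
    exists (rsubmx (t : 'rV[R]_(1 + n))); first by move=> i; rewrite mxE.
    by rewrite mul_scalar_mx [X in (X - _)%R]addrC addrK.
  case: ifPn => // x01 [t ct ty].
  exists (row_mx (x / a)%:M t : 'rV[R]_(1 + n)).
    move=> i; rewrite mxE; case: splitP => j ij; last exact: ct.
    by rewrite ord1 mxE eqxx mulr1n.
  rewrite -[LHS]/(_ *m T') TE mul_row_block -scalar_mxM divfK// mulmx0 addr0.
  by rewrite mul_scalar_mx ty addrCA subrr addr0.
have parE x : lebesgue_rV (slice (par T) x) =
    (\prod_i `|D i i|)%:E * (\1_[set x | (0 <= x / a < 1)%R] x)%:E.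
  rewrite sE indicE; case: ifPn => x01.
    rewrite mem_set//= mule1 lebesgue_rV_translate; last exact: rVmeas_par.
    apply: IH => // i j ji; rewrite !mxE; apply: uT.
    by rewrite /= !add1n ltnS.
  rewrite lebesgue_rV0 memNset//= ?mule0//; exact/negP.
under eq_integral do rewrite parE.
have mS : measurable ([set x | (0 <= x / a < 1)%R] : set mR).
  have mf : measurable_fun setT (fun x : mR => (x / a)%R : mR) by apply: measurable_funM.
  rewrite (_ : mkset _ = (fun x : mR => (x / a)%R : mR) @^-1` `[0%R, 1%R[%classic).
    by rewrite -[X in measurable X]setTI; apply: mf => //; exact: measurable_itv.
  by apply/seteqP; split => x; rewrite /= in_itv.
rewrite ge0_integralZl//; last 2 first.
- by apply/measurable_EFinP; exact: measurable_indic.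
- by rewrite lee_fin prodr_ge0.
rewrite integral_indic// setIT.
have mE : lebesgue_measure ([set x | (0 <= x / a < 1)%R] : set mR) = `|a|%:E.
  have [a_gt0|a_lt0|/eqP] := ltgtP a 0%R; last by rewrite (negbTE a0).
    rewrite (_ : mkset _ = `]a, 0%R]%classic).
      by rewrite lebesgue_measure_itv/= lte_fin a_gt0 -EFinB sub0r ltr0_norm.
    apply/seteqP; split => x; rewrite /= in_itv/=.
      by rewrite ler_ndivlMr// ltr_ndivrMr// mul0r mul1r andbC.
    by rewrite ler_ndivlMr// ltr_ndivrMr// mul0r mul1r andbC.
  rewrite (_ : mkset _ = `[0%R, a[%classic).
    by rewrite lebesgue_measure_itv/= lte_fin a_lt0 -EFinB subr0 gtr0_norm.
  apply/seteqP; split => x; rewrite /= in_itv/=.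
    by rewrite ler_pdivlMr// ltr_pdivrMr// mul0r mul1r.
  by rewrite ler_pdivlMr// ltr_pdivrMr// mul0r mul1r.
rewrite [X in _ * X]mE -EFinM; congr EFin; rewrite big_ord_recl mulrC; congr (_ * _)%R.
apply: eq_bigr => i _; rewrite !mxE; congr (`|T _ _|)%R; exact/val_inj.
Qed.

End parallelepiped.

Section vol.
Context {R : realType}.

Definition rVbounded n (A : set 'rV[R]_n) := exists b : R, forall x, A x -> `|x| <= b.

Lemma par1 n : par 1%:M = @cube R n.
Proof.
by apply/seteqP; split => [_ [t ct <-]|x cx]; [rewrite mulmx1|exists x; rewrite ?mulmx1].
Qed.

Lemma lebesgue_rV_cube n : lebesgue_rV (@cube R n) = 1%:E.
Proof.
rewrite -par1 lebesgue_rV_par_upper ?unitmx1//.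
  by rewrite big1// => i _; rewrite mxE eqxx normr1.
by move=> i j ji; rewrite mxE -val_eqE /= gtn_eqF.
Qed.

Lemma lebesgue_rV_fin n (A : set 'rV[R]_n) : rVmeas A -> rVbounded A ->
  lebesgue_rV A \is a fin_num.
Proof.
move=> mA [b bA]; rewrite ge0_fin_numE ?lebesgue_rV_ge0//.
pose r := `|b| + 1; have r0 : 0 < r by rewrite ltr_pwDr.
(* This is the cube of points with all coordinates in [-r, r). Rescaled by [(2 * r)^-1] its measure
   is 1, so it cannot be infinite. *)
pose B := [set x : 'rV[R]_n | @cube R n ((2 * r)^-1 *: x + const_mx (2^-1))].
have mB : rVmeas B.
  rewrite /B (_ : mkset _ = [set x | @cube R n (x *m (2 * r)^-1%:M + const_mx (2^-1))]).
    by apply: rVmeas_affine; exact: rVmeas_cube.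
  by apply/funext => x /=; rewrite mul_mx_scalar.
apply: (@le_lt_trans _ _ (lebesgue_rV B)).
  apply: le_lebesgue_rV => // x /bA xb i; rewrite !mxE.
  have : `|x 0 i| < r.
    by rewrite (le_lt_trans (coord_le_norm _ _))// (le_lt_trans xb)// /r; have := ler_norm b; lra.
  rewrite ltr_norml => /andP[x1 x2].
  have i0 : 0 < (2 * r)^-1 by rewrite invr_gt0 mulr_gt0.
  have e : (2 * r)^-1 * r = 2^-1 by rewrite invfM -mulrA mulVf ?mulr1// gt_eqF.
  apply/andP; split; first by rewrite -e -mulrDr mulr_ge0 ?ltW//; lra.
  by rewrite [ltRHS](splitr 1) mul1r ltrD2r -e ltr_pM2l.
have := lebesgue_rV_affine (const_mx 2^-1) (_ : 0 < (2 * r)^-1) (@rVmeas_cube R n).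
rewrite lebesgue_rV_cube -/B => /(_ _); rewrite invr_gt0 mulr_gt0// => /(_ isT) E.
rewrite ltNge leye_eq; apply/eqP => B1; move: E; rewrite B1 gt0_muley//.
by rewrite lte_fin exprn_gt0// invr_gt0 mulr_gt0.
Qed.

Lemma volE n (A : set 'rV[R]_n) : rVmeas A -> rVbounded A -> lebesgue_rV A = (vol A)%:E.
Proof. by move=> mA bA; rewrite fineK//; exact: lebesgue_rV_fin. Qed.

Lemma vol_ge0 n (A : set 'rV[R]_n) : 0 <= vol A.
Proof. by rewrite fine_ge0// lebesgue_rV_ge0. Qed.

Lemma vol_set0 n : vol (@set0 'rV[R]_n) = 0.
Proof. by rewrite /vol lebesgue_rV0. Qed.

Lemma rVboundedS n (A B : set 'rV[R]_n) : A `<=` B -> rVbounded B -> rVbounded A.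
Proof. by move=> AB [b bB]; exists b => x /AB/bB. Qed.

Lemma rVboundedU n (A B : set 'rV[R]_n) : rVbounded A -> rVbounded B -> rVbounded (A `|` B).
Proof.
move=> [a aA] [b bB]; exists (Num.max a b) => x [/aA|/bB] h;
by rewrite le_max h ?orbT.
Qed.

Lemma volU n (A B : set 'rV[R]_n) : rVmeas A -> rVmeas B -> rVbounded A -> rVbounded B ->
  [disjoint A & B] -> vol (A `|` B) = vol A + vol B.
Proof.
move=> mA mB bA bB AB; apply: EFin_inj.
by rewrite EFinD -!volE//; [exact: lebesgue_rVU|exact: rVmeasU|exact: rVboundedU].
Qed.

Lemma le_vol n (A B : set 'rV[R]_n) : rVmeas A -> rVmeas B -> rVbounded B ->
  A `<=` B -> vol A <= vol B.
Proof.
move=> mA mB bB AB; rewrite -lee_fin -!volE//; last exact: rVboundedS bB.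
exact: le_lebesgue_rV.
Qed.

Lemma vol_affine n (a : R) (b : 'rV[R]_n) (A : set 'rV[R]_n) :
  0 < a -> rVmeas A -> a ^+ n * vol [set x | A (a *: x + b)] = vol A.
Proof.
move=> a0 mA; rewrite /vol -(lebesgue_rV_affine b a0 mA).
have an : 0 < a ^+ n by rewrite exprn_gt0.
case: (lebesgue_rV [set x | A (a *: x + b)]) => [r| |] //=.
  by rewrite gt0_muley ?lte_fin//= mulr0.
by rewrite gt0_muleNy ?lte_fin//= mulr0.
Qed.

Lemma rVmeas_scale n (a : R) (b : 'rV[R]_n) (A : set 'rV[R]_n) :
  rVmeas A -> rVmeas [set x | A (a *: x + b)].
Proof.
move=> mA; rewrite (_ : mkset _ = [set x | A (x *m a%:M + b)]).
  exact: rVmeas_affine.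
by apply/funext => x /=; rewrite mul_mx_scalar.
Qed.

Lemma vol_translate n (b : 'rV[R]_n) (A : set 'rV[R]_n) :
  rVmeas A -> vol [set x | A (x + b)] = vol A.
Proof. by move=> mA; rewrite /vol lebesgue_rV_translate. Qed.

Lemma cube_bounded n : rVbounded (@cube R n).
Proof.
exists 1 => x cx; apply: norm_le_coord => // i.
by have /andP[x0 x1] := cx i; rewrite ger0_norm// ltW.
Qed.

Lemma vol_cube n : vol (@cube R n) = 1.
Proof. by rewrite /vol lebesgue_rV_cube. Qed.

(** The half-open cube of side [r] with lowest corner [q] lies in the ball, hence in [A]. *)
Lemma vol_gt0 n (A : set 'rV[R]_n) (q : 'rV[R]_n) (r : R) : rVmeas A -> rVbounded A ->
  0 < r -> (forall x, `|x - q| <= r -> A x) -> 0 < vol A.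
Proof.
move=> mA bA r0 H.
have H1 : r^-1 ^+ n * vol [set x | @cube R n (r^-1 *: x + - (r^-1 *: q))] = 1.
  by rewrite vol_affine ?vol_cube ?invr_gt0//; exact: rVmeas_cube.
suff : vol [set x | @cube R n (r^-1 *: x + - (r^-1 *: q))] <= vol A.
  apply: lt_le_trans; rewrite lt_neqAle vol_ge0 andbT; apply/eqP => E.
  by move: H1; rewrite -E mulr0 => /eqP; rewrite eq_sym oner_eq0.
apply: le_vol => //; first by apply: rVmeas_scale; exact: rVmeas_cube.
move=> x /= cx; apply: H; apply: norm_le_coord; first exact: ltW.
move=> i; have := cx i; rewrite !mxE -mulrBr => /andP[x0 x1].
rewrite ger0_norm; last by move: x0; rewrite pmulr_rge0// invr_gt0.
by move: x1; rewrite mulrC ltr_pdivrMr// mul1r => /ltW.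
Qed.

Lemma vol_bigcup n (I : choiceType) (D : set I) (F : I -> set 'rV[R]_n) :
  finite_set D -> (forall i, D i -> rVmeas (F i)) -> (forall i, D i -> rVbounded (F i)) ->
  trivIset D F ->
  [/\ rVmeas (\bigcup_(i in D) F i), rVbounded (\bigcup_(i in D) F i) &
      vol (\bigcup_(i in D) F i) = \sum_(i \in D) vol (F i)].
Proof.
move=> fD mF bF tF.
have mU : rVmeas (\bigcup_(i in D) F i).
  by rewrite /rVmeas preimage_bigcup; apply: fin_bigcup_measurable.
have bU : rVbounded (\bigcup_(i in D) F i).
  pose b i := if pselect (D i) is left h then sval (cid (bF i h)) else 0.
  exists (\sum_(i \in D) `|b i|) => x [i Di Fx].
  rewrite fsbig_finite//= (bigD1_seq i)//=; last by rewrite in_fset_set// inE.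
  rewrite ler_wpDr ?sumr_ge0// (le_trans _ (ler_norm _))// /b.
  by case: pselect => // h; case: cid => c /= /(_ x Fx).
split=> //; apply: EFin_inj; rewrite -volE//.
have [mu muE] := @lebesgue_tuple_sigma_finite R n.
rewrite /lebesgue_rV muE -[LHS]/(mu ((@rV_of_tuple R n) @^-1` (\bigcup_(i in D) F i))).
rewrite preimage_bigcup measure_fin_bigcup//.
  rewrite !fsbig_finite//= -sumEFin; apply: eq_big_seq => i /=.
  by rewrite in_fset_set// inE => Di; rewrite -volE; [rewrite /lebesgue_rV muE|exact: mF|exact: bF].
move=> i j Di Dj [t [Fi Fj]]; apply: tF => //; by exists (rV_of_tuple t).
Qed.

End vol.

(** * Lattice points and linear images of convex bodies *)

Section fsum.
Context {R : realType} {I : choiceType}.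
Implicit Types (A B : set I) (f g : I -> R).

Lemma ler_fsumr A f g : finite_set A -> (forall i, A i -> f i <= g i) ->
  \sum_(i \in A) f i <= \sum_(i \in A) g i.
Proof.
move=> fA fg; rewrite !fsbig_finite//= big_seq [leRHS]big_seq ler_sum// => i.
by rewrite in_fset_set// inE => /fg.
Qed.

Lemma ler_fsumr_subset A B f : finite_set A -> B `<=` A -> (forall i, A i -> 0 <= f i) ->
  \sum_(i \in B) f i <= \sum_(i \in A) f i.
Proof.
move=> fA BA f0; rewrite [leRHS](fsbigID B)//= setIidr// lerDl fsumr_ge0//.
by move=> i [/f0].
Qed.

End fsum.

(** * Weighted lattice points in a dilated convex body *)

Section lattice_count.
Context {R : realType}.

Definition rVconvex n (A : set 'rV[R]_n) := forall (a b : R) x y,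
  A x -> A y -> 0 <= a -> 0 <= b -> a + b = 1 -> A (a *: x + b *: y).

Definition convex_body n (Q : set 'rV[R]_n) := [/\ rVmeas Q, rVbounded Q, rVconvex Q &
  exists q, exists2 r, 0 < r & forall x, `|x - q| <= r -> Q x].

(** Shifted by [N], all coordinates become ordinals below [2 * N], so the points are images of
    finitely many functions. *)
Lemma finite_int_box n (b : R) : finite_set [set z : 'rV[int]_n | `|zpt z : 'rV[R]_n| <= b].
Proof.
pose N := (Num.truncn `|b|).+1.
apply: (@sub_finite_set _ _ ((fun f : {ffun 'I_n -> 'I_(N.*2)} =>
    \row_i ((f i)%:Z - N%:Z)) @` setT)); last first.
  by apply: finite_image; exact: finite_finset.
move=> z /= zb; have zN i : - N%:Z <= z 0 i < N%:Z.
  rewrite -(ler_int R) -(ltr_int R) mulrNz /= .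
  have h : `|(z 0 i)%:~R| < N%:~R :> R.
    have := coord_le_norm (zpt z : 'rV[R]_n) i; rewrite mxE => /le_lt_trans; apply.
    by rewrite (le_lt_trans zb)// (le_lt_trans (ler_norm b))// truncnS_gt.
  by move: h; rewrite ltr_norml => /andP[/ltW ->].
have zlt i : (`|(z 0 i + N%:Z)%R| < N.*2)%N.
  by have /andP[] := zN i; rewrite -addnn; lia.
exists [ffun i => Ordinal (zlt i)] => //; apply/rowP => i; rewrite !mxE ffunE /=.
by have /andP[zi _] := zN i; rewrite gez0_abs ?addrK// -lerBlDr sub0r.
Qed.

Definition tile n (M : 'M[R]_n) (z : 'rV[int]_n) : set 'rV[R]_n :=
  [set x | par M (x + - (zpt z *m M))].

(** Taking floors of the coordinates of [x] in the basis of rows finds its tile, so the tiles are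
    disjoint and cover the space. *)
Lemma tileP n (M : 'M[R]_n) z x : M \in unitmx ->
  tile M z x <-> z = \row_i Num.floor ((x *m invmx M) 0 i).
Proof.
move=> uM; rewrite /tile /= par_unitmx//= mulmxBl mulmxK//; split=> [c|->].
  apply/rowP => i; rewrite mxE; apply/esym/floor_def.
  by have := c i; rewrite !mxE subr_ge0 ltrBlDl intrD.
move=> i; rewrite !mxE subr_ge0 ltrBlDl -intrD1.
exact: floor_itv.
Qed.

Lemma rVmeas_tile n (M : 'M[R]_n) z : M \in unitmx -> rVmeas (tile M z).
Proof.
move=> uM; rewrite (_ : tile M z = [set x | par M (1 *: x + - (zpt z *m M))]).
  by apply: rVmeas_scale; exact: rVmeas_par.
by apply/funext => x; rewrite /= scale1r.
Qed.

Lemma par_bounded n (M : 'M[R]_n) : rVbounded (par M).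
Proof.
have [b bc] := @cube_bounded R n; have [C C0 MC] := norm_mulmx_le M.
exists (C * b) => _ [t /bc tb <-].
by rewrite (le_trans (MC _))// ler_pM2l.
Qed.

Lemma tile_bounded n (M : 'M[R]_n) z : rVbounded (tile M z).
Proof.
have [b bc] := par_bounded M; exists (b + `|zpt z *m M|) => x /bc xb.
by rewrite -(subrK (zpt z *m M) x) (le_trans (ler_normD _ _))// lerD2r.
Qed.

Lemma vol_tile n (M : 'M[R]_n) z : M \in unitmx -> vol (tile M z) = vol (par M).
Proof. by move=> uM; rewrite /tile vol_translate//; exact: rVmeas_par. Qed.

Lemma vol_tiles n (M : 'M[R]_n) (D : set 'rV[int]_n) : M \in unitmx -> finite_set D ->
  [/\ rVmeas (\bigcup_(z in D) tile M z), rVbounded (\bigcup_(z in D) tile M z) &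
      vol (\bigcup_(z in D) tile M z) = vol (par M) * \sum_(z \in D) (1 : R)].
Proof.
move=> uM fD; have [|||mU bU ->] := @vol_bigcup _ _ _ D (tile M) fD.
- by move=> *; exact: rVmeas_tile.
- by move=> *; exact: tile_bounded.
- by move=> z z' _ _ [x [/tileP-> // /tileP-> //]].
split=> //; rewrite mulr_fsumr; apply: eq_fsbigr => z _.
by rewrite vol_tile// mulr1.
Qed.

Lemma finite_lattice_body n (M : 'M[R]_n) (Q : set 'rV[R]_n) (m : R) : M \in unitmx ->
  rVbounded Q -> 0 < m -> finite_set [set z | Q (m^-1 *: (zpt z *m M))].
Proof.
move=> uM [b bQ] m0; have [C C0 MC] := norm_mulmx_le (invmx M).
apply: sub_finite_set (finite_int_box n (C * (m * b))) => z /= /bQ.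
rewrite normrZ gtr0_norm ?invr_gt0// mulrC ler_pdivrMr// mulrC => h.
rewrite -(mulmxK uM (zpt z)) (le_trans (MC _))// ler_pM2l//.
Qed.

(** Attach to each lattice point its tile. The tiles of points of weight surely 1 cover
    [(m - c) Q + c q], and the tiles of all counted points lie in [(m + c) Q - c q]; both inclusions
    come from writing a point as a convex combination with one member in the ball around [q]. *)
Lemma lattice_sum_bounds n (M : 'M[R]_n) (Q : set 'rV[R]_n) : M \in unitmx -> convex_body Q ->
  exists2 c : R, 0 < c & forall (m : R) (g : 'rV[int]_n -> R), c < m ->
    (forall z, Q (m^-1 *: (zpt z *m M)) -> 0 <= g z <= 1) ->
    (forall z, (forall u, `|u| <= 1 -> Q (m^-1 *: (zpt z *m M + u))) -> g z = 1) ->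
    (m - c) ^+ n * vol Q <=
      vol (par M) * \sum_(z \in [set z | Q (m^-1 *: (zpt z *m M))]) g z <=
    (m + c) ^+ n * vol Q.
Proof.
move=> uM [mQ bQ cQ [q [r r0 qr]]].
have [w0 Hw0] := par_bounded M; pose b := `|w0| + 1.
have b0 : 0 < b by rewrite ltr_pwDr.
(* With this [c], the point [q + c^-1 *: u] is in [Q] for every [u] of norm at most [b]. The bound
   [b] exceeds that of the cell by 1, to absorb the perturbations of norm at most 1 in the last
   hypothesis on [g]. *)
pose c := b / r; have c0 : 0 < c by rewrite divr_gt0.
have Qu u : `|u| <= b -> Q (q + c^-1 *: u).
  move=> ub; apply: qr; rewrite addrC addKr normrZ gtr0_norm ?invr_gt0//.
  by rewrite ler_pdivrMl// /c divfK// gt_eqF.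
have parb w : par M w -> `|w| + 1 <= b.
  by move=> /Hw0 h; rewrite lerD2r (le_trans h)// ler_norm.
exists c => // m g cm g01 g1; have m0 : 0 < m by apply: lt_trans cm.
set A := [set z | _].
have fA : finite_set A by exact: finite_lattice_body.
pose B := [set z | forall u, `|u| <= 1 -> Q (m^-1 *: (zpt z *m M + u))].
have BA : B `<=` A by move=> z /(_ 0); rewrite addr0 normr0; apply.
have fB : finite_set B by apply: sub_finite_set fA.
have parM : 0 <= vol (par M) by exact: vol_ge0.
apply/andP; split.
  apply: (@le_trans _ _ (vol (par M) * \sum_(z \in B) (1 : R))).
    have [mU bU <-] := vol_tiles uM fB.
    have mc0 : 0 < m - c by rewrite subr_gt0.
    rewrite -(vol_affine (- ((m - c)^-1 *: (c *: q))) (_ : 0 < (m - c)^-1) mQ); last by rewrite invr_gt0.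
    rewrite mulrA -exprMn divff ?gt_eqF// expr1n mul1r.
    apply: le_vol => //; first exact: rVmeas_scale.
    move=> x /= Qx; pose z := \row_i Num.floor ((x *m invmx M) 0 i).
    have tz : tile M z x by apply/tileP.
    exists z => // u u1.
    have -> : m^-1 *: (zpt z *m M + u) = ((m - c) / m) *: ((m - c)^-1 *: x - (m - c)^-1 *: (c *: q))
        + (c / m) *: (q + c^-1 *: (u - (x - zpt z *m M))).
      apply/rowP => i; rewrite !mxE; field.
      by rewrite !gt_eqF.
    apply: cQ => //; rewrite ?divr_ge0 ?ltW//; last by field; rewrite gt_eqF.
    apply: Qu; rewrite (le_trans (ler_normB _ _))// addrC (le_trans _ (parb _ tz))//.
    by rewrite lerD2l.
  rewrite ler_wpM2l// (eq_fsbigr g) => [|z /[!inE] Bz]; last by rewrite g1.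
  by apply: ler_fsumr_subset => // z /g01/andP[].
apply: (@le_trans _ _ (vol (par M) * \sum_(z \in A) (1 : R))).
  by rewrite ler_wpM2l// ler_fsumr// => z /g01/andP[].
have [mU bU <-] := vol_tiles uM fA.
have mc0 : 0 < m + c by rewrite addr_gt0.
rewrite -(vol_affine ((m + c)^-1 *: (c *: q)) (_ : 0 < (m + c)^-1) mQ); last by rewrite invr_gt0.
rewrite mulrA -exprMn divff ?gt_eqF// expr1n mul1r.
apply: le_vol => //; first exact: rVmeas_scale.
  have [bb Hb] := bQ; exists ((m + c) * (bb + `|(m + c)^-1 *: (c *: q)|)) => x /= /Hb.
  set y := _ *: (c *: q) => h; rewrite -ler_pdivrMl//.
  rewrite -(gtr0_norm (_ : 0 < (m + c)^-1)) ?invr_gt0// -normrZ.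
  by rewrite -(addrK y (_ *: x)) (le_trans (ler_normB _ _))// lerD2r.
move=> x [z Az tz] /=.
have -> : (m + c)^-1 *: x + (m + c)^-1 *: (c *: q) = (m / (m + c)) *: (m^-1 *: (zpt z *m M))
    + (c / (m + c)) *: (q + c^-1 *: (x - zpt z *m M)).
  apply/rowP => i; rewrite !mxE; field.
  by rewrite !gt_eqF.
apply: cQ => //; rewrite ?divr_ge0 ?ltW//; last by field; rewrite gt_eqF.
by apply: Qu; apply: le_trans (parb _ tz); rewrite lerDl.
Qed.

End lattice_count.

Section linear_image.
Context {R : realType}.

Lemma cube_convex n : rVconvex (@cube R n).
Proof.
move=> a b x y cx cy a0 b0 ab i; rewrite !mxE.
have /andP[x0 x1] := cx i; have /andP[y0 y1] := cy i.
rewrite addr_ge0 ?mulr_ge0//= -ab.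
have [a_eq0|a_neq0] := eqVneq a 0.
  have -> : b = 1 by rewrite -ab a_eq0 add0r.
  by rewrite a_eq0 mul0r !add0r mul1r.
apply: ltr_leD; last by rewrite ler_piMr// ltW.
by rewrite gtr_pMr// lt_neqAle eq_sym a_neq0.
Qed.

Lemma convex_body_mulmx n (N : 'M[R]_n) (Q : set 'rV[R]_n) :
  N \in unitmx -> convex_body Q -> convex_body [set x | Q (x *m invmx N)].
Proof.
move=> uN [mQ [b bQ] cQ [q [r r0 qr]]]; split.
- exact: rVmeas_mulmx.
- have [C C0 NC] := norm_mulmx_le N; exists (C * b) => x /= /bQ xb.
  by rewrite -(mulmxKV uN x) (le_trans (NC _))// ler_pM2l.
- move=> a c x y /= Qx Qy a0 c0 ac.
  by rewrite mulmxDl -!scalemxAl; exact: cQ.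
- have [C C0 NC] := norm_mulmx_le (invmx N).
  exists (q *m N), (r / C); first by rewrite divr_gt0.
  move=> x; rewrite ler_pdivlMr// mulrC => xr; apply: qr.
  by rewrite -[X in _ - X](mulmxK uN) -mulmxBl (le_trans (NC _)).
Qed.

Lemma convex_body_cube n : convex_body (@cube R n).
Proof.
split; [exact: rVmeas_cube|exact: cube_bounded|exact: cube_convex|].
exists (const_mx (2^-1)), (4^-1) => // x xr i.
have := le_trans (coord_le_norm _ i) xr; rewrite !mxE ler_distl => /andP[h1 h2].
by apply/andP; split; lra.
Qed.

Lemma convex_body_par n (N : 'M[R]_n) : N \in unitmx -> convex_body (par N).
Proof.
by move=> uN; rewrite par_unitmx//; apply: convex_body_mulmx => //; exact: convex_body_cube.
Qed.

Lemma vol_body_gt0 n (Q : set 'rV[R]_n) : convex_body Q -> 0 < vol Q.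
Proof. by move=> [mQ bQ _ [q [r r0 qr]]]; exact: vol_gt0 r0 qr. Qed.

(** Squeeze between [(1 - c / m) ^+ n] and [(1 + c / m) ^+ n] times the limit. The hypotheses are
    placed at [m.+1] because the inverse of 0 is 0. *)
Lemma lattice_sum_cvg n (M : 'M[R]_n) (Q : set 'rV[R]_n) (g : nat -> 'rV[int]_n -> R) :
  M \in unitmx -> convex_body Q ->
  (forall m z, Q (m.+1%:R^-1 *: (zpt z *m M)) -> 0 <= g m.+1 z <= 1) ->
  (forall m z, (forall u, `|u| <= 1 -> Q (m.+1%:R^-1 *: (zpt z *m M + u))) -> g m.+1 z = 1) ->
  (fun m : nat => (\sum_(z \in [set z | Q (m%:R^-1 *: (zpt z *m M))]) g m z) / m%:R ^+ n)
    @ \oo --> vol Q / vol (par M).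
Proof.
move=> uM bQ g01 g1; have [c c0 H] := lattice_sum_bounds uM bQ.
have p0 : 0 < vol (par M) by exact/vol_body_gt0/convex_body_par.
pose K := vol Q / vol (par M).
have cvc (s : R) : (fun m : nat => (1 + s * (m%:R)^-1) ^+ n * K) @ \oo --> K.
  suff : (fun m : nat => (1 + s * (m%:R)^-1) ^+ n * K) @ \oo --> (1 + s * 0) ^+ n * K.
    by rewrite mulr0 addr0 expr1n mul1r.
  apply: cvgM; last exact: cvg_cst.
  suff h : (fun m : nat => 1 + s * (m%:R)^-1) @ \oo --> 1 + s * 0.
    exact: (cvg_comp _ _ h (@exprn_continuous R n (1 + s * 0))).
  apply: cvgD; first exact: cvg_cst.
  apply: cvgM; first exact: cvg_cst.
  apply/gtr0_cvgV0; last exact: cvgr_idn.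
  by near=> m; rewrite ltr0n; near: m; exists 1%N.
apply: (squeeze_cvgr _ (cvc (- c)) (cvc c)).
near=> m.
have cm : c < m%:R by near: m; exact: nbhs_infty_gtr.
have m0 : 0 < m%:R :> R by apply: lt_trans cm.
have mE : m = m.-1.+1 by rewrite prednK// -(ltr0n R).
have g01m z : Q (m%:R^-1 *: (zpt z *m M)) -> 0 <= g m z <= 1.
  by rewrite mE; exact: g01.
have g1m z : (forall u, `|u| <= 1 -> Q (m%:R^-1 *: (zpt z *m M + u))) -> g m z = 1.
  by rewrite mE; exact: g1.
have /andP[h1 h2] := H m%:R (g m) cm g01m g1m.
have e (s : R) : (1 + s * m%:R^-1) ^+ n * K = (m%:R + s) ^+ n * vol Q / (vol (par M) * m%:R ^+ n).
  have -> : 1 + s * m%:R^-1 = (m%:R + s) / m%:R by field; rewrite gt_eqF.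
  by rewrite expr_div_n /K; field; rewrite !gt_eqF// exprn_gt0.
have pm : 0 < vol (par M) * m%:R ^+ n by rewrite mulr_gt0// exprn_gt0.
rewrite !e ler_pdivrMr// ler_pdivlMr//.
set S := \sum_(z \in _) _ in h1 h2 *.
have -> : S / m%:R ^+ n * (vol (par M) * m%:R ^+ n) = vol (par M) * S.
  by field; rewrite gt_eqF// exprn_gt0.
by rewrite h1.
Unshelve. all: by end_near. Qed.

(* Both sides are read off from counting the same integer points, once in the
   lattice of [N] and once in the standard lattice. *)
Lemma vol_mulmx n (N : 'M[R]_n) (Q : set 'rV[R]_n) : N \in unitmx -> convex_body Q ->
  vol [set x | Q (x *m invmx N)] = vol (par N) * vol Q.
Proof.
move=> uN bQ; have bQ' := convex_body_mulmx uN bQ.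
have i01 : 0 <= (1 : R) <= 1 by rewrite ler01 lexx.
have H1 := @lattice_sum_cvg n N _ (fun _ _ => 1) uN bQ' (fun _ _ _ => i01) (fun _ _ _ => erefl).
have H2 := @lattice_sum_cvg n 1%:M _ (fun _ _ => 1) (unitmx1 _ _) bQ (fun _ _ _ => i01) (fun _ _ _ => erefl).
have E0 : (fun m : nat => (\sum_(z \in [set z : 'rV[int]_n |
      [set x | Q (x *m invmx N)] (m%:R^-1 *: (zpt z *m N))]) (1 : R)) / m%:R ^+ n) =
    (fun m : nat => (\sum_(z \in [set z | Q (m%:R^-1 *: (zpt z *m 1%:M))]) (1 : R)) / m%:R ^+ n).
  apply/funext => m; congr (_ / _); apply: eq_fsbigl; apply/funext => z /=.
  by rewrite mulmx1 -scalemxAl mulmxK.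
rewrite E0 in H1; have E := cvg_unique _ H1 H2.
have p0 : 0 < vol (par N) by exact/vol_body_gt0/convex_body_par.
rewrite -[LHS](divfK (lt0r_neq0 p0)) mulrC; congr (_ * _).
by rewrite E ?par1 ?vol_cube ?divr1.
Qed.

Lemma vol_par_mulmx n (M N : 'M[R]_n) : M \in unitmx -> N \in unitmx ->
  vol (par (M *m N)) = vol (par M) * vol (par N).
Proof.
move=> uM uN; rewrite [RHS]mulrC -vol_mulmx//; last exact: convex_body_par.
congr vol; apply/seteqP; split => [_ [t ct <-]|x [t ct tM]] /=.
  by exists t; rewrite // mulmxA mulmxK.
by exists t; rewrite // mulmxA tM mulmxKV.
Qed.

Lemma vol_par_perm n (s : 'S_n) : vol (par (perm_mx s : 'M[R]_n)) = 1.
Proof.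
rewrite -(vol_cube n); congr vol; apply/seteqP; split => [_ [t ct <-] i|x cx].
  by rewrite -[s]invgK -col_permE mxE.
exists (col_perm s x); first by move=> i; rewrite mxE.
by rewrite col_permE -mulmxA -perm_mxM mulVg perm_mx1 mulmx1.
Qed.

Lemma vol_par_upper n (T : 'M[R]_n) :
  (forall i j : 'I_n, (j < i)%N -> T i j = 0) -> T \in unitmx ->
  vol (par T) = `|\det T|.
Proof.
move=> Tu uT; rewrite /vol lebesgue_rV_par_upper//= -det_tr det_trig.
  by rewrite normr_prod; apply: eq_bigr => i _; rewrite mxE.
by apply/is_trig_mxP => i j ij; rewrite mxE Tu.
Qed.

(** Conjugation by the order-reversing permutation makes the matrix upper triangular and changes
    neither the volume nor the absolute determinant. *)
Lemma vol_par_lower n (T : 'M[R]_n) :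
  (forall i j : 'I_n, (i < j)%N -> T i j = 0) -> T \in unitmx ->
  vol (par T) = `|\det T|.
Proof.
move=> Tl uT; pose w : 'S_n := perm (@rev_ord_inj n).
have ww : (w * w = 1)%g by apply/permP => i; rewrite permM !permE rev_ordK.
have wi : (w^-1)%g = w by apply/eqP; rewrite eq_invg_mul ww.
pose T' := perm_mx w *m T *m perm_mx w.
have uT' : T' \in unitmx by rewrite !unitmx_mul !unitmx_perm uT.
have H : vol (par T') = `|\det T'|.
  apply: vol_par_upper => // i j ji.
  rewrite /T' -mulmxA -row_permE mxE -{1}wi -col_permE mxE !permE; apply: Tl => /=.
  by have := ltn_ord i; lia.
have -> : T = perm_mx w *m T' *m perm_mx w.
  by rewrite /T' -!mulmxA -perm_mxM ww perm_mx1 mulmx1 mulmxA -perm_mxM ww perm_mx1 mul1mx.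
clearbody T'.
rewrite !vol_par_mulmx ?unitmx_mul ?unitmx_perm// !vol_par_perm mul1r mulr1 H.
by rewrite !det_mulmx !normrM !det_perm !normrX !normrN1 !expr1n mul1r mulr1.
Qed.

(** Both sides are multiplicative and agree on the factors of an LUP decomposition, which is
    available in positive dimension. *)
Lemma vol_par n (M : 'M[R]_n) : M \in unitmx -> vol (par M) = `|\det M|.
Proof.
case: n M => [M _|n M uM].
  rewrite det_mx00 normr1 -(vol_cube 0) -par1; congr (vol (par _)).
  by apply/matrixP => -[].
have := cormen_lup_correct M; have := cormen_lup_perm M.
have := cormen_lup_detL M; have := @cormen_lup_lower _ _ M; have := @cormen_lup_upper _ _ M.
case: cormen_lup => -[P L] U /= Uu Ll dL /is_perm_mxP[s ->] E.
have uL : L \in unitmx by rewrite unitmxE dL unitr1.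
have uP : (perm_mx s : 'M[R]_n.+1) \in unitmx by exact: unitmx_perm.
have {}E : perm_mx s *m M = L *m U by exact: E.
have uU : U \in unitmx.
  have : L *m U \in unitmx by rewrite -E unitmx_mul uP uM.
  by rewrite unitmx_mul => /andP[].
have := congr1 (fun A => vol (par A)) E; have := congr1 (fun A => `|\det A|) E.
rewrite !vol_par_mulmx// !det_mulmx !normrM vol_par_perm det_perm normrX normrN1 expr1n !mul1r.
move=> -> ->; rewrite vol_par_lower// ?vol_par_upper//.
by move=> i j ij; rewrite Ll ?(ltnW ij)// -val_eqE /= ltn_eqF.
Qed.

End linear_image.

(** * Orthonormal coordinates and solid angles *)

Section dot_product.
Context {R : realType}.
Implicit Types d m n : nat.

Lemma dotrE d (x y : 'rV[R]_d) : dotr x y = \sum_i x 0 i * y 0 i.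
Proof. by rewrite /dotr mxE; apply: eq_bigr => i _; rewrite mxE. Qed.

Lemma dotrC d (x y : 'rV[R]_d) : dotr x y = dotr y x.
Proof. by rewrite !dotrE; apply: eq_bigr => i _; rewrite mulrC. Qed.

Lemma dotrDl d (x y z : 'rV[R]_d) : dotr (x + y) z = dotr x z + dotr y z.
Proof. by rewrite /dotr mulmxDl mxE. Qed.

Lemma dotrDr d (x y z : 'rV[R]_d) : dotr x (y + z) = dotr x y + dotr x z.
Proof. by rewrite !(dotrC x) dotrDl. Qed.

Lemma dotrZl d (a : R) (x y : 'rV[R]_d) : dotr (a *: x) y = a * dotr x y.
Proof. by rewrite /dotr -scalemxAl mxE. Qed.

Lemma dotrZr d (a : R) (x y : 'rV[R]_d) : dotr x (a *: y) = a * dotr x y.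
Proof. by rewrite !(dotrC x) dotrZl. Qed.

Lemma dotrNl d (x y : 'rV[R]_d) : dotr (- x) y = - dotr x y.
Proof. by rewrite -scaleN1r dotrZl mulN1r. Qed.

Lemma dotrNr d (x y : 'rV[R]_d) : dotr x (- y) = - dotr x y.
Proof. by rewrite !(dotrC x) dotrNl. Qed.

Lemma dotrBl d (x y z : 'rV[R]_d) : dotr (x - y) z = dotr x z - dotr y z.
Proof. by rewrite dotrDl dotrNl. Qed.

Lemma dotrBr d (x y z : 'rV[R]_d) : dotr x (y - z) = dotr x y - dotr x z.
Proof. by rewrite dotrDr dotrNr. Qed.

Lemma dotr0l d (x : 'rV[R]_d) : dotr 0 x = 0.
Proof. by rewrite /dotr mul0mx mxE. Qed.

Lemma dotr0r d (x : 'rV[R]_d) : dotr x 0 = 0.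
Proof. by rewrite dotrC dotr0l. Qed.

Lemma dotr_sumr d (I : Type) (s : seq I) (x : 'rV[R]_d) (f : I -> 'rV[R]_d) :
  dotr x (\sum_(i <- s) f i) = \sum_(i <- s) dotr x (f i).
Proof. by elim/big_rec2: _ => [|i a b _ <-]; rewrite ?dotr0r// dotrDr. Qed.

Lemma dotr_ge0 d (x : 'rV[R]_d) : 0 <= dotr x x.
Proof. by rewrite dotrE sumr_ge0// => i _; rewrite -expr2 sqr_ge0. Qed.

Lemma dotr_eq0 d (x : 'rV[R]_d) : (dotr x x == 0) = (x == 0).
Proof.
apply/eqP/eqP => [|->]; last exact: dotr0l.
rewrite dotrE => /psumr_eq0P H; apply/rowP => i; rewrite mxE.
have := H (fun i _ => _) i isT; rewrite -expr2 => /(_ _)/eqP; rewrite sqrf_eq0 => h.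
by apply/eqP/h => j; rewrite -expr2 sqr_ge0.
Qed.

Lemma dotr_gt0 d (x : 'rV[R]_d) : (0 < dotr x x) = (x != 0).
Proof. by rewrite lt_neqAle dotr_ge0 andbT eq_sym dotr_eq0. Qed.

Lemma enorm_ge0 d (x : 'rV[R]_d) : 0 <= enorm x.
Proof. exact: sqrtr_ge0. Qed.

Lemma enorm_gt0 d (x : 'rV[R]_d) : (0 < enorm x) = (x != 0).
Proof. by rewrite sqrtr_gt0 dotr_gt0. Qed.

Lemma enormZ d (a : R) (x : 'rV[R]_d) : enorm (a *: x) = `|a| * enorm x.
Proof. by rewrite /enorm dotrZl dotrZr mulrA -expr2 sqrtrM ?sqr_ge0// sqrtr_sqr. Qed.

Lemma enorm_sqr d (x : 'rV[R]_d) : enorm x ^+ 2 = dotr x x.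
Proof. by rewrite sqr_sqrtr// dotr_ge0. Qed.

Lemma norm_le_enorm d (x : 'rV[R]_d) : `|x| <= enorm x.
Proof.
apply: norm_le_coord => [|i]; first exact: enorm_ge0.
rewrite -sqrtr_sqr ler_sqrt ?dotr_ge0// dotrE (bigD1 i)//= -expr2 lerDl.
by rewrite sumr_ge0// => j _; rewrite -expr2 sqr_ge0.
Qed.

Lemma enorm_le_norm d (x : 'rV[R]_d) : enorm x <= d%:R * `|x|.
Proof.
rewrite -(ler_pXn2r (_ : (0 < 2)%N)) ?nnegrE ?enorm_ge0 ?mulr_ge0//.
rewrite enorm_sqr dotrE exprMn.
apply: (@le_trans _ _ (\sum_(i < d) `|x| ^+ 2)).
  by apply: ler_sum => i _; rewrite -expr2 -real_normK ?num_real// lerXn2r ?nnegrE ?coord_le_norm.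
rewrite sumr_const card_ord -[leLHS]mulr_natl ler_wpM2r ?sqr_ge0//.
by rewrite -natrX ler_nat; case: (d) => // k; rewrite -[leqLHS]expn1 leq_pexp2l.
Qed.

Lemma continuous_sumr (T : topologicalType) (I : Type) (s : seq I) (f : I -> T -> R) :
  (forall i, continuous (f i)) -> continuous (fun t => \sum_(i <- s) f i t).
Proof.
move=> cf t; elim: s => [|i s IH].
  rewrite (_ : (fun _ => _) = cst 0); first exact: cvg_cst.
  by apply/funext => u; rewrite big_nil.
rewrite (_ : (fun _ => _) = (fun u => f i u + \sum_(i <- s) f i u)).
  exact: (cvgD (cf i t) IH).
by apply/funext => u; rewrite big_cons.
Qed.

Lemma dotr_continuousr d (x : 'rV[R]_d) : continuous (dotr x).
Proof.
rewrite (_ : dotr x = (fun y => \sum_i x 0 i * y 0 i)); last first.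
  by apply/funext => y; rewrite dotrE.
by apply: continuous_sumr => i y; exact: (cvgM (cvg_cst _) (@coord_continuous _ _ _ 0 i y)).
Qed.

Lemma dotr_sqr_continuous d : continuous (fun x : 'rV[R]_d => dotr x x).
Proof.
rewrite (_ : (fun _ => _) = (fun y : 'rV[R]_d => \sum_i y 0 i * y 0 i)); last first.
  by apply/funext => y; rewrite dotrE.
by apply: continuous_sumr => i y; exact: (cvgM (@coord_continuous _ _ _ 0 i y) (@coord_continuous _ _ _ 0 i y)).
Qed.

Lemma enorm_le1E d (x : 'rV[R]_d) : (enorm x <= 1) = (dotr x x <= 1).
Proof. by rewrite -{1}(sqrtr1 R) ler_sqrt. Qed.

Lemma closed_eball d : closed [set x : 'rV[R]_d | enorm x <= 1].
Proof.
rewrite (_ : mkset _ = (fun x => dotr x x) @^-1` [set r | r <= 1]).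
  by apply: preimage_closed; [move=> x _; exact: dotr_sqr_continuous|exact: closed_le].
by apply/funext => x; rewrite /= /mkset /preimage/= enorm_le1E.
Qed.

Lemma closed_halfspace d (c : 'rV[R]_d) (b : R) : closed [set x | dotr c x <= b].
Proof.
rewrite (_ : mkset _ = (dotr c) @^-1` [set r | r <= b])//.
by apply: preimage_closed; [move=> x _; exact: dotr_continuousr|exact: closed_le].
Qed.

End dot_product.

Section null_sets.
Context {R : realType}.

(* Infinitely many disjoint translates of [A] fit into a bounded set. *)
Lemma vol_hyperplane n (A : set 'rV[R]_n) (c : 'rV[R]_n) : c != 0 ->
  rVmeas A -> rVbounded A -> (forall x, A x -> dotr x c = 0) -> vol A = 0.
Proof.
move=> c0 mA [b bA] Ac.
pose S := [set x : 'rV[R]_n | `|x| <= b + `|c|].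
have mS : rVmeas S.
  apply: rVmeas_closed; rewrite (_ : S = (fun x => `|x|) @^-1` [set r | r <= b + `|c|])//.
  by apply: preimage_closed; [move=> x _; exact: norm_continuous|exact: closed_le].
have bS : rVbounded S by exists (b + `|c|).
(* The shifts are fractions of [c], so all [N.+1] translates stay in [S], however large [N] is. *)
pose F N (j : nat) := [set x | A (x + - ((j%:R / N.+1%:R) *: c))].
have mF N j : rVmeas (F N j).
  rewrite /F (_ : mkset _ = [set x | A (1 *: x + - ((j%:R / N.+1%:R) *: c))]).
    exact: rVmeas_scale.
  by apply/funext => x /=; rewrite scale1r.
have FS N j : (j < N.+1)%N -> F N j `<=` S.
  move=> jN x /bA xb; rewrite /S/= -(subrK ((j%:R / N.+1%:R) *: c) x).
  rewrite (le_trans (ler_normD _ _))// lerD// normrZ ger0_norm ?divr_ge0//.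
  by rewrite ler_piMl// ler_pdivrMr// mul1r ler_nat ltnW.
have H N : N.+1%:R * vol A <= vol S.
  have [|||mU bU volF] := @vol_bigcup R n nat `I_N.+1 (F N) (finite_II _).
  - by move=> *; exact: mF.
  - by move=> j /= jN; apply: rVboundedS bS; exact: FS.
  - move=> i j _ _ [x [/Ac xi /Ac xj]].
    move: xi; rewrite dotrDl dotrNl dotrZl => /eqP; rewrite subr_eq0 => /eqP xi.
    move: xj; rewrite dotrDl dotrNl dotrZl xi => /eqP; rewrite subr_eq0 => /eqP.
    move=> /(mulIf _)-/(_ _)/(mulIf _); rewrite dotr_eq0 invr_eq0 pnatr_eq0 => /(_ isT c0)/eqP.
    by rewrite eqr_nat => /eqP.
  have : vol (\bigcup_(j in `I_N.+1) F N j) <= vol S.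
    by apply: le_vol => // x [j /= jN]; exact: FS.
  rewrite volF (eq_fsbigr (fun=> vol A)); last first.
    by move=> j _; rewrite /F vol_translate.
  by rewrite -fsbig_ord sumr_const card_ord mulr_natl.
apply/eqP; rewrite eq_le vol_ge0 andbT leNgt; apply/negP => v0.
have := H (Num.truncn (vol S / vol A)); rewrite leNgt => /negP; apply.
by rewrite -ltr_pdivrMr// truncnS_gt.
Qed.

End null_sets.

(** * Orthonormal bases, linear spans and orthogonal complements *)

Section orthonormal.
Context {R : realType} {d : nat}.
Local Notation E := 'rV[R]_d.
Implicit Types (L U W : {vspace E}) (S : set E).

(** The rows below the first are orthonormalized by induction. The first row minus its projection,
    [r], is nonzero by independence and is then normalized. *)
Lemma gram_schmidt m (A : 'M[R]_(m, d)) : row_free A ->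
  exists2 B : 'M[R]_(m, d), B *m B^T = 1%:M & (B :=: A)%MS.
Proof.
elim: m A => [|m IH] A fA.
  by exists A => //; apply/matrixP => -[].
pose A1 : 'M[R]_(1 + m, d) := A.
have AE : A = col_mx (usubmx A1) (dsubmx A1) :> 'M[R]_(1 + m, d) by rewrite vsubmxK.
set a := usubmx A1 in AE; set A' := dsubmx A1 in AE.
have fA1 : row_free (col_mx a A') by rewrite -AE.
have fA' : row_free A'.
  apply/row_freeP; have /row_freeP[X AX] := fA1.
  exists (rsubmx (X : 'M[R]_(d, 1 + m))).
  move: AX; rewrite -{1}[X](@hsubmxK _ _ 1 m) mul_col_row (@scalar_mx_block _ 1 m).
  by move=> /eq_block_mx[].
have [B' BB' eqB'] := IH A' fA'.
pose r := a - a *m B'^T *m B'.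
have r0 : r != 0.
  apply/eqP => /eqP; rewrite subr_eq0 => /eqP aE.
  have /submxP[D aD] : (a <= A')%MS by rewrite -eqB' aE submxMl.
  have /eqP : (row_mx 1 (- D) : 'M[R]_(1, 1 + m)) *m col_mx a A' = 0.
    by rewrite mul_row_col mul1mx mulNmx -aD subrr.
  rewrite mulmx_free_eq0// => /eqP/(congr1 (fun M => lsubmx (M : 'M[R]_(1, 1 + m)) 0 0)).
  by rewrite row_mxKl !mxE => /eqP; rewrite oner_eq0.
have rB' : r *m B'^T = 0 by rewrite mulmxBl -!mulmxA BB' mulmx1 subrr.
pose e := (enorm r)^-1 *: r.
have e1 : e *m e^T = 1%:M.
  apply/matrixP => i j; rewrite !ord1 -[LHS]/(dotr e e) dotrZl dotrZr -enorm_sqr mxE eqxx.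
  by rewrite mulrA -invfM -expr2 mulVf// expf_neq0// gt_eqF// enorm_gt0.
exists (col_mx e B' : 'M[R]_(1 + m, d)).
  rewrite (@tr_col_mx _ 1) (@mul_col_row _ 1 m _ 1 m) e1 BB' -scalemxAl rB' scaler0.
  rewrite -[B' *m e^T]trmxK trmx_mul trmxK -scalemxAl rB' scaler0 trmx0.
  by rewrite -scalar_mx_block.
have eqr : (col_mx a A' :=: col_mx e B')%MS.
  apply/eqmxP; rewrite -!addsmxE; apply/andP; split.
    rewrite addsmx_sub -eqB' addsmxSr andbT.
    rewrite -[a](subrK (a *m B'^T *m B')) -/r addmx_sub//; last first.
      by rewrite (submx_trans (submxMl _ _))// addsmxSr.
    rewrite (submx_trans _ (addsmxSl _ _))// /e.
    by rewrite -[r in (r <= _)%MS](scalerK (lt0r_neq0 (_ : 0 < enorm r))) ?enorm_gt0//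
      scalerA mulVf ?scale1r ?gt_eqF ?enorm_gt0// eqmx_scale// invr_eq0 gt_eqF// enorm_gt0.
  rewrite addsmx_sub eqB' addsmxSr andbT scalemx_sub// /r.
  rewrite addmx_sub ?addsmxSl// -mulNmx (submx_trans (submxMl _ _))// eqB' addsmxSr//.
by move: eqr; rewrite -AE => /eqmx_sym.
Qed.

(** The specification is satisfiable, so the choice in [orthonormal_basis] never takes its
    default. *)
Lemma orthonormal_basisP L :
  orthonormal_basis L *m (orthonormal_basis L)^T = 1%:M /\
  forall x : E, x \in L <-> (x <= orthonormal_basis L)%MS.
Proof.
rewrite /orthonormal_basis; set S := [set B | _].
suff [B SB] : S !=set0 by have := @xgetPex _ 0 S (ex_intro _ B SB).
pose A := \matrix_(i < \dim L) (vbasis L)`_i.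
have fA : row_free A.
  rewrite -kermx_eq0; apply/rowV0P => c /sub_kermxP cA.
  have /freeP fb := basis_free (vbasisP L).
  apply/rowP => i; rewrite mxE; apply: fb.
  by rewrite -[RHS]cA mulmx_sum_row; apply: eq_bigr => j _; rewrite rowK.
have [B BB eqB] := gram_schmidt fA; exists B; split=> // x; rewrite eqB; split=> [|/submxP[c ->]].
  move=> /coord_vbasis ->; apply: summx_sub => i _; rewrite scalemx_sub//.
  by rewrite -[X in (X <= _)%MS](rowK (fun i : 'I__ => (vbasis L)`_i)) row_sub.
rewrite mulmx_sum_row memv_suml// => i _; rewrite memvZ// rowK.
by apply: vbasis_mem; rewrite mem_nth// size_tuple.
Qed.

Local Notation ob := orthonormal_basis.

Lemma ob_orth L : ob L *m (ob L)^T = 1%:M.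
Proof. by have [] := orthonormal_basisP L. Qed.

Lemma mem_ob L (y : 'rV[R]_(\dim L)) : y *m ob L \in L.
Proof. by have [_ ->] := orthonormal_basisP L; rewrite submxMl. Qed.

Lemma obK L x : x \in L -> x *m (ob L)^T *m ob L = x.
Proof.
have [B1 ->] := orthonormal_basisP L => /submxP[D ->].
by rewrite -(mulmxA D) B1 mulmx1.
Qed.

Lemma dotr_orthonormal L (x y : 'rV[R]_(\dim L)) : dotr (x *m ob L) (y *m ob L) = dotr x y.
Proof. by rewrite /dotr trmx_mul mulmxA -(mulmxA x) ob_orth mulmx1. Qed.

Lemma enorm_ob L (x : 'rV[R]_(\dim L)) : enorm (x *m ob L) = enorm x.
Proof. by rewrite /enorm dotr_orthonormal. Qed.

(** A subspace of least dimension containing [S] is the least one: intersecting it with any other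
    such subspace cannot lower the dimension. *)
Lemma linP S : (S `<=` [set` lin S]) /\ forall W, S `<=` [set` W] -> (lin S <= W)%VS.
Proof.
rewrite /lin; set C := (X in xget _ X).
suff [U CU] : C !=set0 by have := @xgetPex _ 0%VS C (ex_intro _ U CU).
pose P n := `[< exists2 U : {vspace E}, S `<=` [set` U] & \dim U = n >].
have exP : exists n, P n by exists (\dim {:E}); apply/asboolP; exists fullv => // x _; rewrite /= memvf.
have [n /asboolP[U SU Un] minn] := ex_minnP exP.
exists U; split => // W SW; have SUW : S `<=` [set` (U :&: W)%VS].
  by move=> x Sx /=; rewrite memv_cap; apply/andP; split; [exact: SU|exact: SW].
have : (n <= \dim (U :&: W))%N by apply: minn; apply/asboolP; exists (U :&: W)%VS.
rewrite -Un => dU; have /eqP <- : (U :&: W == U)%VS by rewrite eqEdim capvSl.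
exact: capvSr.
Qed.

Lemma sub_lin S : S `<=` [set` lin S]. Proof. by have [] := linP S. Qed.

Lemma lin_sub S W : S `<=` [set` W] -> (lin S <= W)%VS.
Proof. by have [_] := linP S; apply. Qed.

Lemma lin_eq S W : S `<=` [set` W] -> (W <= lin S)%VS -> lin S = W.
Proof. by move=> SW WS; apply/eqP; rewrite eqEsubv WS lin_sub. Qed.

Definition orthv L : {vspace E} := lker (linfun (mulmxr (ob L)^T)).

Lemma orthvP L x : x \in orthv L <-> forall u, u \in L -> dotr x u = 0.
Proof.
rewrite memv_ker lfunE /=; split=> [/eqP xB u /obK <-|xL].
  by rewrite /dotr trmx_mul mulmxA xB mul0mx mxE.
apply/eqP/rowP => i; rewrite [RHS]mxE.
transitivity (dotr x (row i (ob L))); last by apply: xL; rewrite rowE mem_ob.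
by rewrite dotrE mxE; apply: eq_bigr => j _; rewrite !mxE.
Qed.

Lemma orthv_decomp L x : x - x *m (ob L)^T *m ob L \in orthv L.
Proof. by rewrite memv_ker lfunE /= mulmxBl -!mulmxA ob_orth mulmx1 subrr. Qed.

(** The component of [x] orthogonal to [L] is orthogonal to itself. *)
Lemma orthvK L x : (forall u, u \in orthv L -> dotr x u = 0) -> x \in L.
Proof.
move=> xL; have := xL _ (orthv_decomp L x).
set r := x - _; have rL : r \in orthv L by exact: orthv_decomp.
have pL := mem_ob (x *m (ob L)^T).
rewrite -{1}(subrK (x *m (ob L)^T *m ob L) x) -/r dotrDl (dotrC _ r).
rewrite [X in _ + X](_ : _ = 0) ?addr0; last by move/orthvP : rL; apply.
by move=> /eqP; rewrite dotr_eq0 subr_eq0 => /eqP ->.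
Qed.

End orthonormal.

(** * Angles as fractions of a ball *)

Section angle.
Context {R : realType} {d : nat}.
Local Notation E := 'rV[R]_d.
Local Notation ob := orthonormal_basis.
Implicit Types (L W : {vspace E}) (A B C : set E).

Let eball n : set 'rV[R]_n := [set y | enorm y <= 1].

Let rVmeas_eball n : rVmeas (@eball n).
Proof. by apply: rVmeas_closed; exact: closed_eball. Qed.

Let eball_bounded n : rVbounded (@eball n).
Proof. by exists 1 => x; exact: le_trans (norm_le_enorm x). Qed.

Let vol_eball_gt0 n : 0 < vol (@eball n).
Proof.
apply: (@vol_gt0 _ _ _ 0 (n.+1%:R^-1)) => // x; rewrite subr0 => xn.
rewrite /eball/= (le_trans (enorm_le_norm x))//.
rewrite (le_trans (ler_wpM2l _ xn))// ler_pdivrMr// mul1r ler_nat.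
exact: leqnSn.
Qed.

(* The fraction of the unit ball of [L] covered by [A]; for a cone spanning [L]
   this is its solid angle, but it is meaningful for arbitrary [L] and [A]. *)
Definition ang L A : R :=
  vol_in L [set x | enorm x <= 1 /\ A x] / vol_in L [set x | enorm x <= 1].

Let trace L A : set 'rV[R]_(\dim L) := @eball _ `&` [set y | A (y *m ob L)].

Arguments trace : clear implicits.

Let angE L A : ang L A = vol (trace L A) / vol (@eball (\dim L)).
Proof.
rewrite /ang /vol_in /vol; congr (_ / _).
  by congr (fine (lebesgue_rV _)); apply/funext => y; rewrite /trace/eball/setI/= enorm_ob.
by congr (fine (lebesgue_rV _)); apply/funext => y; rewrite /eball/= enorm_ob.
Qed.

Let rVmeas_trace L A : rVmeas A -> rVmeas (trace L A).
Proof. by move=> mA; apply: rVmeasI => //; exact: rVmeas_mulmx. Qed.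

Let trace_bounded L A : rVbounded (trace L A).
Proof. by apply: rVboundedS (@eball_bounded _) => x []. Qed.

Lemma angU L A B : rVmeas A -> rVmeas B -> (forall x, A x -> B x -> False) ->
  ang L (A `|` B) = ang L A + ang L B.
Proof.
move=> mA mB AB; rewrite !angE -mulrDl -volU; try exact: rVmeas_trace; try exact: trace_bounded.
  by congr (vol _ / _); rewrite /trace -setIUr.
by apply/disj_set2P/seteqP; split => // y [[_ Ay] [_ By]]; exact: AB By.
Qed.

Lemma eq_ang L A B : (forall x, x \in L -> A x <-> B x) -> ang L A = ang L B.
Proof.
move=> AB; rewrite !angE; congr (vol _ / _); apply/seteqP.
by split => y [yb /=] /(AB _ (mem_ob _)).
Qed.

Lemma le_ang L A B : rVmeas A -> rVmeas B -> (forall x, A x -> B x) -> ang L A <= ang L B.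
Proof.
move=> mA mB AB; rewrite !angE ler_wpM2r ?invr_ge0 ?vol_ge0// le_vol//; try exact: rVmeas_trace.
by move=> y [yb /AB].
Qed.

Lemma ang_ge0 L A : 0 <= ang L A.
Proof. by rewrite angE mulr_ge0 ?invr_ge0 ?vol_ge0. Qed.

Lemma ang_eq1 L A : (forall x, x \in L -> A x) -> ang L A = 1.
Proof.
move=> LA; rewrite angE (_ : trace L A = @eball _) ?divff ?gt_eqF//.
by apply/seteqP; split => [y []//|y yb]; split => //; exact/LA/mem_ob.
Qed.

Lemma ang_le1 L A : rVmeas A -> ang L A <= 1.
Proof.
move=> mA; rewrite -(@ang_eq1 L setT)//; apply: le_ang => //; exact: rVmeasT.
Qed.

Lemma ang_null L W A : rVmeas A -> ~~ (L <= W)%VS ->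
  (forall x, x \in L -> A x -> x \in W) -> ang L A = 0.
Proof.
move=> mA LW AW; have [x xL xW] : exists2 x, x \in L & x \notin W.
  by apply/not_exists2P => H; case/negP: LW; apply/subvP => x xL;
    have [//|/negP] := H x; rewrite negbK.
pose W' := (L :&: W)%VS; pose p := x *m (ob W')^T *m ob W'.
have pW : p \in W' by exact: mem_ob.
have pL : p \in L by move: pW; rewrite memv_cap => /andP[].
have rW : x - p \in orthv W' by exact: orthv_decomp.
pose c := (x - p) *m (ob L)^T.
have cE : c *m ob L = x - p by rewrite obK// rpredB.
rewrite angE (@vol_hyperplane _ _ _ c) ?mul0r//; [|exact: rVmeas_trace|].
  apply: contra xW => /eqP c0; move: cE; rewrite c0 mul0mx => /esym/eqP.
  by rewrite subr_eq0 => /eqP ->; move: pW; rewrite memv_cap => /andP[].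
move=> y [_ /= Ay]; rewrite -dotr_orthonormal cE dotrC; move/orthvP : rW; apply.
by rewrite memv_cap mem_ob AW// mem_ob.
Qed.

Lemma ang_fsumD L (I : choiceType) (D : set I) (F : I -> set E) :
  finite_set D -> (forall i, D i -> rVmeas (F i)) ->
  (forall i j x, D i -> D j -> F i x -> F j x -> i = j) ->
  ang L (\bigcup_(i in D) F i) = \sum_(i \in D) ang L (F i).
Proof.
move=> fD mF dF; have [|||mU bU volF] := @vol_bigcup R _ I D (fun i => trace L (F i)) fD.
- by move=> i Di; apply: rVmeas_trace; exact: mF.
- by move=> i _; exact: trace_bounded.
- by move=> i j Di Dj [y [[_ Fi] [_ Fj]]]; exact: dF Fi Fj.
rewrite angE (_ : trace _ _ = \bigcup_(i in D) trace L (F i)).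
  by rewrite volF mulr_fsuml; apply: eq_fsbigr => i _; rewrite angE.
by rewrite /trace -setI_bigcupr.
Qed.

Lemma ang0 L : ang L set0 = 0.
Proof.
rewrite angE (_ : trace _ _ = set0) ?vol_set0 ?mul0r//.
by apply/seteqP; split => y // [].
Qed.

Lemma angID L A B : rVmeas A -> rVmeas B -> ang L A = ang L (A `\` B) + ang L (A `&` B).
Proof.
move=> mA mB; rewrite -angU; [|exact: rVmeasD|exact: rVmeasI|by move=> x [_ ?] []].
congr ang; apply/seteqP; split => [x Ax|x [[]|[]]//].
by have [Bx|Bx] := pselect (B x); [right|left].
Qed.

Lemma ang_bigcup_null L (I : choiceType) (D : set I) (F : I -> set E) :
  finite_set D -> (forall i, D i -> rVmeas (F i)) -> (forall i, D i -> ang L (F i) = 0) ->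
  rVmeas (\bigcup_(i in D) F i) /\ ang L (\bigcup_(i in D) F i) = 0.
Proof.
move=> /finite_seqP[s ->]; elim: s => [|i s IH] mF F0.
  by rewrite set_nil bigcup_set0 ang0; split => //; exact: rVmeas0.
have [|| mU U0] := IH.
- by move=> j js; apply: mF; rewrite /= inE js orbT.
- by move=> j js; apply: F0; rewrite /= inE js orbT.
have -> : \bigcup_(j in [set` i :: s]) F j = F i `|` (\bigcup_(j in [set` s]) F j `\` F i).
  apply/seteqP; split => [x [j]|x].
    rewrite /= inE => /orP[/eqP ->|js Fx]; first by left.
    have [Fi|Fi] := pselect (F i x); [by left|right; split => //; by exists j].
  case=> [Fx|[[j js Fx] _]]; first by exists i; rewrite //= inE eqxx.
  by exists j; rewrite //= inE js orbT.
have mi : rVmeas (F i) by apply: mF; rewrite /= inE eqxx.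
have mD : rVmeas (\bigcup_(j in [set` s]) F j `\` F i) by exact: rVmeasD.
split; first exact: rVmeasU.
have Fi0 : ang L (F i) = 0 by apply: F0; rewrite /= inE eqxx.
rewrite angU// => [|x Fx []//]; rewrite Fi0 add0r.
by apply/eqP; rewrite eq_le ang_ge0 andbT -U0; apply: le_ang => // x [].
Qed.

(** For a cone, normalizing a nonzero vector does not affect membership, so the sphere and the ball
    versions differ only at the origin. The origin is null unless [C] is trivial, and then both
    sides are 1. *)
Lemma solid_angleE C : rVmeas C -> C 0 ->
  (forall (l : R) x, 0 <= l -> C x -> C (l *: x)) -> solid_angle C = ang (lin C) C.
Proof.
move=> mC C0 CZ; rewrite /solid_angle; case: ifPn => [/asboolP ->|/asboolPn nC].
  rewrite ang_eq1// => x; suff -> : lin [set (0 : E)] = 0%VS by rewrite memv0 => /eqP ->.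
  by apply: lin_eq; [move=> _ ->; rewrite /= mem0v|exact: sub0v].
rewrite /unif_sphere; set L := lin C.
have m0 : rVmeas [set (0 : E)].
  apply: rVmeas_closed; apply: accessible_closed_set1; apply: hausdorff_accessible.
  exact: norm_hausdorff.
transitivity (ang L (C `\` [set 0])).
  rewrite /ang; congr (vol_in _ _ / _); apply/seteqP; split => x /=.
    move=> [/andP[x0 x1]] /(CZ (enorm x) _ (enorm_ge0 x)).
    rewrite scalerA divff ?gt_eqF// scale1r => Cx; split=> //; split => //.
    by apply/eqP; rewrite -enorm_gt0.
  move=> [x1 [Cx /eqP x0]]; rewrite x1 enorm_gt0 x0; split => //.
  by apply: CZ => //; rewrite invr_ge0 enorm_ge0.
have -> : ang L C = ang L ((C `\` [set 0]) `|` [set 0]).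
  congr ang; apply/seteqP; split => x; last by move=> [[]//|->].
  by move=> Cx; have [->|/eqP x0] := eqVneq x 0; [right|left].
rewrite angU//; [|exact: rVmeasD|by move=> x []].
rewrite (@ang_null L 0%VS [set 0]) ?addr0//; last by move=> x _ ->; rewrite mem0v.
apply/negP => L0; apply: nC; apply/seteqP; split=> [x Cx|_ -> //].
by have /(subvP L0) := sub_lin Cx; rewrite memv0 => /eqP.
Qed.

End angle.

(** * Polytopes and their faces *)

Section affine_span.
Context {R : realType} {d : nat}.
Local Notation E := 'rV[R]_d.
Implicit Types (L W : {vspace E}) (S A B C P F : set E).

(** Take a list of elements of [S] whose span has the greatest dimension. *)
Lemma lin_spanned S : exists2 s : seq E, (forall x, x \in s -> S x) & lin S = span s.
Proof.
pose P n := `[< exists2 s : seq E, (forall x, x \in s -> S x) & \dim (span s) = n >].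
have exP : exists n, P n by exists 0%N; apply/asboolP; exists [::] => //; rewrite span_nil dimv0.
have ubP n : P n -> (n <= \dim {:E})%N.
  by move=> /asboolP[s _ <-]; apply: dimvS; exact: subvf.
have [n /asboolP[s sS sn] maxn] := ex_maxnP exP ubP.
exists s => //; apply: lin_eq => [x Sx|]; last first.
  by apply/span_subvP => x /sS; exact: sub_lin.
have : (\dim (span (x :: s)) <= n)%N.
  apply: maxn; apply/asboolP; exists (x :: s) => // y; rewrite inE => /orP[/eqP ->//|].
  exact: sS.
rewrite -sn => dxs; have /eqP -> : span s == span (x :: s).
  by rewrite eqEdim dxs andbT span_cons addvSr.
by rewrite /= memv_span// inE eqxx.
Qed.

Lemma sub_aff S : S `<=` aff S.
Proof.
move=> x Sx; exists 1%N, (fun=> 1), (fun=> x).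
by split => //; rewrite big_ord1// scale1r.
Qed.

Lemma affB S v x : S v -> aff S x -> x - v \in lin [set y - v | y in S].
Proof.
move=> Sv [n [c [w [wS c1 ->]]]].
have -> : \sum_(i < n) c i *: w i - v = \sum_(i < n) c i *: (w i - v).
  under [RHS]eq_bigr do rewrite scalerBr.
  by rewrite sumrB -scaler_suml c1 scale1r.
rewrite memv_suml// => i _; rewrite memvZ//; apply: sub_lin.
by exists (w i).
Qed.

Lemma dirspaceE S v : S v -> dirspace S = lin [set x - v | x in S].
Proof.
move=> Sv; apply: lin_eq => [_ [x ax [y ay <-]] /=|].
  have -> : x - y = (x - v) - (y - v) by rewrite opprB addrA subrK.
  by rewrite rpredB// affB.
apply: lin_sub => _ [x Sx <-]; apply: sub_lin; exists x; first exact: sub_aff.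
by exists v => //; exact: sub_aff.
Qed.

Lemma affP S v x : S v -> aff S x <-> x - v \in dirspace S.
Proof.
move=> Sv; rewrite (dirspaceE Sv); split; first exact: affB.
have [s sS ->] := lin_spanned [set x - v | x in S].
move=> /(@coord_span _ _ _ (in_tuple s)); set a := fun i => coord (in_tuple s) i (x - v).
pose y (i : 'I_(size s)) := v + s`_i.
have yS i : S (y i).
  by have [z Sz zE] := sS s`_i (mem_nth _ (ltn_ord i)); rewrite /y -zE addrC subrK.
move=> xE.
(* The base point [v], at index [ord0], receives the weight that makes the total 1. *)
exists (size s).+1, (fun i => if unlift ord0 i is Some j then a j else 1 - \sum_j a j),
  (fun i => if unlift ord0 i is Some j then y j else v); split.
- by move=> i; case: unliftP.
- rewrite big_ord_recl unlift_none [X in _ + X](_ : _ = \sum_j a j) ?subrK//.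
  by apply: eq_bigr => i _; rewrite liftK.
- rewrite big_ord_recl unlift_none.
  rewrite [X in _ + X](_ : _ = (\sum_j a j) *: v + (x - v)).
    by rewrite addrA -scalerDl subrK scale1r addrC subrK.
  rewrite [in RHS]xE scaler_suml -big_split; apply: eq_bigr => i _ /=.
  by rewrite liftK scalerDr.
Qed.

Lemma rVconvex_sum P m (c : 'I_m -> R) (w : 'I_m -> E) : rVconvex P ->
  (forall i, 0 <= c i) -> \sum_i c i = 1 -> (forall i, 0 < c i -> P (w i)) ->
  P (\sum_i c i *: w i).
Proof.
move=> cP; elim: m c w => [|m IH] c w c0 c1 wP.
  by move: c1; rewrite big_ord0 => /esym/eqP; rewrite oner_eq0.
rewrite big_ord_recl; move: c1; rewrite big_ord_recl => c1.
set s := \sum_(i < m) _ in c1.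
have s0 : 0 <= s by rewrite sumr_ge0.
have [s_eq0|s_neq0] := eqVneq s 0.
  move: c1; rewrite s_eq0 addr0 => c1; rewrite c1 scale1r.
  rewrite big1 ?addr0; first by apply: wP; rewrite c1.
  move=> i _; move/psumr_eq0P: s_eq0 => -> //; rewrite scale0r//.
have sgt0 : 0 < s by rewrite lt_neqAle eq_sym s_neq0.
have Ps : P (\sum_(i < m) (c (lift ord0 i) / s) *: w (lift ord0 i)).
  apply: IH => [i||i]; rewrite ?divr_ge0//; first by rewrite -mulr_suml -/s divff.
  by rewrite pmulr_lgt0 ?invr_gt0//; exact: wP.
have -> : \sum_(i < m) c (lift ord0 i) *: w (lift ord0 i) =
    s *: \sum_(i < m) (c (lift ord0 i) / s) *: w (lift ord0 i).
  by rewrite scaler_sumr; apply: eq_bigr => i _; rewrite scalerA mulrCA divff// mulr1.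
have [c_eq0|c_neq0] := eqVneq (c ord0) 0.
  have s1 : s = 1 by rewrite -c1 c_eq0 add0r.
  by rewrite c_eq0 scale0r add0r [X in X *: _]s1 scale1r.
by apply: cP => //; apply: wP; rewrite lt_neqAle eq_sym c_neq0 c0.
Qed.

(** The formula of [lattice_polytope] with real generators, so that a lattice polytope is a [hull]
    by conversion. *)
Definition hull m (w : 'I_m -> E) : set E := [set x | exists c : 'I_m -> R,
  [/\ forall i, 0 <= c i, \sum_(i < m) c i = 1 & x = \sum_(i < m) c i *: w i]].

Lemma hull_convex m (w : 'I_m -> E) : rVconvex (hull w).
Proof.
move=> a b x y [c [c0 c1 ->]] [e [e0 e1 ->]] a0 b0 ab.
exists (fun i => a * c i + b * e i); split.
- by move=> i; rewrite addr_ge0// mulr_ge0.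
- by rewrite big_split/= -!mulr_sumr c1 e1 !mulr1.
- rewrite !scaler_sumr -big_split/=; apply: eq_bigr => i _.
  by rewrite !scalerA scalerDl.
Qed.

Lemma mem_hull m (w : 'I_m -> E) i : hull w (w i).
Proof.
exists (fun j => (j == i)%:R); split=> [j||]; first exact: ler0n.
  by rewrite (bigD1 i)//= eqxx big1 ?addr0// => j /negbTE ->.
rewrite (bigD1 i)//= eqxx scale1r big1 ?addr0// => j /negbTE ->.
by rewrite scale0r.
Qed.

Lemma sub_hull m (w : 'I_m -> E) P : rVconvex P -> (forall i, P (w i)) -> hull w `<=` P.
Proof. by move=> cP wP x [c [c0 c1 ->]]; exact: rVconvex_sum. Qed.

Lemma mulmx_continuous m n (V : 'M[R]_(m, n)) : continuous (fun c : 'rV[R]_m => c *m V).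
Proof.
move=> c; have [C C0 HC] := norm_mulmx_le V.
apply/(@cvgrPdist_le _ _ _ _ (nbhs_filter c)) => e e0; near=> t.
rewrite -mulmxBl (le_trans (HC _))// -ler_pdivlMl//.
by near: t; apply: cvgr_dist_le; [exact: cvg_id|rewrite mulr_gt0// invr_gt0].
Unshelve. all: by end_near. Qed.

(** The image of the standard simplex [D] under a linear map. *)
Lemma hull_compact m (w : 'I_m -> E) : compact (hull w).
Proof.
pose V : 'M[R]_(m, d) := \matrix_i w i.
pose D : set 'rV[R]_m := [set c | (forall i, 0 <= c 0 i) /\ \sum_i c 0 i = 1].
have -> : hull w = (fun c : 'rV[R]_m => c *m V) @` D.
  apply/seteqP; split => [x [c [c0 c1 ->]]|_ [c [c0 c1] <-]].
    exists (\row_i c i).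
      by split => [i|]; rewrite ?mxE// -c1; apply: eq_bigr => i _; rewrite mxE.
    by rewrite mulmx_sum_row; apply: eq_bigr => i _; rewrite rowK mxE.
  exists (c 0); split => //.
  by rewrite mulmx_sum_row; apply: eq_bigr => i _; rewrite rowK.
apply: continuous_compact.
  by apply: continuous_subspaceT; exact: mulmx_continuous.
apply: bounded_closed_compact.
  exists 1; split; first exact: num_real.
  move=> M M1 c [c0 c1]; apply: norm_le_coord => [|i]; first exact: le_trans (ltW M1).
  rewrite (le_trans _ (ltW M1))// ger0_norm// -c1 (bigD1 i)//= lerDl.
  by rewrite sumr_ge0.
rewrite (_ : D = (\bigcap_(i in [set: 'I_m]) ((fun c : 'rV[R]_m => c 0 i) @^-1` [set r | 0 <= r])) `&`
    (fun c : 'rV[R]_m => \sum_i c 0 i) @^-1` [set r | r = 1]); last first.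
  by apply/seteqP; split => c [h1 h2]; split => // i; have := h1 i => // /(_ I).
apply: closedI.
  apply: closed_bigI => i _; apply: preimage_closed; last exact: closed_ge.
  by move=> c _; exact: coord_continuous.
apply: preimage_closed; last exact: closed_eq.
by move=> c _; apply: continuous_sumr => i; exact: coord_continuous.
Qed.

Lemma hull_closed m (w : 'I_m -> E) : closed (hull w).
Proof. by apply: compact_closed; [exact: norm_hausdorff|exact: hull_compact]. Qed.

Lemma hull_bounded m (w : 'I_m -> E) : rVbounded (hull w).
Proof.
have [M [_ HM]] := compact_bounded (@hull_compact m w).
by exists (M + 1) => x; apply: HM; rewrite ltrDl.
Qed.

(* Keeping the index type: points outside the face are replaced by one of its points. *)
Lemma face_hull m (w : 'I_m -> E) F : is_face F (hull w) ->
  exists2 f : 'I_m -> 'I_m, F = hull (w \o f) & forall i, F (w (f i)).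
Proof.
move=> [[p Fp] [a [b [ab FE]]]].
(* If the functional attains its bound at a convex combination, the nonnegative weighted gaps sum to
   zero; hence every generator of positive weight attains it too. *)
have wE x (c : 'I_m -> R) : (forall i, 0 <= c i) -> \sum_i c i = 1 ->
    x = \sum_i c i *: w i -> F x -> forall i, 0 < c i -> F (w i).
  move=> c0 c1 xE; rewrite FE => -[_ axb] i ci; split; first exact: mem_hull.
  have : \sum_i c i * (b - dotr a (w i)) = 0.
    under eq_bigr do rewrite mulrBr; rewrite sumrB -mulr_suml c1 mul1r -axb xE dotr_sumr.
    by apply/eqP; rewrite subr_eq0; apply/eqP/eq_bigr => j _; rewrite dotrZr.
  move/psumr_eq0P => /(_ _ i isT)/eqP; rewrite mulf_eq0 gt_eqF//= subr_eq0 => H.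
  apply/esym/eqP/H => j _; rewrite mulr_ge0// subr_ge0; apply: ab; exact: mem_hull.
have [c [c0 c1 pE]] : hull w p by move: Fp; rewrite FE => -[].
have [i0 ci0] : exists i, 0 < c i.
  apply/not_existsP => H; have : \sum_i c i = 0.
    apply: big1 => i _; apply/eqP; rewrite eq_le c0 andbT leNgt.
    by apply/negP; exact: H.
  by rewrite c1 => /eqP; rewrite oner_eq0.
have Fi0 : F (w i0) by exact: (wE p c).
pose f i := if `[< F (w i) >] then i else i0.
have Ff i : F (w (f i)) by rewrite /f; case: asboolP.
have cF : rVconvex F.
  rewrite FE => s t x y [hx ax] [hy ay] s0 t0 st; split; first exact: hull_convex.
  by rewrite dotrDr !dotrZr ax ay -mulrDl st mul1r.
exists f => //; apply/seteqP; split => [x Fx|]; last exact: sub_hull.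
have [e [e0 e1 xE]] : hull w x by move: Fx; rewrite FE => -[].
exists e; split => //; rewrite xE; apply: eq_bigr => i _ /=.
have [->|ei] := eqVneq (e i) 0; first by rewrite !scale0r.
rewrite /f; case: asboolP => // nF; exfalso; apply: nF; apply: (wE x e) => //.
by rewrite lt_neqAle eq_sym ei e0.
Qed.

Lemma finite_faces_hull m (w : 'I_m -> E) : finite_set [set F | is_face F (hull w)].
Proof.
apply: (@sub_finite_set _ _ ((fun f : {ffun 'I_m -> 'I_m} => hull (w \o f)) @` setT)).
  by move=> F /face_hull[f FE _]; exists (finfun f) => //; rewrite FE; congr hull;
    apply/funext => i /=; rewrite ffunE.
by apply: finite_image; exact: finite_finset.
Qed.

End affine_span.

(** * Tangent cones, polars and the angles of faces *)

Section polytope_cones.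
Context {R : realType} {d : nat}.
Local Notation E := 'rV[R]_d.
Implicit Types (L W : {vspace E}) (S A B C P F : set E).

Lemma mem_segment P v x (e t : R) : rVconvex P -> P v -> P (v + e *: x) ->
  0 <= t <= e -> P (v + t *: x).
Proof.
move=> cP Pv Pe /andP[t0 te]; have [e0|e0] := eqVneq e 0.
  have -> : t = e by apply/le_anti; rewrite te e0.
  by [].
have e_gt0 : 0 < e by rewrite lt_neqAle eq_sym e0 (le_trans t0).
have -> : v + t *: x = (1 - t / e) *: v + (t / e) *: (v + e *: x).
  by apply/rowP => i; rewrite !mxE; field.
apply: cP => //; last by rewrite subrK.
  by rewrite subr_ge0 ler_pdivrMr// mul1r.
by rewrite divr_ge0// ltW.
Qed.

Lemma tangent_coneP P v x : P v -> tangent_cone v P x <->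
  exists2 e : R, 0 < e & P (v + e *: x).
Proof.
move=> Pv; split=> [[l /= l0 [p Pp <-]]|[e e0 Pe]].
  have [->|l_neq0] := eqVneq l 0.
    by exists 1 => //; rewrite scale0r scaler0 addr0.
  exists l^-1; first by rewrite invr_gt0 lt_neqAle eq_sym l_neq0.
  by rewrite scalerA mulVf// scale1r addrC subrK.
exists e^-1; first by rewrite /= invr_ge0 ltW.
exists (v + e *: x) => //; rewrite [v + _]addrC addrK scalerA mulVf ?scale1r// gt_eqF//.
Qed.

Lemma tangent_cone0 P v : P v -> tangent_cone v P 0.
Proof. by move=> Pv; apply/tangent_coneP => //; exists 1; rewrite // scaler0 addr0. Qed.

Lemma tangent_coneB P v x : P x -> tangent_cone v P (x - v).
Proof. by move=> Px; exists 1; rewrite /= ?ler01//; exists x; rewrite ?scale1r. Qed.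

Lemma tangent_coneZ P v (l : R) x : 0 <= l -> tangent_cone v P x -> tangent_cone v P (l *: x).
Proof.
move=> l0 [a /= a0 [p Pp <-]]; exists (l * a); first by rewrite /= mulr_ge0.
by exists p => //; rewrite scalerA.
Qed.

(** By convexity the step lengths [1 / (n + 1)] suffice, which makes the cone a countable union of
    closed sets. *)
Lemma rVmeas_tangent_cone P v : closed P -> rVconvex P -> P v -> rVmeas (tangent_cone v P).
Proof.
move=> clP cP Pv.
rewrite (_ : tangent_cone v P = \bigcup_n [set x | P ((n.+1%:R^-1 : R) *: x + v)]).
  by apply: rVmeas_bigcup => n; apply: rVmeas_scale; exact: rVmeas_closed.
apply/seteqP; split => x.
  move=> /(tangent_coneP _ Pv)[e e0 Pe]; exists (Num.truncn e^-1) => //=.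
  rewrite addrC; apply: mem_segment Pe _ => //.
  rewrite invr_ge0 ler0n/= -[leRHS]invrK lef_pV2 ?posrE ?invr_gt0//.
  by rewrite ltW// truncnS_gt.
by move=> [n _ /= Pn]; apply/tangent_coneP => //; exists n.+1%:R^-1; rewrite ?invr_gt0// addrC.
Qed.

Lemma closed_polar C : closed (polar C).
Proof.
rewrite (_ : polar C = \bigcap_(x in C) [set w | dotr x w <= 0]).
  by apply: closed_bigI => x _; exact: closed_halfspace.
by apply/seteqP; split => w /= H x /H; rewrite dotrC.
Qed.

Lemma rVmeas_polar C : rVmeas (polar C).
Proof. exact: (rVmeas_closed (@closed_polar C)). Qed.

Lemma polar0 C : polar C 0.
Proof. by move=> x _; rewrite dotr0l. Qed.

Lemma polarZ C (l : R) x : 0 <= l -> polar C x -> polar C (l *: x).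
Proof. by move=> l0 Cx y Cy; rewrite dotrZl mulr_ge0_le0// Cx. Qed.

Lemma polar_tangent_coneP P v w : polar (tangent_cone v P) w <->
  forall x, P x -> dotr w x <= dotr w v.
Proof.
split=> [H x Px|H _ [l /= l0 [x Px <-]]].
  by rewrite -subr_le0 -dotrBr; apply: H; exact: tangent_coneB.
by rewrite dotrZr dotrBr mulr_ge0_le0// subr_le0 H.
Qed.

Lemma solid_angle_tangent_cone P v : closed P -> rVconvex P -> P v ->
  solid_angle (tangent_cone v P) = ang (dirspace P) (tangent_cone v P).
Proof.
move=> clP cP Pv; rewrite solid_angleE; first last.
- by move=> l x; exact: tangent_coneZ.
- exact: tangent_cone0.
- exact: rVmeas_tangent_cone.
congr ang; rewrite (dirspaceE Pv); apply: lin_eq.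
  by move=> _ [l /= l0 [x Px <-]]; rewrite memvZ//; apply: sub_lin; exists x.
by apply: lin_sub => _ [x Px <-]; apply: sub_lin; exact: tangent_coneB.
Qed.

Lemma dirspaceB P x y : P x -> P y -> x - y \in dirspace P.
Proof. by move=> Px Py; rewrite (dirspaceE Py); apply: sub_lin; exists x. Qed.

Lemma sub_mxvs m (V : 'M[R]_(m, d)) S : (forall x, S x -> (x <= V)%MS) ->
  forall u, u \in lin S -> (u <= V)%MS.
Proof.
move=> SV u uS; pose W := lker (linfun (mulmxr (cokermx V))) : {vspace E}.
have WE x : (x \in W) = (x <= V)%MS by rewrite memv_ker lfunE /= submxE.
rewrite -WE; apply/(subvP _ u uS); apply: lin_sub => x Sx.
by rewrite /= WE SV.
Qed.

(* The barycenter of the points is in the relative interior. *)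
Lemma relint_hull m (w : 'I_m -> E) : hull w !=set0 -> relint (hull w) !=set0.
Proof.
move=> [x0 [c0 [_ c01 _]]]; have m0 : (0 < m)%N.
  by case: m w c0 c01 => // w c0; rewrite big_ord0 => /esym/eqP; rewrite oner_eq0.
have mR0 : 0 < m%:R :> R by rewrite ltr0n.
pose p := \sum_i m%:R^-1 *: w i.
have Pp : hull w p.
  exists (fun=> m%:R^-1); split => //.
  by rewrite sumr_const card_ord -[LHS]mulr_natl divff ?gt_eqF.
pose V : 'M[R]_(m, d) := \matrix_i (w i - p).
have VE (a : 'rV_m) : a *m V = \sum_i a 0 i *: w i - (\sum_i a 0 i) *: p.
  rewrite mulmx_sum_row scaler_suml -sumrB; apply: eq_bigr => i _.
  by rewrite rowK scalerBr.
have LV u : u \in dirspace (hull w) -> (u <= V)%MS.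
  rewrite (dirspaceE Pp); apply: sub_mxvs => _ [_ [c [_ c1 ->]] <-].
  rewrite (_ : _ - p = (\row_i c i) *m V) ?submxMl// VE.
  rewrite [X in X *: p](_ : _ = 1) ?scale1r; last first.
    by rewrite -c1; apply: eq_bigr => i _; rewrite mxE.
  by congr (_ - p); apply: eq_bigr => i _; rewrite mxE.
have [C C0 HC] := norm_mulmx_le (pinvmx V).
(* Within this radius each coefficient [a 0 i] is at least [- 1 / (2 m)] and their sum at most
   [1 / 2], so the weights [a 0 i + (1 - sum) / m] remain nonnegative. *)
exists p; split => //; exists (2 * m%:R * C)^-1; first by rewrite invr_gt0 !mulr_gt0.
move=> x /(affP _ Pp) /LV xp xe; pose a := (x - p) *m pinvmx V.
have aV : a *m V = x - p by rewrite mulmxKpV.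
have ai i : `|a 0 i| <= (2 * m%:R)^-1.
  rewrite (le_trans (coord_le_norm _ _))// (le_trans (HC _))// -ler_pdivlMl//.
  rewrite (le_trans (norm_le_enorm _))// (le_trans (ltW xe))//.
  by rewrite invfM mulrC.
have sa : `|\sum_i a 0 i| <= 2^-1.
  rewrite (le_trans (ler_norm_sum _ _ _))// (le_trans (ler_sum _ (fun i _ => ai i)))//.
  by rewrite sumr_const card_ord -[leLHS]mulr_natl invfM mulrCA divff ?mulr1// gt_eqF.
exists (fun i => a 0 i + (1 - \sum_j a 0 j) * m%:R^-1); split.
- move=> i; have := ai i; rewrite ler_norml => /andP[h1 _].
  move: sa; rewrite ler_norml => /andP[_ h2].
  have : 2^-1 * m%:R^-1 <= (1 - \sum_j a 0 j) * m%:R^-1.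
    by rewrite ler_wpM2r ?invr_ge0// lerBrDr -lerBrDl; apply: le_trans h2 _; lra.
  by move: h1; rewrite invfM; lra.
- rewrite big_split/= -mulr_sumr sumr_const card_ord -[_ *+ m]mulr_natl divff ?gt_eqF//.
  by rewrite mulr1 addrC subrK.
- under eq_bigr do rewrite scalerDl -scalerA.
  rewrite big_split/= -scaler_sumr -/p scalerBl scale1r addrCA -VE aV.
  by rewrite addrC subrK.
Qed.

Section face.
Variables (m : nat) (w : 'I_m -> E) (F : set E) (v : E).
Let P := hull w.
Hypotheses (fF : is_face F P) (Fv : F v).

Lemma face_sub : F `<=` P.
Proof. by move: fF => [_ [c [b [_ ->]]]] x []. Qed.

Let Pv : P v. Proof. exact: face_sub. Qed.

(** The supporting functional is constant on the affine hull of [F]. Consequently a face through [v]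
    is determined by its direction space. *)
Lemma faceE x : F x <-> P x /\ x - v \in dirspace F.
Proof.
split=> [Fx|[Px xv]]; first by split; [exact: face_sub|exact: dirspaceB].
have : aff F x by apply/(affP _ Fv).
have [_ [c [b [cb FE]]]] := fF.
move=> [n [a [y [yF a1 xE]]]]; rewrite FE; split => //.
rewrite xE dotr_sumr -[RHS]mul1r -a1 mulr_suml; apply: eq_bigr => i _.
by have := yF i; rewrite FE dotrZr => -[_ ->].
Qed.

Lemma tangent_cone_face_eq x : x \in dirspace F ->
  tangent_cone v F x <-> tangent_cone v P x.
Proof.
move=> xF; split=> [/(tangent_coneP _ Fv)|/(tangent_coneP _ Pv)] [e e0 Fe].
  by apply/tangent_coneP => //; exists e => //; exact: face_sub.
apply/tangent_coneP => //; exists e => //; apply/faceE; split => //.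
by rewrite addrC addKr memvZ.
Qed.

Lemma face_polytope : exists w' : 'I_m -> E, F = hull w'.
Proof. by have [f -> _] := face_hull fF; exists (w \o f). Qed.

Lemma solid_angle_tangent_face :
  solid_angle (tangent_cone v F) = ang (dirspace F) (tangent_cone v P).
Proof.
have [w' FE] := face_polytope.
rewrite solid_angle_tangent_cone//; last 2 first.
- by rewrite FE; exact: hull_closed.
- by rewrite FE; exact: hull_convex.
by apply: eq_ang => x; exact: tangent_cone_face_eq.
Qed.

(** [normal_cone] is based at a chosen relative interior point [p]. From [p] one can move both ways
    inside [F], so normals are orthogonal to [F], and then any point of [F], in particular [v],
    serves as base point. *)
Lemma normal_coneE y : normal_cone F P y <->
  y \in orthv (dirspace F) /\ polar (tangent_cone v P) y.
Proof.
have [w' FE] := face_polytope.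
have [Fp [e e0 He]] : relint F (xget 0 (relint F)).
  have : relint F !=set0 by rewrite FE; apply: relint_hull; rewrite -FE; exists v.
  by move=> [p Fp]; exact: (@xgetPex _ 0 _ (ex_intro _ p Fp)).
rewrite /normal_cone /tangent_cone_face; set p := xget 0 _ in Fp He *.
rewrite !polar_tangent_coneP.
split=> [yP|[yL yP] x Px]; last first.
  rewrite (le_trans (yP x Px))// -subr_le0 -dotrBr.
  by move/orthvP : yL => ->//; exact: dirspaceB.
suff yL : y \in orthv (dirspace F).
  split=> // x Px; rewrite (le_trans (yP x Px))// -subr_le0 -dotrBr.
  by move/orthvP : yL => ->//; exact: dirspaceB.
apply/orthvP => u uF; have [->|u0] := eqVneq u 0; first exact: dotr0r.
have nu : 0 < enorm u by rewrite enorm_gt0.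
(* A step of length [e / 2], inside the ball of radius [e]. *)
pose t := e / (2 * enorm u); have t0 : 0 < t by rewrite divr_gt0// mulr_gt0.
have Ft (s : R) : `|s| = t -> P (p + s *: u).
  move=> st; apply: face_sub; apply: He.
    by apply/(affP _ Fp); rewrite addrC addKr memvZ.
  have tu : t * enorm u = e / 2 by rewrite /t; field; rewrite gt_eqF.
  by rewrite addrC addKr enormZ st tu; lra.
have := yP _ (Ft t (gtr0_norm t0)); rewrite dotrDr gerDl dotrZr => h1.
have := yP _ (Ft (- t) (etrans (normrN t) (gtr0_norm t0))).
rewrite dotrDr gerDl dotrZr mulNr oppr_le0 => h2.
have : t * dotr y u = 0 by apply/le_anti; rewrite h1 h2.
by move=> /eqP; rewrite mulf_eq0 gt_eqF//= => /eqP.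
Qed.

(** The supporting functional [c] is normal, and for [y] orthogonal to [F] so is [l *: c + y] once
    [l] is large; hence [y] is in the span of the normals. *)
Lemma lin_normal_cone : lin (normal_cone F P) = orthv (dirspace F).
Proof.
apply: lin_eq => [y /normal_coneE[]//|]; apply/subvP => y yL.
have [_ [c [b [cb FE]]]] := fF.
have cL : c \in orthv (dirspace F).
  apply/orthvP => u; rewrite (dirspaceE Fv).
  move=> uF; pose W := orthv <[c]>%VS : {vspace E}.
  have : u \in W.
    apply: (subvP _ u uF); apply: lin_sub => _ [x Fx <-] /=.
    apply/orthvP => _ /vlineP[k ->]; rewrite dotrZr dotrC dotrBr.
    move: Fx Fv; rewrite FE => -[_ ->] [_ ->].
    by rewrite subrr mulr0.
  by move=> /orthvP uW; rewrite dotrC uW// memv_line.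
have cvb : dotr c v = b by move: Fv; rewrite FE => -[].
have [l Hl] : exists l : R, forall i, F (w i) \/
    dotr (l *: c + y) (w i) <= dotr (l *: c + y) v.
  (* The value of [l] needed at each generator off [F]. On [F] the denominator is 0 and so is the
     quotient; the sum dominates every term. *)
  pose g i := `|dotr y (w i - v)| / (b - dotr c (w i)).
  have cw i : 0 <= b - dotr c (w i) by rewrite subr_ge0; apply: cb; exact: mem_hull.
  exists (\sum_i g i) => i.
  have [|nF] := pselect (F (w i)); [by left|right].
  have cwi : 0 < b - dotr c (w i).
    rewrite lt_neqAle cw andbT eq_sym subr_eq0; apply/eqP => be; apply: nF.
    by rewrite FE; split => //; exact: mem_hull.
  rewrite -subr_le0 -dotrBr dotrDl dotrZl [dotr c _]dotrBr cvb -opprB mulrN addrC subr_le0.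
  rewrite (le_trans (ler_norm _))//.
  have -> : `|dotr y (w i - v)| = g i * (b - dotr c (w i)) by rewrite divfK// gt_eqF.
  rewrite ler_wpM2r// (bigD1 i)//= lerDl sumr_ge0// => j _.
  by rewrite mulr_ge0 ?invr_ge0.
have Nc : normal_cone F P c.
  by apply/normal_coneE; split => //; apply/polar_tangent_coneP => x /cb; rewrite cvb.
have Nly : normal_cone F P (l *: c + y).
  apply/normal_coneE; split; first by rewrite rpredD// memvZ.
  apply/polar_tangent_coneP; pose z := l *: c + y.
  have cS : rVconvex [set x | dotr z x <= dotr z v].
    move=> s t x x' /= h1 h2 s0 t0 st; rewrite dotrDr !dotrZr.
    by rewrite -[leRHS]mul1r -st mulrDl lerD// ler_wpM2l.
  apply: (sub_hull cS) => i /=; have [Fi|//] := Hl i.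
  have zL : z \in orthv (dirspace F) by rewrite rpredD// memvZ.
  rewrite -subr_le0 -dotrBr; move/orthvP : zL => ->//; exact: dirspaceB.
by rewrite -[y](addKr (l *: c)) rpredD ?rpredN ?memvZ//; apply: sub_lin.
Qed.

Lemma solid_angle_normal_cone :
  solid_angle (normal_cone F P) = ang (orthv (dirspace F)) (polar (tangent_cone v P)).
Proof.
rewrite solid_angleE; first last.
- by move=> l x; exact: polarZ.
- exact: polar0.
- exact: rVmeas_polar.
rewrite lin_normal_cone; apply: eq_ang => x xF; split; first by move=> /normal_coneE[].
by move=> h; apply/normal_coneE.
Qed.

End face.

(* Two nonnull angles force the minimal face through [v] to have direction [L];
   it is cut out by a sum of normal vectors spanning the complement of [L]. *)
Lemma face_of_ang m (w : 'I_m -> E) v L : hull w v ->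
  ang L (tangent_cone v (hull w)) * ang (orthv L) (polar (tangent_cone v (hull w))) != 0 ->
  exists F, [/\ is_face F (hull w), F v & dirspace F = L].
Proof.
set P := hull w => Pv; rewrite mulf_eq0 negb_or => /andP[aL aN].
pose N : set E := [set y | y \in orthv L /\ polar (tangent_cone v P) y].
(* A nonzero angle forces the trace to span the subspace. *)
have linN : (orthv L <= lin N)%VS.
  apply/negPn/negP => /(@ang_null _ _ _ _ _ (@rVmeas_polar (tangent_cone v P))) H.
  by move/eqP : aN; apply; apply: H => x xL Nx; apply: sub_lin.
pose T : set E := [set x | x \in L /\ tangent_cone v P x].
have mT : rVmeas (tangent_cone v P).
  by apply: rVmeas_tangent_cone => //; [exact: hull_closed|exact: hull_convex].
have linT : (L <= lin T)%VS.
  apply/negPn/negP => /(@ang_null _ _ _ _ _ mT) H.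
  by move/eqP : aL; apply; apply: H => x xL Nx; apply: sub_lin.
have [s sN lE] := lin_spanned N.
pose y := \sum_(z <- s) z.
have yP x : P x -> dotr y x <= dotr y v.
  move=> Px; rewrite /y !(dotrC _ x) !(dotrC _ v) !dotr_sumr.
  rewrite big_seq [leRHS]big_seq ler_sum// => z /sN[_ /polar_tangent_coneP/(_ _ Px)].
  by rewrite !(dotrC z).
exists [set x | P x /\ dotr y x = dotr y v].
have fF : is_face [set x | P x /\ dotr y x = dotr y v] P.
  by split; [exists v|exists y, (dotr y v)].
split => //; apply/eqP; rewrite eqEsubv; apply/andP; split.
  (* Where [y] attains its maximum, each of its summands does, since the gaps are nonnegative. So
     [x - v] is orthogonal to the span of [s], which contains [orthv L]. *)
  rewrite (@dirspaceE _ _ _ v)//; apply: lin_sub => _ [x [Px yx] <-] /=.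
  apply: orthvK => u /(subvP linN); rewrite lE => uN.
  have zx z : z \in s -> dotr z (x - v) = 0.
    move: yx; rewrite /y (dotrC _ x) (dotrC _ v) !dotr_sumr => /eqP; rewrite eq_sym -subr_eq0 -sumrB => /eqP.
    rewrite big_seq => /eqP; rewrite psumr_eq0 => [/allP H zs|z' /sN[_ /polar_tangent_coneP/(_ _ Px)]].
      by have := H z zs; rewrite zs/= dotrBr !(dotrC z) subr_eq0 => /eqP ->; rewrite subrr.
    by rewrite subr_ge0 !(dotrC z').
  have : u \in orthv <[x - v]>%VS.
    apply: (subvP _ u uN); apply/span_subvP => z zs; apply/orthvP => _ /vlineP[k ->].
    by rewrite dotrZr zx// mulr0.
  by move=> /orthvP H; rewrite dotrC H// memv_line.
apply: (subv_trans linT); apply: lin_sub => x [xL /(tangent_coneP _ Pv)[e e0 Pe]].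
rewrite /= -[x](scalerK (lt0r_neq0 e0)) memvZ//.
rewrite -[_ *: x](addKr v) addrC; apply: dirspaceB => //; split=> //.
rewrite dotrDr dotrZr [dotr y x](_ : _ = 0) ?mulr0 ?addr0//.
rewrite /y dotrC dotr_sumr big_seq big1// => z /sN[/orthvP zL _].
by rewrite dotrC zL.
Qed.

End polytope_cones.

(** * Discrete intrinsic volumes *)

Section cone_sum.
Context {R : realType} {d : nat}.
Local Notation E := 'rV[R]_d.
Implicit Types (L W : {vspace E}) (S A B C P Q F : set E).

(* [latdet] depends on a face with a lattice point only through its direction. *)
Definition lattice_det L : R :=
  let B := map_mx intr (xget 0 [set B : 'M[int]_(\dim L, d) |
    row_free (map_mx intr B : 'M[R]_(\dim L, d)) /\
    forall z, (zpt z \in L) <-> exists c : 'rV[int]_(\dim L), z = c *m B]) in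
  Num.sqrt (\det (B *m B^T)).

Lemma zptB (z w : 'rV[int]_d) : zpt (z - w) = zpt z - zpt w :> E.
Proof. exact: map_mxB. Qed.

Lemma zptD (z w : 'rV[int]_d) : zpt (z + w) = zpt z + zpt w :> E.
Proof. exact: map_mxD. Qed.

Lemma aff_latticeE F v z : F (zpt v) -> aff_lattice F z <-> zpt z \in dirspace F.
Proof.
move=> Fv; split=> [[y ay [y' ay' <-]]|zF].
  rewrite zptB -(subrKA (zpt v)) rpredD//; first exact/(affP _ Fv).
  by rewrite -opprB rpredN; apply/(affP _ Fv).
exists (z + v); first by apply/(affP _ Fv); rewrite zptD addrK.
by exists v; [exact: sub_aff|rewrite addrK].
Qed.

Lemma latdetE F v : F (zpt v) -> latdet F = lattice_det (dirspace F).
Proof.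
move=> Fv; rewrite /latdet /lattice_det /lattice_basis /adim.
suff -> : [set B : 'M[int]_(\dim (dirspace F), d) |
      row_free (map_mx intr B : 'M[R]_(\dim (dirspace F), d)) /\
      forall z, aff_lattice F z <-> exists c : 'rV[int]_(\dim (dirspace F)), z = c *m B] =
    [set B | row_free (map_mx intr B : 'M[R]_(\dim (dirspace F), d)) /\
      forall z, zpt z \in dirspace F <-> exists c : 'rV[int]_(\dim (dirspace F)), z = c *m B].
  by [].
apply/seteqP; split => B [fB HB]; split => // z.
  exact: (iff_trans (iff_sym (aff_latticeE z Fv)) (HB z)).
exact: (iff_trans (aff_latticeE z Fv) (HB z)).
Qed.

Definition cone_term C L : R := lattice_det L * ang (orthv L) (polar C) * ang L C.

(** The index set is infinite in general; for tangent cones of polytopes the next lemma gives finite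
    support. *)
Definition cone_sum k C : R := \sum_(L \in [set L | \dim L = k]) cone_term C L.

Lemma cone_term_finite m (w : 'I_m -> E) v : hull w v ->
  finite_set [set L | cone_term (tangent_cone v (hull w)) L != 0].
Proof.
move=> Pv; apply: (@sub_finite_set _ _ (dirspace @` [set F | is_face F (hull w)])).
  move=> L; rewrite /cone_term /= -mulrA mulf_eq0 negb_or mulrC => /andP[_].
  by move=> /(face_of_ang Pv)[F [fF _ FL]]; exists F.
by apply: finite_image; exact: finite_faces_hull.
Qed.

(** [dirspace] is injective on the faces through [v]. Faces missing [v] contribute 0 through the
    indicator, and subspaces that are no direction of a face contribute 0 by [face_of_ang]. *)
Lemma face_sum_cone_sum m (w : 'I_m -> E) k (v : 'rV[int]_d) : hull w (zpt v) ->
  \sum_(F \in faces k (hull w))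
    (\1_F (zpt v) * latdet F * solid_angle (normal_cone F (hull w))
       * solid_angle (tangent_cone (zpt v) F)) =
  cone_sum k (tangent_cone (zpt v) (hull w)).
Proof.
move=> Pv; pose D := [set F | faces k (hull w) F /\ F (zpt v)].
rewrite -(@fsbig_widen _ _ _ _ D) => [|F []//|F [fF nD]]; last first.
  by rewrite /preimage/= indicE memNset ?mul0r// => Fv; exact: nD.
rewrite (eq_fsbigr (fun F => cone_term (tangent_cone (zpt v) (hull w)) (dirspace F))); last first.
  move=> F /set_mem[[fF _] Fv].
  rewrite indicE mem_set// mul1r (latdetE Fv) (solid_angle_normal_cone fF Fv).
  by rewrite (solid_angle_tangent_face fF Fv).
rewrite -(@fsbig_image _ _ _ _ _ D dirspace (cone_term (tangent_cone (zpt v) (hull w)))); last first.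
  move=> F F' /set_mem[[fF _] Fv] /set_mem[[fF' _] Fv'] FF'.
  apply/seteqP; split => x; first by move=> /(faceE fF Fv); rewrite FF' => /(faceE fF' Fv').
  by move=> /(faceE fF' Fv'); rewrite -FF' => /(faceE fF Fv).
apply: fsbig_widen => [_ [F [[fF Fk] Fv] <-]//|L [Lk nL]].
rewrite /preimage/=; apply: contra_notP nL => /eqP; rewrite /cone_term -mulrA mulf_eq0 negb_or mulrC.
move=> /andP[_ /(face_of_ang Pv)[F [fF Fv FL]]]; exists F => //; split => //; split => //.
by rewrite /adim FL.
Qed.

Lemma discrete_intrinsic_volumeE m (w : 'I_m -> E) k :
  discrete_intrinsic_volume k (hull w) =
  \sum_(v \in latpts (hull w)) cone_sum k (tangent_cone (zpt v) (hull w)).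
Proof. by apply: eq_fsbigr => v /set_mem; exact: face_sum_cone_sum. Qed.

Lemma finite_latpts A : rVbounded A -> finite_set (latpts A).
Proof.
move=> [b Ab]; apply: sub_finite_set (@finite_int_box R d b) => z /=.
exact: Ab.
Qed.

End cone_sum.

(** * The valuation identity at a common point *)

Section valuation.
Context {R : realType} {d : nat}.
Local Notation E := 'rV[R]_d.
Implicit Types (L W : {vspace E}) (S A B C P Q F : set E).

Lemma tangent_coneU P Q v : P v -> Q v ->
  tangent_cone v (P `|` Q) = tangent_cone v P `|` tangent_cone v Q.
Proof.
move=> Pv Qv; apply/seteqP; split => x.
  by move=> [l l0 [p [Pp|Qp] <-]]; [left|right]; exists l => //; exists p.
by move=> [|] [l l0 [p Pp <-]]; exists l => //; exists p => //; [left|right].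
Qed.

Lemma tangent_coneI P Q v : rVconvex P -> rVconvex Q -> P v -> Q v ->
  tangent_cone v (P `&` Q) = tangent_cone v P `&` tangent_cone v Q.
Proof.
move=> cP cQ Pv Qv; apply/seteqP; split => x.
  by move=> [l l0 [p [Pp Qp] <-]]; split; exists l => //; exists p.
move=> [/(tangent_coneP _ Pv)[e e0 Pe] /(tangent_coneP _ Qv)[f f0 Qf]].
apply/tangent_coneP => //; exists (Num.min e f); first by rewrite lt_min e0.
have m0 : 0 <= Num.min e f by rewrite le_min !ltW.
split; first by apply: mem_segment Pe _; rewrite ?m0 ?ge_min ?lexx.
by apply: mem_segment Qf _; rewrite ?m0 ?ge_min ?lexx ?orbT.
Qed.

Lemma closed_complement_segment Q x u : closed Q -> ~ Q x ->
  exists2 e : R, 0 < e & forall t, 0 <= t <= e -> ~ Q (x + t *: u).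
Proof.
move=> clQ Qx.
have [e /= e0 eQ] : nbhs_ball x (~` Q) by apply/nbhs_ballP; apply: (closed_openC clQ).
pose s := e / (2 * (`|u| + 1)).
have u1 : 0 < `|u| + 1 by rewrite ltr_wpDl.
have s0 : 0 < s by rewrite divr_gt0// mulr_gt0.
exists s => // t /andP[t0 ts]; apply: eQ; rewrite -ball_normE /= opprD addNKr normrN.
rewrite normrZ ger0_norm// (le_lt_trans (ler_wpM2r (normr_ge0 u) ts))//.
have : s * (`|u| + 1) = e / 2 by rewrite /s; field; rewrite gt_eqF.
have := normr_ge0 u; nra.
Qed.

(* Walking from a point of [P] outside [Q] towards a point of [Q], one first stays in [P]. *)
Lemma normal_transfer P Q x y : closed Q -> rVconvex (P `|` Q) ->
  P x -> ~ Q x -> (forall p, P p -> dotr y p <= dotr y x) ->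
  forall q, Q q -> dotr y q <= dotr y x.
Proof.
move=> clQ cPQ Px Qx yP q Qq.
have [e e0 He] := closed_complement_segment (q - x) clQ Qx.
pose t := Num.min e 1.
have t0 : 0 < t by rewrite lt_min e0 ltr01.
have te : t <= e by rewrite ge_min lexx.
have t1 : t <= 1 by rewrite ge_min lexx orbT.
have : (P `|` Q) (x + t *: (q - x)).
  have -> : x + t *: (q - x) = (1 - t) *: x + t *: q.
    by apply/rowP => i; rewrite !mxE; ring.
  apply: cPQ; [by left|by right|by rewrite subr_ge0|exact: ltW|by rewrite subrK].
case=> [/yP|]; last by move=> /He; rewrite (ltW t0) te => /(_ isT).
by rewrite dotrDr gerDl dotrZr pmulr_rle0// dotrBr subr_le0.
Qed.

(** A point [v + e *: x] lies in [P] but not in [Q], and has the same height as [v] with respect to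
    [y]; [normal_transfer] is applied there. *)
Lemma polar_diff P Q v x y : closed Q -> rVconvex (P `|` Q) -> rVconvex P -> P v -> Q v ->
  tangent_cone v P x -> ~ tangent_cone v Q x -> dotr y x = 0 ->
  polar (tangent_cone v P) y -> polar (tangent_cone v Q) y.
Proof.
move=> clQ cPQ cP Pv Qv /(tangent_coneP _ Pv)[e e0 Pe] TQ yx yP.
have vx : dotr y (v + e *: x) = dotr y v by rewrite dotrDr dotrZr yx mulr0 addr0.
apply/polar_tangent_coneP => q Qq; rewrite -vx.
apply: normal_transfer Pe _ _ _ Qq => // [Qe|p Pp].
  by apply: TQ; apply/tangent_coneP => //; exists e.
by rewrite vx; move/polar_tangent_coneP : yP; apply.
Qed.

(** The supremum [s] of the parameters in [P] is attained. If its point were not in [Q], the points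
    just beyond it would be in neither set. *)
Lemma segment_meets P Q p q : closed P -> closed Q -> rVconvex (P `|` Q) -> P p -> Q q ->
  exists2 t : R, 0 <= t <= 1 & (P `&` Q) ((1 - t) *: p + t *: q).
Proof.
move=> clP clQ cPQ Pp Qq; pose z (t : R) := (1 - t) *: p + t *: q.
have zE t : z t = p + t *: (q - p) by apply/rowP => i; rewrite !mxE; ring.
pose T := [set t : R | 0 <= t <= 1 /\ P (z t)].
have T0 : T 0 by split; rewrite ?lexx ?ler01// /z subr0 scale1r scale0r addr0.
have hsT : has_sup T by split; [exists 0|exists 1 => t [/andP[]]].
pose s := sup T.
have s0 : 0 <= s by apply: ub_le_sup => //; exact: hsT.2.
have s1 : s <= 1 by apply: ge_sup; [exists 0|move=> t [/andP[]]].
have Ps : P (z s).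
  apply: contrapT => nP; have [e e0 He] := closed_complement_segment (p - q) clP nP.
  have [t Tt st] := sup_adherent e0 hsT.
  have ts : t <= s by apply: ub_le_sup => //; exact: hsT.2.
  case: Tt => t01; apply: contraPP => _ Pt.
  have := He (s - t); rewrite subr_ge0 ts lerBlDl -lerBlDr ltW// => /(_ isT); apply.
  by move: Pt; rewrite !zE; congr P; apply/rowP => i; rewrite !mxE; ring.
exists s; first by rewrite s0 s1.
split=> //; apply: contrapT => nQ.
have [e e0 He] := closed_complement_segment (q - p) clQ nQ.
have s_lt1 : s < 1.
  rewrite lt_neqAle s1 andbT; apply/eqP => sE; apply: nQ.
  by rewrite -/(z s) sE /z subrr scale0r add0r scale1r.
pose t := Num.min e (1 - s).
have t0 : 0 < t by rewrite lt_min e0 subr_gt0.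
have te : t <= e by rewrite ge_min lexx.
have ts : t <= 1 - s by rewrite ge_min lexx orbT.
have st1 : s + t <= 1 by rewrite addrC -lerBrDr.
have zst : z s + t *: (q - p) = z (s + t) by rewrite !zE; apply/rowP => i; rewrite !mxE; ring.
have : (P `|` Q) (z (s + t)).
  apply: cPQ; [by left|by right|by rewrite subr_ge0|by rewrite addr_ge0// ltW|by rewrite subrK].
case=> [Pst|]; last by rewrite -zst; apply: He; rewrite (ltW t0).
have : s + t <= s.
  apply: ub_le_sup; first exact: hsT.2.
  by split => //; rewrite addr_ge0// ltW.
by rewrite gerDl leNgt t0.
Qed.

(** If [y] exceeded its value at [v] both at some [p] in [P] and at some [q] in [Q], it would do so
    along the whole segment, which meets the intersection. *)
Lemma polarI P Q v y : closed P -> closed Q -> rVconvex (P `|` Q) -> P v -> Q v ->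
  polar (tangent_cone v (P `&` Q)) y ->
  polar (tangent_cone v P) y \/ polar (tangent_cone v Q) y.
Proof.
move=> clP clQ cPQ Pv Qv yPQ.
have [yP|/existsNP[p /not_implyP[Pp /negP]]] := pselect (forall p, P p -> dotr y p <= dotr y v).
  by left; apply/polar_tangent_coneP.
rewrite -ltNge => py; right; apply/polar_tangent_coneP => q Qq.
rewrite leNgt; apply/negP => qy.
have [t /andP[t0 t1] PQt] := segment_meets clP clQ cPQ Pp Qq.
move/polar_tangent_coneP : yPQ => /(_ _ PQt); rewrite dotrDr !dotrZr.
have h1 : 0 <= (1 - t) * (dotr y p - dotr y v) by rewrite mulr_ge0// ?subr_ge0// ltW.
have [->|tn0] := eqVneq t 0; first by lra.
have h2 : 0 < t * (dotr y q - dotr y v) by rewrite mulr_gt0// ?subr_gt0// lt_neqAle eq_sym tn0.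
by lra.
Qed.

(** Angles in [L] are split over the two differences and the intersection. The defect of the
    identity is then a combination of the products [h1] and [h2], each vanishing: if [L] meets the
    difference of the cones, the two polars involved agree on [orthv L]. *)
Lemma cone_term_valuation P Q v L : closed P -> closed Q -> rVconvex P -> rVconvex Q ->
  rVconvex (P `|` Q) -> P v -> Q v ->
  cone_term (tangent_cone v (P `|` Q)) L + cone_term (tangent_cone v (P `&` Q)) L =
  cone_term (tangent_cone v P) L + cone_term (tangent_cone v Q) L.
Proof.
move=> clP clQ cP cQ cPQ Pv Qv; rewrite /cone_term tangent_coneU//.
set C := tangent_cone v P; set D := tangent_cone v Q.
set b := ang (orthv L).
have mC : rVmeas C by exact: rVmeas_tangent_cone.
have mD : rVmeas D by exact: rVmeas_tangent_cone.
have CI : tangent_cone v (P `&` Q) = C `&` D by exact: tangent_coneI.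
rewrite [in ang L (tangent_cone v _)]CI.
have aC : ang L C = ang L (C `\` D) + ang L (C `&` D) by exact: angID.
have aD : ang L D = ang L (D `\` C) + ang L (C `&` D) by rewrite setIC; exact: angID.
have aU : ang L (C `|` D) = ang L (C `\` D) + ang L (D `\` C) + ang L (C `&` D).
  rewrite -angU; [|exact: rVmeasD|exact: rVmeasD|by move=> x [_ ?] []].
  rewrite -angU; [|by apply: rVmeasU; exact: rVmeasD|exact: rVmeasI|by move=> x [[_ h]|[_ h]] []].
  congr ang; apply/seteqP; split => [x CDx|x [[[Cx]|[Dx]]|[Cx]]]; [|by left|by right|by left].
  have [Cx|nC] := pselect (C x); have [Dx|nD] := pselect (D x).
  - by right.
  - by left; left.
  - by left; right.
  - by case: CDx.
have PU : polar (C `|` D) = polar C `&` polar D.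
  apply/seteqP; split => [y yCD|y [yC yD] x [|]]; last 2 first.
  - exact: yC.
  - exact: yD.
  by split => x h; apply: yCD; [left|right].
have bI : b (polar (tangent_cone v (P `&` Q))) + b (polar (C `|` D)) = b (polar C) + b (polar D).
  have -> : polar (tangent_cone v (P `&` Q)) = polar C `|` polar D.
    apply/seteqP; split => [y|]; first exact: polarI.
    by move=> y [|] h x; rewrite CI => -[Cx Dx]; exact: h.
  rewrite PU /b (angID _ (@rVmeas_polar _ _ C) (@rVmeas_polar _ _ D)).
  rewrite -[polar C `|` polar D](_ : (polar C `\` polar D) `|` polar D = _); last first.
    apply/seteqP; split => y; first by move=> [[]|]; [left|right].
    have [yD|yD] := pselect (polar D y); first by right.
    by move=> [yC|//]; left.
  rewrite angU; [|by apply: rVmeasD; exact: rVmeas_polar|exact: rVmeas_polar|by move=> y []].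
  by rewrite addrAC.
have bC : ang L (C `\` D) != 0 -> b (polar (C `|` D)) = b (polar C).
  have [[x [xL Cx Dx]]|H] := pselect (exists x, [/\ x \in L, C x & ~ D x]).
    move=> _; apply: eq_ang => y /orthvP yL; rewrite PU; split=> [[]//|yC]; split => //.
    exact: (polar_diff clQ cPQ cP Pv Qv Cx Dx (yL x xL)).
  rewrite (@eq_ang _ _ L _ set0) ?ang0 ?eqxx// => x xL; split=> // -[Cx Dx].
  by apply: H; exists x.
have bD : ang L (D `\` C) != 0 -> b (polar (C `|` D)) = b (polar D).
  have [[x [xL Dx Cx]]|H] := pselect (exists x, [/\ x \in L, D x & ~ C x]).
    move=> _; apply: eq_ang => y /orthvP yL; rewrite PU; split=> [[]//|yD]; split => //.
    by apply: (polar_diff clP _ cQ Qv Pv Dx Cx (yL x xL)) => //; rewrite setUC.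
  rewrite (@eq_ang _ _ L _ set0) ?ang0 ?eqxx// => x xL; split=> // -[Dx Cx].
  by apply: H; exists x.
have h1 : ang L (C `\` D) * (b (polar (C `|` D)) - b (polar C)) = 0.
  by have [->|/bC ->] := eqVneq (ang L (C `\` D)) 0; rewrite ?mul0r// subrr mulr0.
have h2 : ang L (D `\` C) * (b (polar (C `|` D)) - b (polar D)) = 0.
  by have [->|/bD ->] := eqVneq (ang L (D `\` C)) 0; rewrite ?mul0r// subrr mulr0.
rewrite aU aC aD -/(b _) -/(b (polar C)) -/(b (polar D)) -/(b (polar (C `|` D))).
have -> : b (polar (tangent_cone v (P `&` Q))) = b (polar C) + b (polar D) - b (polar (C `|` D)).
  by rewrite -bI addrK.
move: (lattice_det L) (ang L (C `\` D)) (ang L (D `\` C)) (ang L (C `&` D)) h1 h2.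
move: (b (polar C)) (b (polar D)) (b (polar (C `|` D))) => p q u l a1 a2 a3 h1 h2.
apply/eqP; rewrite -subr_eq0.
rewrite (_ : _ - _ = l * (a1 * (u - p)) + l * (a2 * (u - q))); last by ring.
by rewrite h1 h2 !mulr0 addr0.
Qed.

End valuation.

(** * Intersections of lattice polytopes with convex union *)

Section polytope_intersection.
Context {R : realType} {d : nat}.
Local Notation E := 'rV[R]_d.
Implicit Types (L W : {vspace E}) (S A B C P Q F : set E).

(** The functional is [x - y], with [y] the point of [A] nearest to [x]. *)
Lemma separate_point A x : compact A -> rVconvex A -> ~ A x ->
  exists c : E, forall k, A k -> dotr c k < dotr c x.
Proof.
move=> kA cA nAx; have [[k0 Ak0]|nA] := pselect (A !=set0); last first.
  by exists 0 => k Ak; exfalso; apply: nA; exists k.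
have cf : continuous (fun k : E => dotr (k - x) (k - x)).
  rewrite (_ : (fun _ => _) = (fun k : E => \sum_i (k 0 i - x 0 i) * (k 0 i - x 0 i))).
    apply: continuous_sumr => i k.
    have ck : (fun k : E => k 0 i - x 0 i) @ k --> k 0 i - x 0 i.
      exact: (cvgB (@coord_continuous _ _ _ 0 i k) (cvg_cst _)).
    exact: (cvgM ck ck).
  by apply/funext => k; rewrite dotrE; apply: eq_bigr => i _; rewrite !mxE.
have [y /set_mem Ay ymin] := EVT_min_rV (ex_intro _ k0 Ak0) kA (continuous_subspaceT cf).
exists (x - y) => k Ak.
have xy : x - y != 0 by rewrite subr_eq0; apply/eqP => xy; apply: nAx; rewrite xy.
suff h : dotr (x - y) (k - y) <= 0.
  rewrite -(subrK y k) dotrDr (le_lt_trans (lerD h (lexx _)))// add0r.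
  by rewrite -subr_gt0 -dotrBr dotr_gt0.
rewrite leNgt; apply/negP => h.
have ky : 0 < dotr (k - y) (k - y).
  by rewrite dotr_gt0; apply/eqP => ky; move: h; rewrite ky dotr0r ltxx.
set a := dotr (x - y) (k - y) in h; set b := dotr (k - y) (k - y) in ky.
(* Since [t * b <= a], the decrease [2 t a] of the squared distance outweighs the increase
   [t^2 b]. *)
pose t := Num.min 1 (a / b).
have t0 : 0 < t by rewrite lt_min ltr01 divr_gt0.
have t1 : t <= 1 by rewrite ge_min lexx.
have tb : t * b <= a by rewrite -ler_pdivlMr// ge_min lexx orbT.
have : dotr (y - x) (y - x) <= dotr (y + t *: (k - y) - x) (y + t *: (k - y) - x).
  apply: ymin; apply: mem_set; have -> : y + t *: (k - y) = (1 - t) *: y + t *: k.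
    by apply/rowP => i; rewrite !mxE; ring.
  by apply: cA => //; [rewrite subr_ge0|exact: ltW|rewrite subrK].
have -> : y + t *: (k - y) - x = (y - x) + t *: (k - y) by rewrite addrAC.
have := mulr_gt0 t0 h; have := ler_wpM2l (ltW t0) tb.
have : dotr (y - x) (k - y) = - a by rewrite -opprB dotrNl.
rewrite /b; move: (y - x) (k - y) => p q pq tq ta.
rewrite !(dotrDl, dotrDr) (dotrC _ p) !dotrZl !dotrZr pq.
by rewrite !mulrN; lra.
Qed.

(** Choose a generator of positive weight. Unless it equals [x], one can move from [x] towards it
    and, by at most its weight, away from it. *)
Lemma hull_vertex m (w : 'I_m -> E) x : hull w x ->
  (exists i, x = w i) \/ exists h, [/\ h != 0, hull w (x + h) & hull w (x - h)].
Proof.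
move=> [c [c0 c1 xE]].
have [i ci0] : exists i, 0 < c i.
  apply/not_existsP => H; have : \sum_i c i = 0.
    by apply: big1 => i _; apply/eqP; rewrite eq_le c0 andbT leNgt; apply/negP; exact: H.
  by rewrite c1 => /eqP; rewrite oner_eq0.
have [xi|xi] := eqVneq x (w i); [by left; exists i|right].
have ci1 : c i <= 1 by rewrite -c1 (bigD1 i)//= lerDl sumr_ge0.
have dE : \sum_j (j == i)%:R *: w j = w i.
  rewrite (bigD1 i)//= eqxx scale1r big1 ?addr0// => j /negbTE ->.
  by rewrite scale0r.
have d1 : \sum_j (j == i)%:R = 1 :> R.
  by rewrite (bigD1 i)//= eqxx big1 ?addr0// => j /negbTE ->.
have H (t : R) : - c i <= t <= 1 -> hull w (x + t *: (w i - x)).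
  move=> /andP[t1 t2]; exists (fun j => c j * (1 - t) + t * (j == i)%:R); split.
  - move=> j; have [->|ji] := eqVneq j i; last by rewrite mulr0 addr0 mulr_ge0// subr_ge0.
    rewrite mulr1; have : 0 <= (t + c i) * (1 - c i) by rewrite mulr_ge0// ?subr_ge0//; lra.
    by have := sqr_ge0 (c i); rewrite expr2; lra.
  - by rewrite big_split/= -mulr_suml -mulr_sumr c1 d1; ring.
  - transitivity ((1 - t) *: \sum_j c j *: w j + t *: \sum_j (j == i)%:R *: w j).
      by rewrite -xE dE; apply/rowP => j; rewrite !mxE; ring.
    rewrite !scaler_sumr -big_split; apply: eq_bigr => j _ /=.
    by rewrite !scalerA -scalerDl [(1 - t) * _]mulrC.
exists (c i *: (w i - x)); split; last 2 first.
- by apply: H; rewrite ci1 andbT; lra.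
- by rewrite -scaleNr; apply: H; rewrite lexx/=; lra.
by rewrite scaler_eq0 negb_or gt_eqF//= subr_eq0 eq_sym.
Qed.

(* If [z] were a vertex of neither, it would be the midpoint of a segment of [P] with
   one half outside [Q] and of a segment of [Q]; the segments joining the outer end
   of the former to the ends of the latter meet the intersection, which by
   convexity pushes [Q] beyond [z]. *)
Lemma vertex_of_inter m n (w : 'I_m -> E) (u : 'I_n -> E) (z : E) :
  let P := hull w in let Q := hull u in rVconvex (P `|` Q) -> P z -> Q z ->
  (forall h, (P `&` Q) (z + h) -> (P `&` Q) (z - h) -> h = 0) ->
  (exists i, z = w i) \/ (exists i, z = u i).
Proof.
move=> P Q cPQ Pz Qz ext.
have [|[h [h0 Ph1 Ph2]]] := hull_vertex Pz; first by left.
have [|[g [g0 Qg1 Qg2]]] := hull_vertex Qz; first by right.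
have cP : rVconvex P by exact: hull_convex.
have cQ : rVconvex Q by exact: hull_convex.
(* If [Q] contained points of both rays from [z] along [h], the intersection would contain a segment
   around [z]. So one ray avoids [Q], and [k] is [h] or [- h]. *)
suff K k : P (z - k) -> (forall e, 0 < e -> ~ Q (z - e *: k)) -> False.
  exfalso; have [[e [e0 Qe]]|nQ] := pselect (exists e, 0 < e /\ Q (z + e *: h)); last first.
    apply: (K (- h)); rewrite ?opprK// => e e0; rewrite scalerN opprK => Qe.
    by apply: nQ; exists e.
  apply: (K h) => // f f0; rewrite -scalerN => Qf.
  pose t := Num.min 1 (Num.min e f).
  have t0 : 0 < t by rewrite !lt_min ltr01 e0.
  have t01 : 0 <= t <= 1 by rewrite ltW//= ge_min lexx.
  have te : 0 <= t <= e by rewrite ltW//= !ge_min lexx orbT.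
  have tf : 0 <= t <= f by rewrite ltW//= !ge_min lexx !orbT.
  have : t *: h = 0.
    apply: ext; split; [|exact: mem_segment Qe te|rewrite -scalerN|rewrite -scalerN; exact: mem_segment Qf tf].
      by apply: mem_segment t01 => //; rewrite scale1r.
    by apply: mem_segment t01 => //; rewrite scale1r.
  by move/eqP; rewrite scaler_eq0 gt_eqF//= (negbTE h0).
move=> Pk nQ.
have meet (g' : E) : Q (z + g') -> exists2 t, 0 < t <= 1 &
    (P `&` Q) (z - (1 - t) *: k + t *: g').
  move=> Qg; have [t /andP[t0 t1] PQt] := segment_meets (@hull_closed _ _ _ w) (@hull_closed _ _ _ u) cPQ Pk Qg.
  have PQt' : (P `&` Q) (z - (1 - t) *: k + t *: g').
    by move: PQt; congr (_ `&` _) => //; apply/rowP => i; rewrite !mxE; ring.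
  exists t => //; rewrite t1 andbT lt_neqAle t0 andbT; apply/eqP => tE.
  move: PQt'; rewrite -tE subr0 scale0r addr0 => -[_].
  exact: nQ.
have [t /andP[t0 t1] PQt] := meet _ Qg1.
have [s /andP[s0 s1] PQs] := meet _ Qg2.
(* Weights [s / (s + t)] and [t / (s + t)] cancel [g] and leave [z - c *: k] in [Q]. Hence [c] is
   not positive, so [s = t = 1] and both [z + g] and [z - g] lie in the intersection. *)
pose c := (s * (1 - t) + t * (1 - s)) / (s + t).
have st : 0 < s + t by rewrite addr_gt0.
have Qc : Q (z - c *: k).
  have -> : z - c *: k = (s / (s + t)) *: (z - (1 - t) *: k + t *: g)
      + (t / (s + t)) *: (z - (1 - s) *: k + s *: (- g)).
    by apply/rowP => i; rewrite !mxE /c; field; rewrite gt_eqF.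
  apply: cQ; [by case: PQt|by case: PQs|by rewrite divr_ge0// ltW|by rewrite divr_ge0// ltW|].
  by rewrite -mulrDl divff// gt_eqF.
have c_le0 : c <= 0 by rewrite leNgt; apply/negP => /nQ.
have n1 : 0 <= s * (1 - t) by rewrite mulr_ge0 ?subr_ge0// ltW.
have n2 : 0 <= t * (1 - s) by rewrite mulr_ge0 ?subr_ge0// ltW.
have : s * (1 - t) + t * (1 - s) <= 0 by move: c_le0; rewrite /c ler_pdivrMr// mul0r.
move=> n3.
have tE : t = 1.
  have : s * (1 - t) = 0 by apply/le_anti; rewrite n1 andbT; lra.
  by move/eqP; rewrite mulf_eq0 gt_eqF//= subr_eq0 => /eqP.
have sE : s = 1.
  have : t * (1 - s) = 0 by apply/le_anti; rewrite n2 andbT; lra.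
  by move/eqP; rewrite mulf_eq0 gt_eqF//= subr_eq0 => /eqP.
move/eqP : g0; apply; apply: ext.
  by move: PQt; rewrite tE subrr scale0r subr0 scale1r.
by move: PQs; rewrite sE subrr scale0r subr0 scale1r.
Qed.

(* Among the maximizers of a linear form, a point of largest Euclidean norm is extreme. *)
Lemma extreme_max A c x : compact A -> A x -> exists z, [/\ A z, dotr c x <= dotr c z &
  forall h, A (z + h) -> A (z - h) -> h = 0].
Proof.
move=> kA Ax.
have [y /set_mem Ay ymax] := EVT_max_rV (ex_intro _ x Ax) kA
  (continuous_subspaceT (@dotr_continuousr R d c)).
have {}ymax k : A k -> dotr c k <= dotr c y by move=> Ak; apply: ymax; exact: mem_set.
pose M := A `&` [set k | dotr c k = dotr c y].
have kM : compact M.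
  apply: compact_closedI => //.
  rewrite (_ : mkset _ = dotr c @^-1` [set r | r = dotr c y])//.
  by apply: preimage_closed; [move=> k _; exact: dotr_continuousr|exact: closed_eq].
have My : M y by [].
have [z /set_mem[Az cz] zmax] := EVT_max_rV (ex_intro _ y My) kM
  (continuous_subspaceT (@dotr_sqr_continuous R d)).
exists z; split => // [|h Ah1 Ah2]; first by rewrite cz; exact: ymax.
have ch : dotr c h = 0.
  have := ymax _ Ah1; have := ymax _ Ah2; rewrite dotrBr dotrDr cz.
  by lra.
have n1 : dotr (z + h) (z + h) <= dotr z z.
  by apply: zmax; apply: mem_set; split => //=; rewrite dotrDr ch addr0.
have n2 : dotr (z - h) (z - h) <= dotr z z.
  by apply: zmax; apply: mem_set; split => //=; rewrite dotrBr ch subr0.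
apply/eqP; rewrite -dotr_eq0 eq_le dotr_ge0 andbT.
move: n1 n2; rewrite !(dotrBl, dotrBr, dotrDl, dotrDr) (dotrC h z).
by lra.
Qed.

Lemma lattice_polytope_seq (s : seq 'rV[int]_d) :
  lattice_polytope (hull (fun i : 'I_(size s) => zpt s`_i : E)).
Proof. by exists (size s), (fun i => s`_i). Qed.

(** The candidate [K] is the hull of the generators of [P] and [Q] lying in both. A functional
    separating a point from [K] would be maximal at an extreme point of the intersection, which is
    one of these generators. *)
Lemma lattice_polytopeI P Q : lattice_polytope P -> lattice_polytope Q ->
  rVconvex (P `|` Q) -> lattice_polytope (P `&` Q).
Proof.
move=> [m [w PE]] [n [u QE]] cPQ.
have {}PE : P = hull (fun i => zpt (w i)) by [].
have {}QE : Q = hull (fun i => zpt (u i)) by [].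
have cP : rVconvex P by rewrite PE; exact: hull_convex.
have cQ : rVconvex Q by rewrite QE; exact: hull_convex.
pose s := [seq z <- [seq w i | i : 'I_m] ++ [seq u i | i : 'I_n] | `[< (P `&` Q) (zpt z) >]].
pose K := hull (fun i : 'I_(size s) => zpt s`_i : E).
have sPQ z : z \in s -> (P `&` Q) (zpt z) by rewrite mem_filter => /andP[/asboolP].
have sK z : z \in s -> K (zpt z).
  move=> zs; have := zs; rewrite -index_mem => zi.
  have := mem_hull (fun i : 'I_(size s) => zpt s`_i : E) (Ordinal zi).
  by rewrite /= nth_index.
suff -> : P `&` Q = K by exact: lattice_polytope_seq.
apply/seteqP; split => [x PQx|]; last first.
  apply: sub_hull => [a b x y [Px Qx] [Py Qy] a0 b0 ab|i].
    by split; [exact: cP|exact: cQ].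
  by apply: sPQ; rewrite mem_nth.
apply: contrapT => nKx.
have [c cK] := separate_point (@hull_compact _ _ _ _) (@hull_convex _ _ _ _) nKx.
have kPQ : compact (P `&` Q).
  by apply: compact_closedI; [rewrite PE; exact: hull_compact|rewrite QE; exact: hull_closed].
have [z [[Pz Qz] xz zext]] := extreme_max c kPQ PQx.
suff Kz : K z by have := cK z Kz; rewrite ltNge xz.
have := @vertex_of_inter _ _ (fun i => zpt (w i)) (fun i => zpt (u i)) z.
rewrite /= -PE -QE => /(_ cPQ Pz Qz zext)[[i zE]|[i zE]]; rewrite zE; apply: sK.
  rewrite mem_filter mem_cat map_f ?mem_enum// andbT; apply/asboolP.
  by rewrite -zE.
rewrite mem_filter mem_cat [X in _ || X]map_f ?mem_enum// orbT andbT; apply/asboolP.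
by rewrite -zE.
Qed.

End polytope_intersection.

(** * Valuation, translation invariance and the first three properties *)

Section discrete_intrinsic_volume.
Context {R : realType} {d : nat}.
Local Notation E := 'rV[R]_d.
Implicit Types (L W : {vspace E}) (S A B C P Q F : set E).

Lemma lattice_polytopeP P : lattice_polytope P ->
  exists m (w : 'I_m -> 'rV[int]_d), P = hull (fun i => zpt (w i)).
Proof. by []. Qed.

Lemma lattice_polytope_convex P : lattice_polytope P -> rVconvex P.
Proof. by move=> /lattice_polytopeP[m [w ->]]; exact: hull_convex. Qed.

Lemma lattice_polytope_closed P : lattice_polytope P -> closed P.
Proof. by move=> /lattice_polytopeP[m [w ->]]; exact: hull_closed. Qed.

Lemma lattice_polytope_bounded P : lattice_polytope P -> rVbounded P.
Proof. by move=> /lattice_polytopeP[m [w ->]]; exact: hull_bounded. Qed.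

Lemma lattice_discrete_intrinsic_volumeE k P : lattice_polytope P ->
  discrete_intrinsic_volume k P = \sum_(v \in latpts P) cone_sum k (tangent_cone (zpt v) P).
Proof. by move=> /lattice_polytopeP[m [w ->]]; exact: discrete_intrinsic_volumeE. Qed.

Lemma lattice_cone_term_finite P v : lattice_polytope P -> P v ->
  finite_set [set L | cone_term (tangent_cone v P) L != 0].
Proof. by move=> /lattice_polytopeP[m [w ->]]; exact: cone_term_finite. Qed.

Lemma cone_sum_widen k C (X : set {vspace E}) :
  [set L | cone_term C L != 0] `<=` X ->
  cone_sum k C = \sum_(L \in [set L | \dim L = k] `&` X) cone_term C L.
Proof.
move=> CX; apply/esym; apply: fsbig_widen => [L []//|L [Lk nX]].
rewrite /preimage/=; apply: contra_notP nX => /eqP CL; split=> //; exact: CX.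
Qed.

(** The sums can be added termwise only after restriction to a common finite set of subspaces. *)
Lemma cone_sumD k C1 C2 C3 C4 :
  finite_set [set L | cone_term C1 L != 0] -> finite_set [set L | cone_term C2 L != 0] ->
  finite_set [set L | cone_term C3 L != 0] -> finite_set [set L | cone_term C4 L != 0] ->
  (forall L, cone_term C1 L + cone_term C2 L = cone_term C3 L + cone_term C4 L) ->
  cone_sum k C1 + cone_sum k C2 = cone_sum k C3 + cone_sum k C4.
Proof.
set X1 := (X in finite_set X -> _); set X2 := (X in _ -> finite_set X -> _).
set X3 := (X in _ -> _ -> finite_set X -> _).
set X4 := (X in _ -> _ -> _ -> finite_set X -> _).
move=> f1 f2 f3 f4 H; pose X := (X1 `|` X2) `|` (X3 `|` X4).
have fX : finite_set ([set L | \dim L = k] `&` X).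
  by apply: finite_setIr; rewrite !finite_setU.
rewrite !(@cone_sum_widen k _ X); last 4 first.
- by move=> L h; right; right.
- by move=> L h; right; left.
- by move=> L h; left; right.
- by move=> L h; left; left.
by rewrite -!fsbig_split//=; apply: eq_fsbigr => L _; exact: H.
Qed.

(** Near [v], away from the closed set [Q], the union coincides with [P]. *)
Lemma tangent_coneUl P Q v : closed Q -> rVconvex (P `|` Q) -> P v -> ~ Q v ->
  tangent_cone v (P `|` Q) = tangent_cone v P.
Proof.
move=> clQ cPQ Pv nQ; apply/seteqP; split => x; last first.
  by move=> [l l0 [p Pp <-]]; exists l => //; exists p => //; left.
have PQv : (P `|` Q) v by left.
move=> /(tangent_coneP _ PQv)[e e0 PQe]; apply/(tangent_coneP _ Pv).
have [f f0 Hf] := closed_complement_segment x clQ nQ.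
have t0 : 0 < Num.min e f by rewrite lt_min e0.
exists (Num.min e f) => //.
have [//|Qt] : (P `|` Q) (v + Num.min e f *: x).
  by apply: mem_segment PQe _ => //; rewrite ltW//= ge_min lexx.
by exfalso; apply: Hf Qt; rewrite ltW//= ge_min lexx orbT.
Qed.

Lemma discrete_intrinsic_volume_valuation k :
  valuation (@discrete_intrinsic_volume R d k).
Proof.
split.
  rewrite /discrete_intrinsic_volume (_ : latpts set0 = set0) ?fsbig_set0//.
move=> P Q lP lQ lPQ.
have cP := lattice_polytope_convex lP; have cQ := lattice_polytope_convex lQ.
have clP := lattice_polytope_closed lP; have clQ := lattice_polytope_closed lQ.
have cPQ := lattice_polytope_convex lPQ.
have lI := lattice_polytopeI lP lQ cPQ.
(* Extension by zero puts all four sums over the lattice points of the union, to be compared point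
   by point. *)
pose g A v := if `[< A (zpt v) >] then cone_sum k (tangent_cone (zpt v) A) else 0.
have gE A : lattice_polytope A -> A `<=` P `|` Q ->
    discrete_intrinsic_volume k A = \sum_(v \in latpts (P `|` Q)) g A v.
  move=> lA APQ; rewrite lattice_discrete_intrinsic_volumeE// (eq_fsbigr (g A)).
    apply: fsbig_widen => [v|v [_ nA]]; first exact: APQ.
    by rewrite /preimage/= /g; case: asboolP.
  by move=> v /set_mem Av; rewrite /g; case: asboolP.
have fPQ : finite_set (latpts (P `|` Q)) by exact/finite_latpts/lattice_polytope_bounded.
apply/eqP; rewrite eq_sym subr_eq; apply/eqP/esym.
rewrite !gE//; last by move=> x [Px _]; left.
rewrite -!fsbig_split//=; apply: eq_fsbigr => v /set_mem PQv; rewrite /g.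
have [Pv|nP] := pselect (P (zpt v)); have [Qv|nQ] := pselect (Q (zpt v)); last by case: PQv.
- have Iv : (P `&` Q) (zpt v) by [].
  case: asboolP => // _; case: asboolP => // _; case: asboolP => // _; case: asboolP => // _.
  apply: cone_sumD; try exact: lattice_cone_term_finite.
  by move=> L; exact: cone_term_valuation.
- have nI : ~ (P `&` Q) (zpt v) by move=> [].
  case: asboolP => // _; case: asboolP => // _; case: asboolP => // _; case: asboolP => // _.
  by rewrite tangent_coneUl.
- have nI : ~ (P `&` Q) (zpt v) by move=> [].
  case: asboolP => // _; case: asboolP => // _; case: asboolP => // _; case: asboolP => // _.
  by rewrite setUC tangent_coneUl// 1?setUC// addr0 add0r.
Qed.

Lemma translate_hull m (w : 'I_m -> E) (t : E) :
  translate t (hull w) = hull (fun i => t + w i).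
Proof.
have H (c : 'I_m -> R) : \sum_i c i = 1 ->
    \sum_i c i *: (t + w i) = t + \sum_i c i *: w i.
  by move=> c1; under eq_bigr do rewrite scalerDr; rewrite big_split/= -scaler_suml c1 scale1r.
apply/seteqP; split => [_ [_ [c [c0 c1 ->]] <-]|_ [c [c0 c1 ->]]].
  by exists c; rewrite H.
by exists (\sum_i c i *: w i); rewrite ?H//; exists c.
Qed.

Lemma tangent_cone_translate P (v t : E) :
  tangent_cone (t + v) (translate t P) = tangent_cone v P.
Proof.
apply/seteqP; split => x.
  by move=> [l l0 [_ [p Pp <-] <-]]; exists l => //; exists p => //; rewrite opprD addrACA subrr add0r.
move=> [l l0 [p Pp <-]]; exists l => //; exists (t + p); first by exists p.
by rewrite opprD addrACA subrr add0r.
Qed.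

Lemma discrete_intrinsic_volume_translation k :
  translation_invariant (@discrete_intrinsic_volume R d k).
Proof.
move=> P t lP.
have lT : lattice_polytope (translate (zpt t) P).
  have [m [w ->]] := lattice_polytopeP lP; rewrite translate_hull.
  exists m, (fun i => t + w i); congr hull; apply/funext => i.
  by rewrite zptD.
rewrite !lattice_discrete_intrinsic_volumeE//.
have -> : latpts (translate (zpt t) P) = (fun v => t + v) @` latpts P.
  apply/seteqP; split => [v [p Pp pv]|_ [v Pv <-]].
    have pE : p = zpt (v - t) by rewrite zptB -pv addrC addKr.
    by exists (v - t); [rewrite /latpts/= -pE|rewrite addrC subrK].
  by exists (zpt v) => //; rewrite zptD.
rewrite fsbig_image; last by move=> x y _ _; exact: addrI.
by apply: eq_fsbigr => v _; rewrite zptD tangent_cone_translate.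
Qed.

Lemma det_mx_dim0 (A : comPzRingType) n (M : 'M[A]_n) : n = 0%N -> \det M = 1.
Proof. by move=> n0; move: M; rewrite n0 => M; rewrite det_mx00. Qed.

Lemma lattice_det0 : lattice_det (0%VS : {vspace E}) = 1.
Proof. by rewrite /lattice_det det_mx_dim0 ?sqrtr1// dimv0. Qed.

Lemma cone_sum0 C : C 0 -> cone_sum 0 C = ang (orthv 0) (polar C).
Proof.
move=> C0; rewrite /cone_sum (_ : mkset _ = [set 0%VS]); last first.
  by apply/seteqP; split => L /= => [/eqP|->]; rewrite ?dimv0// dimv_eq0 => /eqP.
rewrite fsbig_set1 /cone_term lattice_det0 mul1r [X in _ * X]ang_eq1 ?mulr1//.
by move=> x; rewrite memv0 => /eqP ->.
Qed.

Lemma discrete_intrinsic_volume0 P : lattice_polytope P -> P !=set0 ->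
  discrete_intrinsic_volume 0 P = 1.
Proof.
move=> lP [x0 Px0]; rewrite lattice_discrete_intrinsic_volumeE//.
pose D := latpts P; pose N (v : 'rV[int]_d) := polar (tangent_cone (zpt v) P).
pose L := orthv (0%VS : {vspace E}).
have LT x : x \in L by apply/orthvP => u; rewrite memv0 => /eqP ->; rewrite dotr0r.
rewrite (eq_fsbigr (fun v => ang L (N v))); last first.
  by move=> v /set_mem Pv; rewrite cone_sum0//; exact: tangent_cone0.
have fD : finite_set D by exact/finite_latpts/lattice_polytope_bounded.
(* Off these finitely many hyperplanes a functional separates the lattice points of [P], so the
   normal cones are disjoint there. *)
pose H (p : 'rV[int]_d * 'rV[int]_d) := [set y : E | y \in orthv <[zpt p.1 - zpt p.2]>%VS].
pose DD := (D `*` D) `&` [set p | p.1 != p.2].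
have mH p : rVmeas (H p).
  rewrite (_ : H p = polar [set` <[zpt p.1 - zpt p.2]>%VS]); first exact: rVmeas_polar.
  apply/seteqP; split => y /= => [/orthvP Hy x xp|yp]; first by rewrite Hy.
  apply/orthvP => u up; apply/le_anti; rewrite yp//= -oppr_le0 -dotrNr yp//.
  by rewrite /= memvN.
have H0 p : DD p -> ang L (H p) = 0.
  move=> [_ /= p12]; apply: (@ang_null _ _ _ (orthv <[zpt p.1 - zpt p.2]>%VS)) => //.
  apply/negP => /subvP/(_ (zpt p.1 - zpt p.2) (LT _))/orthvP/(_ _ (memv_line _))/eqP.
  rewrite dotr_eq0 -zptB => /eqP/rowP z0; move/negP : p12; apply; apply/eqP/rowP => i.
  by have /eqP := z0 i; rewrite !mxE intr_eq0 subr_eq0 => /eqP.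
have fDD : finite_set DD by apply: finite_setIl; exact: finite_setX.
have [mZ Z0] := ang_bigcup_null fDD (fun p _ => mH p) H0.
set Z := \bigcup_(p in DD) H p in mZ Z0.
have mN v : rVmeas (N v) by exact: rVmeas_polar.
rewrite (eq_fsbigr (fun v => ang L (N v `\` Z))); last first.
  move=> v _; rewrite (angID L (mN v) mZ) [X in _ + X](_ : _ = 0) ?addr0//.
  apply/eqP; rewrite eq_le ang_ge0 andbT -Z0; apply: le_ang => //; first exact: rVmeasI.
  by move=> y [].
have mNZ v : D v -> rVmeas (N v `\` Z) by move=> _; exact: rVmeasD.
rewrite -ang_fsumD//; last first.
  move=> v v' y Dv Dv' [Nv nZ] [Nv' _]; apply: contrapT => vv'; apply: nZ.
  exists (v, v'); first by split => //=; apply/eqP.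
  apply/orthvP => _ /vlineP[k ->]; rewrite dotrZr dotrBr.
  suff -> : dotr y (zpt v) = dotr y (zpt v') by rewrite subrr mulr0.
  by apply/le_anti; move/polar_tangent_coneP : Nv => ->//=; move/polar_tangent_coneP : Nv' => ->.
have mU : rVmeas (\bigcup_(v in D) (N v `\` Z)).
  by rewrite /rVmeas preimage_bigcup; apply: fin_bigcup_measurable.
apply/le_anti; rewrite ang_le1//= -(@ang_eq1 _ _ L setT)//.
rewrite (angID L (@rVmeasT _ _) mZ) setTI Z0 addr0.
apply: le_ang => //; first by apply: rVmeasD => //; exact: rVmeasT.
move=> y [_ nZ].
suff [v Dv Nv] : exists2 v, D v & N v y by exists v.
(* Covering: every functional attains its maximum over [P] at a generator, which is a lattice
   point. *)
have [m [w PE]] := lattice_polytopeP lP.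
have [i0] : exists i0 : 'I_m, True.
  move: Px0; rewrite PE => -[c [_ c1 _]]; case: m c c1 w PE => [c|m _ _ _ _]; last by exists ord0.
  by rewrite big_ord0 => /esym/eqP; rewrite oner_eq0.
move=> _; pose f i := dotr y (zpt (w i)).
have [i _ imax] := @Order.TotalTheory.arg_maxP _ _ 'I_m i0 xpredT f isT.
exists (w i); first by rewrite /D /latpts/= PE; exact: (mem_hull (fun i => zpt (w i))).
apply/polar_tangent_coneP => x; rewrite PE.
have cS : rVconvex [set x | dotr y x <= dotr y (zpt (w i))].
  move=> s t z z' /= h1 h2 s0 t0 st; rewrite dotrDr !dotrZr.
  by rewrite -[leRHS]mul1r -st mulrDl lerD// ler_wpM2l.
by apply: (sub_hull cS) => j; exact: imax.
Qed.

Lemma cone_term_null P v L : lattice_polytope P -> P v -> ~~ (L <= dirspace P)%VS ->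
  cone_term (tangent_cone v P) L = 0.
Proof.
move=> lP Pv LP; rewrite /cone_term [X in _ * X](@ang_null _ _ _ _ _ _ LP) ?mulr0//.
  by apply: rVmeas_tangent_cone => //; [exact: lattice_polytope_closed|exact: lattice_polytope_convex].
move=> x _ [l /= l0 [p Pp <-]]; rewrite memvZ//; exact: dirspaceB.
Qed.

Lemma discrete_intrinsic_volume_dim k P : lattice_polytope P -> (adim P < k)%N ->
  discrete_intrinsic_volume k P = 0.
Proof.
move=> lP Pk; rewrite lattice_discrete_intrinsic_volumeE//; apply: fsbig1 => v Pv; apply: fsbig1 => L /= Lk.
apply: cone_term_null => //; apply: contraTN Pk => /dimvS; rewrite Lk.
by rewrite -leqNgt.
Qed.

Lemma dim_rV : \dim {:E} = d.
Proof. by rewrite dimvf /dim /= mul1n. Qed.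

(** Whatever basis is chosen, it generates the unit vectors, so it has an integer inverse and
    determinant 1 or -1. *)
Lemma lattice_det_full : lattice_det (fullv : {vspace E}) = 1.
Proof.
rewrite /lattice_det; move: dim_rV; move: (\dim _) => n nd; subst n.
set S := [set B | _].
have [_ HB] : S (xget 0 S).
  apply: (@xgetPex _ 0 S); exists 1%:M; split => [|z].
    by rewrite map_mx1 row_free_unit unitmx1.
  by rewrite memvf; split=> // _; exists z; rewrite mulmx1.
move: (xget 0 S) HB => B HB.
have [C CB] : exists C : 'M[int]_d, C *m B = 1%:M.
  have H i : {c : 'rV[int]_d | row i 1%:M = c *m B}.
    by apply: cid; apply/HB; rewrite memvf.
  exists (\matrix_i sval (H i)); apply/row_matrixP => i.
  by rewrite row_mul rowK -(svalP (H i)).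
have B2 : \det B ^+ 2 = 1.
  have /eqP := congr1 absz (congr1 determinant CB).
  rewrite det_mulmx det1 abszM absz1 muln_eq1 => /andP[_ /eqP B1].
  by rewrite -(real_normK (num_real _)) -abszE B1 expr1n.
by rewrite det_mulmx det_tr det_map_mx -expr2 -rmorphXn /= B2 rmorph1 sqrtr1.
Qed.

Lemma orthv_full x : x \in orthv (fullv : {vspace E}) -> x = 0.
Proof. by move=> /orthvP/(_ x (memvf _))/eqP; rewrite dotr_eq0 => /eqP. Qed.

Lemma cone_sum_full C : cone_sum d C = ang fullv C.
Proof.
rewrite /cone_sum (_ : mkset _ = [set fullv]); last first.
  apply/seteqP; split => L /= => [Ld|->]; last exact: dim_rV.
  by apply/eqP; rewrite eqEdim subvf Ld dim_rV leqnn.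
rewrite fsbig_set1 /cone_term lattice_det_full mul1r [X in X * _]ang_eq1 ?mul1r//.
by move=> x /orthv_full ->; exact: polar0.
Qed.

Lemma discrete_intrinsic_volume_full P : lattice_polytope P ->
  discrete_intrinsic_volume d P = solid_angle_valuation P.
Proof.
move=> lP; have clP := lattice_polytope_closed lP; have cP := lattice_polytope_convex lP.
rewrite /solid_angle_valuation; case: eqP => Pd.
  rewrite lattice_discrete_intrinsic_volumeE//; apply: eq_fsbigr => v /set_mem Pv.
  rewrite cone_sum_full solid_angle_tangent_cone//; congr ang.
  have dP : \dim (dirspace P) = d by exact: Pd.
  by apply/eqP; rewrite eq_sym eqEdim subvf dim_rV dP leqnn.
rewrite lattice_discrete_intrinsic_volumeE//; apply: fsbig1 => v Pv; rewrite cone_sum_full.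
apply: (@ang_null _ _ _ (dirspace P)); first exact: rVmeas_tangent_cone.
  apply/negP => fP; apply: Pd; rewrite /adim.
  have /eqP -> : dirspace P == fullv by rewrite eqEsubv subvf.
  exact: dim_rV.
by move=> x _ [l /= l0 [p Pp <-]]; rewrite memvZ//; exact: dirspaceB.
Qed.

End discrete_intrinsic_volume.

(** * Asymptotics *)

Section lattice_basis.
Context {R : realType} {d : nat}.
Local Notation E := 'rV[R]_d.
Implicit Types (L : {vspace E}).
Local Notation realmx M := (map_mx intr M : 'M[R]_(_, _)).

Lemma zpt_inj : injective (zpt : 'rV[int]_d -> E).
Proof.
move=> z w zw; apply/rowP => i; move/rowP/(_ i)/eqP : zw.
by rewrite !mxE eqr_int => /eqP.
Qed.

(** Write [A = U *m D *m V] in Smith form. The rows of the unimodular [V] at the nonzero diagonal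
    positions [J] of [D], selected by [S], form a basis of all integer points of [L], even where the
    rows of [A] generate only a sublattice. *)
Lemma lattice_basis_exists L m (A : 'M[int]_(m, d)) :
  (forall x, x \in L <-> (x <= realmx A)%MS) ->
  exists B : 'M[int]_(\dim L, d), row_free (realmx B) /\
    forall z, (zpt z \in L) <-> exists c : 'rV[int]_(\dim L), z = c *m B.
Proof.
move=> LA; have [U uU [V uV [s _ AE]]] := int_Smith_normal_form A.
set D := \matrix_(i, j) _ in AE.
pose J : {set 'I_d} := [set j | [exists i, D i j != 0]]%SET.
pose n := #|J|.
pose S : 'M[int]_(n, d) := \matrix_(i, j) (enum_val i == j)%:R.
have SE (z : 'rV[int]_d) a : (z *m S^T) 0 a = z 0 (enum_val a).
  rewrite mxE (bigD1 (enum_val a))//= !mxE eqxx mulr1 big1 ?addr0// => j /negbTE ja.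
  by rewrite !mxE eq_sym ja mulr0.
have SS : S *m S^T = 1%:M.
  apply/row_matrixP => i; rewrite row_mul; apply/rowP => a; rewrite SE !mxE.
  by rewrite (inj_eq enum_val_inj).
have DS : D *m S^T *m S = D.
  apply/row_matrixP => i; rewrite !row_mul; apply/rowP => j; rewrite [RHS]mxE mxE.
  have [jJ|jJ] := boolP (j \in J).
    rewrite (bigD1 (enum_rank_in jJ j))//= SE !mxE enum_rankK_in// eqxx mulr1.
    rewrite big1 ?addr0// => a aj; rewrite [S a j]mxE [_ == j](_ : _ = false) ?mulr0//.
    by apply: contraNF aj => /eqP aj; apply/eqP/enum_val_inj; rewrite enum_rankK_in.
  rewrite big1 => [|a _]; last first.
    rewrite [S a j]mxE [_ == j](_ : _ = false) ?mulr0//.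
    by apply/eqP => aj; move: (enum_valP a); rewrite aj (negbTE jJ).
  by move: jJ; rewrite inE negb_exists => /forallP/(_ i); rewrite negbK => /eqP.
pose B := S *m V.
have uVR : realmx V \in unitmx by rewrite unitmxE det_map_mx rmorph_unit// -unitmxE.
have uUR : realmx U \in unitmx by rewrite unitmxE det_map_mx rmorph_unit// -unitmxE.
have SSR : realmx S *m (realmx S)^T = 1%:M by rewrite map_trmx -map_mxM SS map_mx1.
have fB : row_free (realmx B).
  apply/row_freeP; exists (invmx (realmx V) *m (realmx S)^T).
  by rewrite map_mxM -mulmxA (mulmxA (realmx V)) mulmxV// mul1mx.
have AB : (realmx A <= realmx B)%MS.
  have -> : realmx A = realmx (U *m (D *m S^T)) *m realmx B.
    by rewrite -map_mxM AE -{1}DS /B !mulmxA.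
  exact: submxMl.
have SD : (realmx S <= realmx D)%MS.
  apply/row_subP => a; have : enum_val a \in J by exact: enum_valP.
  rewrite inE => /existsP[i Di].
  have dE j : D i j = s`_i *+ (i == j :> nat) by rewrite mxE.
  have ia : (i == enum_val a :> nat).
    by apply: contraNT Di; rewrite dE => /negbTE ->.
  have -> : row a (realmx S) = ((D i (enum_val a))%:~R)^-1 *: row i (realmx D).
    apply/rowP => j; rewrite 2![LHS]mxE [S a j]mxE [RHS]mxE 2![X in _ * X]mxE !dE ia.
    have [aj|aj] := eqVneq (enum_val a) j.
      by rewrite -aj ia mulVf// intr_eq0; move: Di; rewrite dE ia.
    have -> : (i == j :> nat) = false by rewrite (eqP ia); exact/negbTE.
    by rewrite mulr0.
  by rewrite scalemx_sub// row_sub.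
have BA : (realmx B <= realmx A)%MS.
  rewrite map_mxM (submx_trans (submxMr _ SD))//.
  have -> : realmx D *m realmx V = invmx (realmx U) *m realmx A.
    by rewrite AE !map_mxM -mulmxA mulKmx.
  exact: submxMl.
have LB x : x \in L <-> (x <= realmx B)%MS.
  by rewrite LA; split => h; exact: submx_trans h _.
have nL : n = \dim L.
  have [oo ob] := orthonormal_basisP L.
  have fo : row_free (orthonormal_basis L) by apply/row_freeP; exists (orthonormal_basis L)^T.
  move: fB fo; rewrite /row_free => /eqP <- /eqP <-; apply/eqP; rewrite eqn_leq.
  apply/andP; split; apply: mxrankS; apply/row_subP => i.
    by apply/ob/LB; exact: row_sub.
  by apply/LB/ob; exact: row_sub.
case: _ / nL; exists B; split => // z; split=> [/LB/submxP[c zc]|[c ->]]; last first.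
  by apply/LB; rewrite /zpt map_mxM submxMl.
(* Coordinates with respect to [V] are integers, and those of a point of [L] are supported on
   [J]. *)
exists (z *m invmx V *m S^T).
apply: zpt_inj.
have zS : realmx (z *m invmx V) = c *m realmx S.
  rewrite map_mxM -/(zpt z) zc map_mxM -!mulmxA -map_mxM mulmxV//.
  by rewrite map_mx1 mulmx1.
have -> : zpt (z *m invmx V *m S^T *m B) =
    realmx (z *m invmx V) *m realmx S^T *m realmx B by rewrite /zpt -!map_mxM.
by rewrite zS -map_trmx -(mulmxA c) SSR mulmx1.
Qed.

End lattice_basis.

(** * Faces and cones of dilated polytopes *)

Section dilation.
Context {R : realType} {d : nat}.
Local Notation E := 'rV[R]_d.
Implicit Types (L W : {vspace E}) (S A B C P Q F : set E).

Lemma zptMn (z : 'rV[int]_d) n : zpt (z *+ n) = n%:R *: zpt z :> E.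
Proof. by apply/rowP => i; rewrite !mxE mulmxnE rmorphMn /= mulr_natl. Qed.

Lemma dilateP n F x : dilate n.+1 F x <-> F (n.+1%:R^-1 *: x).
Proof.
split=> [[u Fu <-]|Fx]; first by rewrite scalerA mulVf ?scale1r ?pnatr_eq0.
by exists (n.+1%:R^-1 *: x) => //; rewrite scalerA divff ?scale1r ?pnatr_eq0.
Qed.

Lemma dilate_hull n m (w : 'I_m -> E) : dilate n (hull w) = hull (fun i => n%:R *: w i).
Proof.
have H (c : 'I_m -> R) : \sum_i c i *: (n%:R *: w i) = n%:R *: \sum_i c i *: w i.
  by rewrite scaler_sumr; apply: eq_bigr => i _; rewrite !scalerA mulrC.
apply/seteqP; split => [_ [_ [c [c0 c1 ->]] <-]|_ [c [c0 c1 ->]]].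
  by exists c; rewrite H.
by exists (\sum_i c i *: w i); rewrite ?H//; exists c.
Qed.

Lemma dilate_lattice n F : lattice_polytope F -> lattice_polytope (dilate n F).
Proof.
move=> /lattice_polytopeP[m [w ->]]; rewrite dilate_hull.
exists m, (fun i => w i *+ n); congr hull; apply/funext => i.
by rewrite zptMn.
Qed.

Lemma tangent_cone_dilate n P (v : E) :
  tangent_cone (n.+1%:R *: v) (dilate n.+1 P) = tangent_cone v P.
Proof.
apply/seteqP; split => x [l /= l0].
  move=> [_ [p Pp <-] <-]; exists (l * n.+1%:R); first by rewrite /= mulr_ge0.
  by exists p => //; rewrite -scalerBr scalerA.
move=> [p Pp <-]; exists (l / n.+1%:R); first by rewrite /= divr_ge0.
exists (n.+1%:R *: p); first by exists p.
by rewrite -scalerBr scalerA divfK// pnatr_eq0.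
Qed.

Lemma dirspace_dilate n F : F !=set0 -> dirspace (dilate n.+1 F) = dirspace F.
Proof.
move=> [v Fv]; have nFv : dilate n.+1 F (n.+1%:R *: v) by exists v.
rewrite (dirspaceE nFv); apply: lin_eq => [_ [_ [x Fx <-] <-]|].
  by rewrite /= -scalerBr memvZ// dirspaceB.
rewrite (dirspaceE Fv); apply: lin_sub => _ [x Fx <-] /=.
rewrite -[x - v](scalerK (_ : n.+1%:R != 0 :> R)) ?pnatr_eq0// memvZ//.
by apply: sub_lin; exists (n.+1%:R *: x); [exists x|rewrite scalerBr].
Qed.

Lemma is_face_dilate n F P : is_face F P -> is_face (dilate n.+1 F) (dilate n.+1 P).
Proof.
move=> [[p Fp] [c [b [cb FE]]]]; split; first by exists (n.+1%:R *: p); exists p.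
exists c, (n.+1%:R * b); split => [_ [x Px <-]|].
  by rewrite dotrZr ler_wpM2l// cb.
apply/seteqP; split => [_ [x Fx <-]|x].
  move: Fx; rewrite FE => -[Px cx]; split; first by exists x.
  by rewrite dotrZr cx.
move=> [[y Py <-]]; rewrite dotrZr => /(mulfI _) cy; exists y => //; rewrite FE; split => //.
by apply: cy; rewrite pnatr_eq0.
Qed.

Lemma is_face_dilateV n G P : is_face G (dilate n.+1 P) ->
  exists2 F, is_face F P & G = dilate n.+1 F.
Proof.
move=> [[p Gp] [c [b [cb GE]]]].
exists [set x | G (n.+1%:R *: x)]; last first.
  apply/seteqP; split => [x Gx|_ [x Gx <-]//].
  by apply/dilateP; rewrite /= scalerA divff ?scale1r// pnatr_eq0.
split; first by exists (n.+1%:R^-1 *: p); rewrite /= scalerA divff ?scale1r// pnatr_eq0.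
exists c, (n.+1%:R^-1 * b); split => [x Px|].
  by rewrite ler_pdivlMl// -dotrZr; apply: cb; exists x.
apply/seteqP; split => x /=; rewrite GE.
  move=> [/dilateP]; rewrite scalerA mulVf ?scale1r ?pnatr_eq0// => Px.
  by rewrite dotrZr => <-; rewrite mulrA mulVf ?mul1r// pnatr_eq0.
move=> [Px cx]; split; first by exists x.
by rewrite dotrZr cx mulrA divff ?mul1r// pnatr_eq0.
Qed.

Lemma faces_dilate n k P : faces k (dilate n.+1 P) = dilate n.+1 @` faces k P.
Proof.
apply/seteqP; split => [G [/is_face_dilateV[F fF ->] Gk]|_ [F [fF Fk] <-]].
  exists F => //; split => //; move: Gk; rewrite /adim dirspace_dilate//.
  by case: fF.
split; first exact: is_face_dilate.
by rewrite /adim dirspace_dilate//; case: fF.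
Qed.

Lemma dilate_inj n : injective (@dilate R d n.+1).
Proof.
move=> F G FG; apply/seteqP; split => x Fx.
  have : dilate n.+1 F (n.+1%:R *: x) by exists x.
  by rewrite FG => /dilateP; rewrite scalerA mulVf ?scale1r// pnatr_eq0.
have : dilate n.+1 G (n.+1%:R *: x) by exists x.
by rewrite -FG => /dilateP; rewrite scalerA mulVf ?scale1r// pnatr_eq0.
Qed.

Lemma face_lattice_polytope F P : lattice_polytope P -> is_face F P ->
  lattice_polytope F /\ exists v : 'rV[int]_d, F (zpt v).
Proof.
move=> /lattice_polytopeP[m [w ->]] fF; have [f FE wF] := face_hull fF; split.
  by rewrite FE; exists m, (w \o f).
have [[x]] := fF; rewrite FE => -[c [_ c1 _]] _.
case: m c c1 w fF f FE wF => [c|m _ _ w fF f FE wF].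
  by rewrite big_ord0 => /esym/eqP; rewrite oner_eq0.
by exists (w (f ord0)); rewrite -FE.
Qed.

Lemma face_sub_dilate n F P x : is_face F P -> dilate n.+1 F x -> dilate n.+1 P x.
Proof. by move=> [_ [c [b [_ ->]]]] [y [Py _] <-]; exists y. Qed.

Lemma solid_angle_normal_dilate n F P : lattice_polytope P -> is_face F P ->
  solid_angle (normal_cone (dilate n.+1 F) (dilate n.+1 P)) = solid_angle (normal_cone F P).
Proof.
move=> lP fF; have [m [w PE]] := lattice_polytopeP lP.
have [[v Fv] _] := fF.
have nFv : dilate n.+1 F (n.+1%:R *: v) by exists v.
have nfF := is_face_dilate n fF; have nPE := dilate_hull n.+1 (fun i => zpt (w i) : E).
have := solid_angle_normal_cone (_ : is_face (dilate n.+1 F) (hull _)) nFv.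
rewrite PE nPE in fF nfF *; move=> -> //; rewrite -nPE tangent_cone_dilate.
rewrite dirspace_dilate; last by exists v.
by rewrite -(solid_angle_normal_cone fF Fv).
Qed.

End dilation.

(** * Passage to the limit *)

Section asymptotics.
Context {R : realType} {d : nat}.
Local Notation E := 'rV[R]_d.
Implicit Types (L W : {vspace E}) (S A B C P Q F : set E).
Local Notation realmx M := (map_mx intr M : 'M[R]_(_, _)).

(** The integer differences of generators span the direction space, so a lattice basis exists and
    [lattice_det] is computed from a genuine one. *)
Lemma latticeP F : lattice_polytope F -> F !=set0 ->
  exists B : 'M[int]_(\dim (dirspace F), d),
  [/\ row_free (realmx B),
      forall z, (zpt z \in dirspace F) <-> exists c : 'rV[int]_(\dim (dirspace F)), z = c *m B
    & lattice_det (dirspace F) = Num.sqrt (\det (realmx B *m (realmx B)^T))].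
Proof.
move=> /lattice_polytopeP[m [w FE]] [x0 Fx0]; set L := dirspace F.
rewrite /lattice_det; set S := (X in xget 0 X).
suff [fB HB] : S (xget 0 S) by exists (xget 0 S).
suff SB : exists B : 'M[int]_(\dim L, d), S B by exact: (@xgetPex _ 0 S SB).
have [i0 _] : exists i0 : 'I_m, True.
  move: Fx0; rewrite FE => -[c [_ c1 _]]; case: m c c1 w FE => [c|m _ _ _ _]; last by exists ord0.
  by rewrite big_ord0 => /esym/eqP; rewrite oner_eq0.
apply: (@lattice_basis_exists _ _ L _ (\matrix_i (w i - w i0))) => x.
have Fw i : F (zpt (w i)) by rewrite FE; exact: (mem_hull (fun i => zpt (w i))).
have rowE i : row i (realmx (\matrix_i (w i - w i0))) = zpt (w i) - zpt (w i0).
  by rewrite -map_row rowK -zptB.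
split=> [|/submxP[c ->]]; last first.
  by rewrite mulmx_sum_row memv_suml// => i _; rewrite memvZ// rowE dirspaceB.
rewrite /L (dirspaceE (Fw i0)); apply: sub_mxvs => _ [y Fy <-].
move: Fy; rewrite FE => -[c [_ c1 ->]].
have -> : \sum_i c i *: zpt (w i) - zpt (w i0) = \sum_i c i *: (zpt (w i) - zpt (w i0)) :> E.
  by under [RHS]eq_bigr do rewrite scalerBr; rewrite sumrB -scaler_suml c1 scale1r.
by apply: summx_sub => i _; rewrite scalemx_sub// -rowE row_sub.
Qed.

(** In orthonormal coordinates the integer points of [L] become the lattice of the rows of [M],
    whose cell has volume [lattice_det L]; [lattice_sum_cvg] applies with the solid angles as
    weights. *)
Lemma solid_angle_sum_cvg F : lattice_polytope F -> F !=set0 ->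
  (fun n : nat => (lattice_det (dirspace F) *
      \sum_(v \in latpts (dilate n F)) solid_angle (tangent_cone (zpt v) (dilate n F)))
      / n%:R ^+ (adim F)) @ \oo --> rvol F.
Proof.
move=> lF F0; have [B [fB LB latE]] := latticeP lF F0.
set L := dirspace F in B fB LB latE *.
have cF := lattice_polytope_convex lF; have clF := lattice_polytope_closed lF.
have [b0 Fb0] := lattice_polytope_bounded lF.
have [m [w FE]] := lattice_polytopeP lF.
have [v0 Fv0] : exists v0 : 'rV[int]_d, F (zpt v0).
  have [i _] : exists i : 'I_m, True.
    have [x0] := F0; rewrite FE => -[c [_ c1 _]]; case: m c c1 w FE => [c|m' _ _ _ _]; last by exists ord0.
    by rewrite big_ord0 => /esym/eqP; rewrite oner_eq0.
  by exists (w i); rewrite FE; exact: (mem_hull (fun i => zpt (w i))).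
pose O := orthonormal_basis L; have OO : O *m O^T = 1%:M by exact: ob_orth.
have BO : realmx B *m O^T *m O = realmx B.
  apply/row_matrixP => i; rewrite !row_mul; apply: obK.
  rewrite -map_row; apply/LB; exists (delta_mx 0 i); exact: rowE.
pose M := realmx B *m O^T.
have MM : M *m M^T = realmx B *m (realmx B)^T.
  by rewrite -{2}BO [in RHS]trmx_mul mulmxA.
have uM : M \in unitmx.
  rewrite -row_free_unit -kermx_eq0; apply/rowV0P => c /sub_kermxP cM.
  have /eqP : c *m realmx B = 0 by rewrite -BO mulmxA cM mul0mx.
  by rewrite mulmx_free_eq0// => /eqP.
have latM : lattice_det L = vol (par M).
  by rewrite latE -MM det_mulmx det_tr -expr2 sqrtr_sqr vol_par.
pose Q := [set y : 'rV[R]_(\dim L) | F (zpt v0 + y *m O)].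
have bodyQ : convex_body Q.
  split.
  - rewrite (_ : Q = [set y | F (y *m O + zpt v0)]); last first.
      by apply/funext => y; rewrite /Q/= addrC.
    by apply: rVmeas_affine; exact: rVmeas_closed.
  - have [C C0 HC] := norm_mulmx_le O^T.
    exists (C * (b0 + `|zpt v0 : E|)) => y /Fb0 yb.
    rewrite -[y]mulmx1 -OO mulmxA (le_trans (HC _))// ler_pM2l//.
    by rewrite -[y *m O](addKr (zpt v0)) addrC (le_trans (ler_normB _ _))// lerD2r.
  - move=> s t x y Qx Qy s0 t0 st; rewrite /Q/=.
    have -> : zpt v0 + (s *: x + t *: y) *m O =
        s *: (zpt v0 + x *m O) + t *: (zpt v0 + y *m O).
      by rewrite mulmxDl -!scalemxAl !scalerDr addrACA -scalerDl st scale1r.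
    exact: cF.
  - have [p [Fp [e e0 He]]] : relint F !=set0.
      by rewrite FE; apply: relint_hull; rewrite -FE.
    have pL : p - zpt v0 \in L by exact: dirspaceB.
    exists ((p - zpt v0) *m O^T), (e / (\dim L).+1%:R); first by rewrite divr_gt0.
    move=> y yq; apply: He.
      by apply/(affP _ Fv0); rewrite addrC addKr; exact: mem_ob.
    have -> : zpt v0 + y *m O - p = (y - (p - zpt v0) *m O^T) *m O.
      by rewrite mulmxBl obK// opprB addrCA addrA.
    rewrite enorm_ob (le_lt_trans (enorm_le_norm _))//.
    rewrite (le_lt_trans (ler_wpM2l _ yq))// mulrCA -ltr_pdivlMl// mulVf ?gt_eqF//.
    by rewrite ltr_pdivrMr// mul1r ltr_nat.
(* The integer points of the affine hull of [n F] are parametrized from the base point [v0 *+ n]. *)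
pose g n (z : 'rV[int]_(\dim L)) :=
  solid_angle (tangent_cone (zpt (v0 *+ n + z *m B)) (dilate n F)).
have zptE n z : zpt (v0 *+ n + z *m B) = n%:R *: zpt v0 + (zpt z *m M) *m O :> E.
  rewrite zptD; congr (_ + _); first exact: zptMn.
  by rewrite -mulmxA BO /zpt map_mxM.
have QE n z : Q (n.+1%:R^-1 *: (zpt z *m M)) <-> dilate n.+1 F (zpt (v0 *+ n.+1 + z *m B)).
  rewrite dilateP zptE scalerDr scalerA mulVf ?pnatr_eq0// scale1r /Q/=.
  by rewrite -scalemxAl.
have lnF n : lattice_polytope (dilate n F) by exact: dilate_lattice.
have gE n z : Q (n.+1%:R^-1 *: (zpt z *m M)) ->
    g n.+1 z = ang L (tangent_cone (zpt (v0 *+ n.+1 + z *m B)) (dilate n.+1 F)).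
  move=> /QE Fz; rewrite /g solid_angle_tangent_cone//.
  - by rewrite dirspace_dilate.
  - exact: lattice_polytope_closed.
  - exact: lattice_polytope_convex.
have g01 n z : Q (n.+1%:R^-1 *: (zpt z *m M)) -> 0 <= g n.+1 z <= 1.
  move=> Qz; rewrite gE// ang_ge0 ang_le1//; apply: rVmeas_tangent_cone.
  - exact: lattice_polytope_closed.
  - exact: lattice_polytope_convex.
  - exact/QE.
have g1 n z : (forall u, `|u| <= 1 -> Q (n.+1%:R^-1 *: (zpt z *m M + u))) -> g n.+1 z = 1.
  move=> H; have Qz : Q (n.+1%:R^-1 *: (zpt z *m M)).
    by have := H 0; rewrite normr0 addr0; apply.
  rewrite gE//; apply: ang_eq1 => x xL; apply/tangent_coneP; first exact/QE.
  pose u := x *m O^T; have u1 : 0 < `|u| + 1 by rewrite ltr_wpDl.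
  (* Scales any direction of [L] to coordinates of norm at most 1, where the hypothesis on [z] puts
     the point in [n F]; the tangent cone is thus all of [L]. *)
  exists (`|u| + 1)^-1; first by rewrite invr_gt0.
  have := H ((`|u| + 1)^-1 *: u); rewrite normrZ gtr0_norm ?invr_gt0//.
  rewrite mulrC ler_pdivrMr// mul1r lerDl ler01 => /(_ isT) Qu.
  rewrite dilateP zptE -addrA scalerDr scalerA mulVf ?pnatr_eq0// scale1r.
  move: Qu; rewrite /Q/= -!scalemxAl mulmxDl -scalemxAl obK//.
have sE n : \sum_(v \in latpts (dilate n.+1 F)) solid_angle (tangent_cone (zpt v) (dilate n.+1 F)) =
    \sum_(z \in [set z | Q (n.+1%:R^-1 *: (zpt z *m M))]) g n.+1 z.
  apply: (reindex_fsbig (fun z => v0 *+ n.+1 + z *m B)); split.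
  - by move=> z /QE.
  - move=> z z' _ _ /addrI/(congr1 (fun x => zpt x : E)); rewrite /zpt !map_mxM => /eqP.
    rewrite -subr_eq0 -mulmxBl mulmx_free_eq0// subr_eq0 => /eqP zz'.
    exact: (@zpt_inj R).
  - move=> v Fv; have [c vc] : exists c, v - v0 *+ n.+1 = c *m B.
      apply/LB; rewrite zptB zptMn.
      rewrite -[zpt v](scalerKV (_ : n.+1%:R != 0 :> R)) ?pnatr_eq0//.
      by rewrite -scalerBr memvZ// dirspaceB//; apply/dilateP.
    have vE : v = v0 *+ n.+1 + c *m B by rewrite -vc addrC subrK.
    by exists c; [apply/QE; rewrite -vE|].
(* [rvol] translates by the chosen point [x0] and [Q] by [v0]; the two coordinate sets are
   translates of each other. *)
have rE : rvol F = vol Q.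
  rewrite /rvol /vol_in; set x0 := xget 0 F.
  have Fx0 : F x0 by have [x Fx] := F0; exact: (@xgetPex _ 0 F (ex_intro _ x Fx)).
  have xL : x0 - zpt v0 \in L by exact: dirspaceB.
  have mQ : rVmeas Q by case: bodyQ.
  rewrite -(vol_translate ((x0 - zpt v0) *m O^T) mQ) /vol; congr (fine (lebesgue_rV _)).
  apply/funext => y; rewrite /Q /= mulmxDl obK//; apply/propext.
  rewrite (_ : zpt v0 + (y *m O + (x0 - zpt v0)) = y *m O + x0); last first.
    by rewrite addrC -addrA subrK.
  split=> [[x Fx <-]|Fy]; first by rewrite subrK.
  by exists (y *m O + x0); rewrite ?addrK.
have H := lattice_sum_cvg uM bodyQ g01 g1; rewrite -cvg_shiftS in H.
have {}H := cvgM (cvg_cst (lattice_det L)) H.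
rewrite -cvg_shiftS rE.
have vM : vol (par M) != 0 by rewrite gt_eqF// vol_body_gt0//; exact: convex_body_par.
have -> : vol Q = lattice_det L * (vol Q / vol (par M)) by rewrite latM mulrC divfK.
rewrite [X in X @ _](_ : _ = (fun n : nat => lattice_det L *
    ((\sum_(z \in [set z | Q (n.+1%:R^-1 *: (zpt z *m M))]) g n.+1 z) / n.+1%:R ^+ \dim L))).
  exact: H.
by apply/funext => n; rewrite /= sE mulrA.
Qed.

(** For the limit the sum over faces is made the outer one: faces of the dilate are dilates of
    faces, with the same normal angles and lattice determinants, so only the inner sums depend on
    [n]. *)
Lemma discrete_intrinsic_volume_dilate k n P : lattice_polytope P ->
  discrete_intrinsic_volume k (dilate n.+1 P) =
  \sum_(F \in faces k P) solid_angle (normal_cone F P) * (lattice_det (dirspace F) *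
    \sum_(v \in latpts (dilate n.+1 F)) solid_angle (tangent_cone (zpt v) (dilate n.+1 F))).
Proof.
move=> lP; have lnP : lattice_polytope (dilate n.+1 P) by exact: dilate_lattice.
have ffP : finite_set (faces k P).
  have [m [w ->]] := lattice_polytopeP lP.
  by apply: sub_finite_set (@finite_faces_hull _ _ _ (fun i => zpt (w i))) => F [].
rewrite /discrete_intrinsic_volume exchange_fsbig; last 2 first.
- exact/finite_latpts/lattice_polytope_bounded.
- by rewrite faces_dilate; exact: finite_image.
rewrite faces_dilate fsbig_image; last by move=> F G _ _; exact: dilate_inj.
apply: eq_fsbigr => F /set_mem[fF Fk].
have [lF [v0 Fv0]] := face_lattice_polytope lP fF.
have nFv : dilate n.+1 F (zpt (v0 *+ n.+1)) by rewrite zptMn; exists (zpt v0).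
rewrite -(@fsbig_widen _ _ _ _ (latpts (dilate n.+1 F))); last 2 first.
- by move=> v; apply: face_sub_dilate.
- by move=> v [_ nF]; rewrite /preimage/= indicE memNset// !mul0r.
rewrite mulrA mulr_fsumr; apply: eq_fsbigr => v /set_mem Fv.
rewrite indicE mem_set// mul1r (latdetE nFv) dirspace_dilate//; last by exists (zpt v0).
by rewrite (solid_angle_normal_dilate n lP fF) [lattice_det _ * _]mulrC.
Qed.

Lemma discrete_intrinsic_volume_cvg k P : lattice_polytope P ->
  (fun n : nat => discrete_intrinsic_volume k (dilate n P) / n%:R ^+ k : R)
    @ \oo --> (intrinsic_volume k P : R).
Proof.
move=> lP; rewrite -cvg_shiftS.
have ffP : finite_set (faces k P).
  have [m [w ->]] := lattice_polytopeP lP.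
  by apply: sub_finite_set (@finite_faces_hull _ _ _ (fun i => zpt (w i))) => F [].
pose t F n := solid_angle (normal_cone F P) * ((lattice_det (dirspace F) *
  \sum_(v \in latpts (dilate n.+1 F)) solid_angle (tangent_cone (zpt v) (dilate n.+1 F)))
  / n.+1%:R ^+ k).
rewrite [X in X @ _](_ : _ = (fun n => \sum_(F \in faces k P) t F n)); last first.
  apply/funext => n /=; rewrite discrete_intrinsic_volume_dilate// mulr_fsuml.
  by apply: eq_fsbigr => F _; rewrite /t -[LHS]mulrA.
rewrite /intrinsic_volume fsbig_finite//= big_seq.
under eq_fun do rewrite fsbig_finite//= big_seq.
apply: cvg_big => [|F]; first exact: add_continuous.
rewrite in_fset_set// => /set_mem[fF Fk].
apply: cvgM; first exact: cvg_cst.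
have [lF [v0 Fv0]] := face_lattice_polytope lP fF.
have := solid_angle_sum_cvg lF (ex_intro _ _ Fv0); rewrite Fk.
by rewrite -cvg_shiftS.
Qed.

End asymptotics.

Theorem theorem1p1 (R : realType) (d : nat) (d_ge1 : (1 <= d)%N) :
  (forall k : nat, (k <= d)%N ->
     valuation (@discrete_intrinsic_volume R d k) /\
     translation_invariant (@discrete_intrinsic_volume R d k)) /\
  (forall P : set 'rV[R]_d, lattice_polytope P ->
     [/\ P !=set0 -> discrete_intrinsic_volume 0 P = 1,
         discrete_intrinsic_volume d P = solid_angle_valuation P,
         forall k : nat, (k <= d)%N -> (adim P < k)%N ->
           discrete_intrinsic_volume k P = 0
       & forall k : nat, (k <= d)%N ->
           (fun n : nat =>
              discrete_intrinsic_volume k (dilate n P) / n%:R ^+ k : R)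
             @ \oo --> (intrinsic_volume k P : R)]).
Proof.
split=> [k _|P lP].
  split; first exact: discrete_intrinsic_volume_valuation.
  exact: discrete_intrinsic_volume_translation.
split.
- exact: discrete_intrinsic_volume0.
- exact: discrete_intrinsic_volume_full.
- by move=> k _; exact: discrete_intrinsic_volume_dim.
- by move=> k _; exact: discrete_intrinsic_volume_cvg.
Qed.
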